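(* Let $(c_i)_{i\in\mathbb{Z}^d}$ be a family of rate functions $c_i:A\times S\to(0,\infty)$, measurable for the product sigma-field, such that for $\varrho$-almost all $a$ the map $\eta\mapsto c_i(a,\eta)$ is continuous, and such that $\sup_{i}\sup_{\eta}\int_A c_i(a,\eta)\varrho(da)<\infty$ and $$\sup_{i\in\mathbb{Z}^d}\int_A\ \sup_{\eta,\zeta:\ \eta(V_i(k))=\zeta(V_i(k))}|c_i(a,\eta)-c_i(a,\zeta)|\,\varrho(da)\longrightarrow 0\quad\text{as }k\to\infty.$$ Let $(\sigma_t)$ be the process with generator $\mathcal{G}$, and let $N^{(F)}_{\mathrm{STOP}}$ be the number of steps of the backward sketch procedure (Algorithm 1) started from $F$, with law $P_{\mathrm{sketch}}$, all as described in the context. Suppose that $$P_{\mathrm{sketch}}\big(N^{(F)}_{\mathrm{STOP}}<\infty\big)=1\qquad\text{for all finite }F\subset\mathbb{Z}^d.$$ Then: (1) Algorithms 1 and 2 are successful, i.e. for each finite $F$ they stop almost surely after a finite number of steps (and produce an output $\{(i,\sigma(i)):i\in F\}$). (2) The process $(\sigma_t)$ admits a unique invariant probability measure $\mu$, and for each finite $F\subset\mathbb{Z}^d$ the law of the set $\{(i,\sigma(i)):i\in F\}$ output at the end of Algorithms 1 and 2 is the projection of $\mu$ on $A^F$.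
   Context: $A\subset\mathbb{R}$ is a Borel set with its Borel sigma-field, $\varrho$ is a finite nonzero nonnegative measure on $A$, and $S=A^{\mathbb{Z}^d}$ carries the product topology and product sigma-field. For $i\in\mathbb{Z}^d$, $\|i\|=\sum_{m=1}^d|i_m|$, and $V_i(k)=\{j\in\mathbb{Z}^d:\|j-i\|\le k\}$ for $k\ge0$. For $V\subset\mathbb{Z}^d$, $\eta(V)\in A^V$ is the restriction of $\eta$ to $V$. For $a\in A$, $\eta^{i,a}$ is the configuration equal to $a$ at $i$ and to $\eta$ elsewhere. Let $\Delta\notin A$ be an extra symbol, $A^*=A\cup\{\Delta\}$, $\varrho^*=\varrho+\delta_\Delta$, and $\eta^{i,\Delta}=\eta$ by convention. Define $$M_i=\sup_{\eta\in S}\int_A c_i(a,\eta)\varrho(da),\qquad c_i(\Delta,\eta)=M_i-\int_A c_i(a,\eta)\varrho(da),$$ $$\alpha_i(-1)=\int_{A^*}\inf_{\zeta\in S}c_i(a,\zeta)\,\varrho^*(da),\qquad \alpha_i(k)=\inf_{w\in A^{V_i(k)}}\int_{A^*}\ \inf_{\zeta:\zeta(V_i(k))=w}c_i(a,\zeta)\,\varrho^*(da)\quad(k\ge0),$$ $$\lambda_i(-1)=\frac{\alpha_i(-1)}{M_i},\qquad \lambda_i(k)=\frac{\alpha_i(k)-\alpha_i(k-1)}{M_i}\quad(k\ge0).$$ Then $(\lambda_i(k))_{k\ge-1}$ is a probability distribution on $\{-1,0,1,\dots\}$, and there are a probability density $p_i^{[-1]}$ on $A$ with respect to $\varrho$ and,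 for $k\ge0$, conditional probability densities $p_i^{[k]}(\cdot\mid w)$, $w\in A^{V_i(k)}$, on $A^*$ with respect to $\varrho^*$, such that for all $\eta$ and $\varrho^*$-almost all $a\in A^*$ (with $p_i^{[-1]}(\Delta)=0$) $$c_i(a,\eta)=M_i\Big[\lambda_i(-1)p_i^{[-1]}(a)+\sum_{k\ge0}\lambda_i(k)p_i^{[k]}(a\mid\eta(V_i(k)))\Big].$$ Fix such densities. The process: standing assumption is that $$\sup_{i\in\mathbb{Z}^d}\sum_{j\neq i}\sup_\eta\sup_{b\in A}\int_A\varrho(da)\,|c_i(a,\eta)-c_i(a,\eta^{j,b})|<\infty,$$ and $(\sigma_t)$ is the (Feller) Markov process on $S$ whose generator is, on cylinder functions, $$\mathcal{G}f(\eta)=\sum_{i\in\mathbb{Z}^d}\int_A\varrho(da)\,c_i(a,\eta)[f(\eta^{i,a})-f(\eta)].$$ Equivalently, its dynamics is the following: each site $i$ carries an independent rate-$M_i$ Poisson clock; when the clock of $i$ rings at time $t$, a range $k\ge -1$ is chosen with probability $\lambda_i(k)$ independently of everything else, and then a symbol in $A^*$ is chosen with law $p_i^{[-1]}d\varrho$ if $k=-1$, or $p_i^{[k]}(\cdot\mid\sigma_{t-}(V_i(k)))\,d\varrho^*$ if $k\ge0$; the value at $i$ is replaced by this symbol if it lies in $A$ and is left unchanged if it is $\Delta$. Algorithm 1 (backward sketch procedure), input a finite $F\subset\mathbb{Z}^d$: set $N=0$, $C=F$. While $C\ne\varnothing$: increase $N$ by $1$; choose at random, independently of the past given $C$, a pair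 $(I,K)$ with $I\in C$, $K\ge-1$ and $$P(I=i,K=k)=\frac{M_i\lambda_i(k)}{\sum_{j\in C}\sum_{l\ge-1}M_j\lambda_j(l)};$$ if $K=-1$ replace $C$ by $C\setminus\{I\}$, otherwise replace $C$ by $C\cup V_I(K)$; record $B(N)=(I,K)$. When $C=\varnothing$, set $N^{(F)}_{\mathrm{STOP}}=N$ and return $N^{(F)}_{\mathrm{STOP}}$ and $B$ (put $N^{(F)}_{\mathrm{STOP}}=\infty$ if $C$ never becomes empty). $P_{\mathrm{sketch}}$ denotes the probability associated with this procedure. Algorithm 2 (forward spin assignment), input $N^{(F)}_{\mathrm{STOP}}$ and $B$: set $\sigma(j)=\Delta$ for all $j\in\mathbb{Z}^d$. For $N=N^{(F)}_{\mathrm{STOP}},N^{(F)}_{\mathrm{STOP}}-1,\dots,1$ successively: let $(I,K)=B(N)$; if $K=-1$ choose $W\in A$ with law $p_I^{[-1]}d\varrho$, otherwise choose $W\in A^*$ with law $p_I^{[K]}(\cdot\mid\sigma(V_I(K)))\,d\varrho^*$ (independently of everything else); if $W\ne\Delta$ set $\sigma(I)=W$. Return $\{(i,\sigma(i)):i\in F\}$. *)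

(* Defs.v *)
From HB Require Import structures.
From mathcomp Require Import all_boot all_order all_algebra finmap zify.
From mathcomp Require Import all_classical all_reals all_analysis measurable_realfun.
Set Implicit Arguments.
Unset Strict Implicit.
Unset Printing Implicit Defensive.
Import Order.TTheory GRing.Theory Num.Theory.
Import numFieldNormedType.Exports.

Local Open Scope classical_set_scope.
Local Open Scope ring_scope.

(* Measurable types of the library are pointed, hence [bset_neq0]; the measures
   put on [A] below are nonzero, so this excludes nothing. *)
Record borelSet (R : realType) := BorelSet {
  bset :> set R ;
  bset_measurable : measurable bset ;
  bset_neq0 : bset !=set0 }.

Definition spin (R : realType) (A : borelSet R) : Type := set_type (bset A).

Section spin.
Context (R : realType) (A : borelSet R).

Definition spin_val (a : spin A) : R := val a.

Lemma spin_inhabited : exists a : spin A, True.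
Proof. by have [x Ax] := bset_neq0 A; exists (exist _ x (mem_set Ax)). Qed.

HB.instance Definition _ := Choice.copy (spin A) (set_type (bset A)).
HB.instance Definition _ := isPointed.Build (spin A) (sval (cid spin_inhabited)).
HB.instance Definition _ := Topological.copy (spin A) (set_type (bset A)).

(* the trace on [A] of the Borel sigma-field of [R] *)
Let spin_measurable := preimage_set_system setT spin_val (@measurable _ R).

Let spin_sigma : sigma_algebra setT spin_measurable.
Proof.
exact/sigma_algebra_preimage/(sigma_algebra_measurable (measurableTypeR R)).
Qed.

Let spin0 : spin_measurable set0. Proof. by case: spin_sigma. Qed.
Let spinC B : spin_measurable B -> spin_measurable (~` B).
Proof. by case: spin_sigma => _ + _ => /[apply]; rewrite setTD. Qed.
Let spinU (F : (set (spin A))^nat) :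
  (forall n, spin_measurable (F n)) -> spin_measurable (\bigcup_n F n).
Proof. by case: spin_sigma => _ _; exact. Qed.

HB.instance Definition _ := @isMeasurable.Build (preimage_display spin_val)
  (spin A) spin_measurable spin0 spinC spinU.

End spin.

(* [power I T] is [T^I] with the product topology and product sigma-field. *)
Definition power (I : Type) (T : Type) : Type := I -> T.

Definition power_display (I : Type) : measure_display -> measure_display.
Proof. exact. Qed.

HB.instance Definition _ (I : Type) (T : pointedType) :=
  Pointed.copy (power I T) (I -> T).
HB.instance Definition _ (I : Type) (T : topologicalType) :=
  Topological.copy (power I T) (prod_topology (fun _ : I => T)).

Section power_measurable.
Context (dT : measure_display) (T : measurableType dT) (I : Type).

Let cylinders : set (set (power I T)) :=
  \bigcup_(i in [set: I])
    preimage_set_system setT (fun f : power I T => f i) (@measurable _ T).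

Let power0 : <<s cylinders >> set0. Proof. exact: sigma_algebra0. Qed.
Let powerC B : <<s cylinders >> B -> <<s cylinders >> (~` B).
Proof. exact: sigma_algebraC. Qed.
Let powerU (F : (set (power I T))^nat) :
  (forall n, <<s cylinders >> (F n)) -> <<s cylinders >> (\bigcup_n F n).
Proof. exact: sigma_algebra_bigcup. Qed.

HB.instance Definition _ := @isMeasurable.Build (power_display I dT)
  (power I T) <<s cylinders >> power0 powerC powerU.

End power_measurable.

(* [A^* = A + {Delta}] is [option A], with [Delta = None]. *)
Definition option_display : measure_display -> measure_display.
Proof. exact. Qed.

Section option_measurable.
Context (dT : measure_display) (T : measurableType dT).

Let option_measurable (B : set (option T)) := measurable (Some @^-1` B).

Let option0 : option_measurable set0.
Proof. by rewrite /option_measurable preimage_set0. Qed.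
Let optionC B : option_measurable B -> option_measurable (~` B).
Proof. by rewrite /option_measurable preimage_setC; exact: measurableC. Qed.
Let optionU (F : (set (option T))^nat) :
  (forall n, option_measurable (F n)) -> option_measurable (\bigcup_n F n).
Proof. by rewrite /option_measurable preimage_bigcup; exact: bigcupT_measurable. Qed.

HB.instance Definition _ := @isMeasurable.Build (option_display dT)
  (option T) option_measurable option0 optionC optionU.

Lemma measurable_Some : measurable_fun [set: T] (@Some T).
Proof. by move=> _ B mB; rewrite setTI. Qed.

Context (R : realType) (mu : {measure set T -> \bar R}).

(* [star rho] is [rho + delta_Delta]. *)
Definition star (B : set (option T)) : \bar R :=
  (mu (Some @^-1` B) + \d_(@None T) B)%E.

Let star_sum : {measure set (option T) -> \bar R} := measure_add
  (measure_function_pushforward__canonical__measure_function_Measure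
    mu measurable_Some)
  (\d_(@None T)).

Let starE : star = star_sum.
Proof. by apply/funext => B; exact/esym/measure_addE. Qed.

Let star0 : star set0 = 0%E. Proof. by rewrite starE measure0. Qed.
Let star_ge0 B : (0 <= star B)%E. Proof. by rewrite starE measure_ge0. Qed.
Let star_sigma_additive : semi_sigma_additive star.
Proof. by rewrite starE; exact: measure_semi_sigma_additive. Qed.

HB.instance Definition _ := isMeasure.Build _ (option T) R star
  star0 star_ge0 star_sigma_additive.

End option_measurable.

Definition site (d : nat) := 'rV[int]_d.

Definition norm1 (d : nat) (i : site d) : nat := (\sum_(m < d) `|i ord0 m|)%N.

(* [V_ i k] is the ball of radius [k] around [i]. *)
Definition V_ (d : nat) (i : site d) (k : nat) : {fset site d} :=
  fset_set [set j | (norm1 (j - i)%R <= k)%N].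

Lemma finite_V (d : nat) (i : site d) (k : nat) :
  finite_set [set j : site d | (norm1 (j - i)%R <= k)%N].
Proof.
pose f (g : {ffun 'I_d -> 'I_(k.*2.+1)}) : site d :=
  \row_m (i ord0 m + ((g m)%:Z - k%:Z)).
apply: (@sub_finite_set _ _ (f @` setT)); last exact/finite_image/finite_finset.
move=> j /= jk; pose z m : int := j ord0 m - i ord0 m.
have zk m : (`|z m| <= k)%N.
  apply: leq_trans jk; rewrite /norm1 (bigD1 m)//= !mxE.
  exact: leq_addr.
have lt m : (`|(z m + k%:Z)%R|%N < k.*2.+1)%N by move: (zk m); lia.
exists [ffun m => Ordinal (lt m)] => //.
apply/rowP => m; rewrite !mxE ffunE /= abszE ger0_norm; last by move: (zk m); lia.
by rewrite addrK /z addrCA subrr addr0.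
Qed.

Lemma in_V (d : nat) (i j : site d) (k : nat) :
  (j \in V_ i k) = (norm1 (j - i)%R <= k)%N.
Proof.
rewrite (in_fset_set (finite_V i k)).
by apply/idP/idP => [/set_mem//|jk]; exact/mem_set.
Qed.

(* The restriction [eta(V)]. *)
Definition restr (I : choiceType) (T : Type) (V : {fset I}) (eta : power I T) :
  power V T := fun j => eta (val j).
Arguments restr {I T} V eta.

Section dynamics.
Context (R : realType) (d : nat) (A : borelSet R).
Local Notation S := (power (site d) (spin A)).

(* [upd eta i a] is [eta^{i,a}]. *)
Definition upd (eta : S) (i : site d) (a : spin A) : S :=
  fun j => if j == i then a else eta j.

Definition cylinder_fun (f : S -> R) :=
  exists V : {fset site d}, forall eta zeta,
    restr V eta = restr V zeta -> f eta = f zeta.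

Context (rho : {finite_measure set (spin A) -> \bar R}).
Context (c : site d -> spin A -> S -> R).

(* The sum has finite support when [f] is a cylinder function. *)
Definition generator (f : S -> R) (eta : S) : R :=
  \sum_(i \in [set: site d])
    \int[rho]_a (c i a eta * (f (upd eta i a) - f eta)).

(* [P t eta] is the law of [sigma_t] for the process started from [eta]; only
   times [t >= 0] matter. *)
Definition markov_semigroup (P : R -> R.-pker S ~> S) : Prop :=
  (forall eta B, measurable B -> P 0 eta B = \d_eta B) /\
  (forall s t eta B, 0 <= s -> 0 <= t -> measurable B ->
     P (s + t) eta B = (\int[P s eta]_zeta P t zeta B)%E).

Definition expect (P : R -> R.-pker S ~> S) (t : R) (f : S -> R) (eta : S) : R :=
  \int[P t eta]_zeta f zeta.

Definition feller (P : R -> R.-pker S ~> S) : Prop :=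
  forall t f, 0 <= t -> continuous f -> [bounded f eta | eta in [set: S]] ->
    continuous (expect P t f).

(* [(P_t f - f) / t] tends to [G f] in sup norm as [t -> 0+]. *)
Definition has_generator (P : R -> R.-pker S ~> S) : Prop :=
  forall f, continuous f -> [bounded f eta | eta in [set: S]] -> cylinder_fun f ->
    ereal_sup (range (fun eta =>
      `|(expect P t f eta - f eta) / t - generator f eta|%:E)) @[t --> 0^'+]
      --> 0%E.

(* [(sigma_t)] is represented by its transition semigroup. *)
Definition process (P : R -> R.-pker S ~> S) : Prop :=
  [/\ markov_semigroup P, feller P & has_generator P].

Definition invariant_law (P : R -> R.-pker S ~> S) (mu : probability S R) : Prop :=
  forall t B, 0 <= t -> measurable B -> (\int[mu]_eta P t eta B)%E = mu B.

Definition M_ (i : site d) : R :=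
  fine (ereal_sup (range (fun eta => (\int[rho]_a (c i a eta)%:E)%E))).

(* The rates extended to [A^*]: [c_i(Delta, eta)] compensates the missing mass. *)
Definition cstar (i : site d) (a : option (spin A)) (eta : S) : R :=
  if a is Some b then c i b eta else M_ i - \int[rho]_b c i b eta.

Definition alpha_m1 (i : site d) : R :=
  fine (\int[star rho]_a ereal_inf (range (fun zeta => (cstar i a zeta)%:E)))%E.

Definition alpha (i : site d) (k : nat) : R :=
  fine (ereal_inf (range (fun w : power (V_ i k) (spin A) =>
    (\int[star rho]_a ereal_inf
       [set (cstar i a zeta)%:E | zeta in [set zeta | restr (V_ i k) zeta = w]])%E))).

(* Ranges [k >= -1] are encoded in [option nat], [None] being [-1]. *)
Definition lambda (i : site d) (k : option nat) : R :=
  match k with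
  | None => alpha_m1 i / M_ i
  | Some 0 => (alpha i 0 - alpha_m1 i) / M_ i
  | Some k'.+1 => (alpha i k'.+1 - alpha i k') / M_ i
  end.

Definition condDensity :=
  forall (i : site d) (k : nat), option (spin A) -> power (V_ i k) (spin A) -> R.

Context (pm1 : site d -> spin A -> R) (pk : condDensity).
Arguments pk : clear implicits.

(* [p_i^{[-1]}] extended to [A^*] by [0] at [Delta] *)
Definition pm1star (i : site d) (a : option (spin A)) : R :=
  if a is Some b then pm1 i b else 0.

Definition decomposition : Prop :=
  [/\ (forall i, [/\ measurable_fun setT (pm1 i), forall a, 0 <= pm1 i a &
         (\int[rho]_a (pm1 i a)%:E)%E = 1%E]),
      (forall i k,
         measurable_fun setT
           (fun x : option (spin A) * power (V_ i k) (spin A) => pk i k x.1 x.2)),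
      (forall i k (w : power (V_ i k) (spin A)),
         (forall a, 0 <= pk i k a w) /\
         (\int[star rho]_a (pk i k a w)%:E)%E = 1%E) &
      (forall i eta, {ae star rho, forall a,
         (cstar i a eta)%:E =
           ((M_ i)%:E * ((lambda i None * pm1star i a)%:E +
             \sum_(0 <= k <oo)
                (lambda i (Some k) * pk i k a (restr (V_ i k) eta))%:E))%E})].

Definition mark := (site d * option nat)%type.

Definition step (C : {fset site d}) (r : mark) : {fset site d} :=
  (if r.2 is Some k then C `|` V_ r.1 k else C `\ r.1)%fset.

(* The set [C] after the choices [h], [h] being in chronological order. *)
Definition active (F : {fset site d}) (h : seq mark) : {fset site d} :=
  foldl step F h.

Definition choice_prob (C : {fset site d}) (r : mark) : R :=
  if r.1 \in C then
    M_ r.1 * lambda r.1 r.2 /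
      \sum_(j <- C) fine (\esum_(l in [set: option nat]) (M_ j * lambda j l)%:E)
  else 0.

(* [N_STOP] when the successive choices are [b 0], [b 1], etc; [None] stands for
   infinity. *)
Definition Nstop (F : {fset site d}) (b : nat -> mark) : option nat :=
  match pselect (exists n, active F (mkseq b n) == fset0) with
  | left stops => Some (ex_minn stops)
  | right _ => None
  end.

(* The output [B(1), ..., B(N_STOP)] of Algorithm 1, if it stops. *)
Definition sketch (F : {fset site d}) (b : nat -> mark) : option (seq mark) :=
  omap (mkseq b) (Nstop F b).

(* The procedure has not stopped after the choices [h]. *)
Definition running (F : {fset site d}) (h : seq mark) : Prop :=
  forall n, (n <= size h)%N -> active F (take n h) != fset0.

(* [Some w] if [s] takes values in [A] on [V] and equals [w] there, and [None]
   if [s] takes the value [Delta] on [V]. *)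
Definition spins_on (s : site d -> option (spin A)) (V : {fset site d}) :
    option (power V (spin A)) :=
  match pselect (exists w : power V (spin A), forall j, s (val j) = Some (w j)) with
  | left ex => Some (sval (cid ex))
  | right _ => None
  end.

(* The law of the symbol prescribed by a mark [(I, K)] with [K >= 0] is defined
   only when [s] takes values in [A] on [V_I(K)]. *)
Definition ready (r : mark) (s : site d -> option (spin A)) : Prop :=
  if r.2 is Some k then spins_on s (V_ r.1 k) <> None else True.

(* The density with respect to [rho^*] of the law of the symbol; junk value when
   [~ ready r s]. *)
Definition symbol_density (r : mark) (s : site d -> option (spin A))
    (a : option (spin A)) : R :=
  if r.2 is Some k then
    if spins_on s (V_ r.1 k) is Some w then pk r.1 k a w else 0
  else pm1star r.1 a.

(* The configuration after [m] steps of Algorithm 2, the marks being processed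
   in the order of [h] and the successive symbols [W] being [x 0], [x 1],
   etc. *)
Fixpoint assign (h : seq mark) (x : nat -> option (spin A)) (m : nat) :
    site d -> option (spin A) :=
  if m is n.+1 then
    fun j => if (j == (nth (0, None) h n).1) && (x n != None) then x n
             else assign h x n j
  else fun _ => None.

(* A realization of the two algorithms with input [F] on a probability space:
   [run_mark n] is the pair chosen at the [n.+1]-st step of Algorithm 1 and
   [run_symbol m] the symbol chosen at the [m.+1]-st step of Algorithm 2 (which
   treats the mark [B(N_STOP - m)]); both are meaningless after the last step. *)
Record algorithms (F : {fset site d}) := Algorithms {
  run_display : measure_display ;
  run_space : measurableType run_display ;
  run_prob : probability run_space R ;
  run_mark : nat -> run_space -> mark ;
  run_symbol : nat -> run_space -> option (spin A) ;
  run_mark_measurable : forall n r, measurable [set o | run_mark n o = r] ;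
  run_symbol_measurable : forall m, measurable_fun setT (run_symbol m) ;
  run_mark_law : forall (h : seq mark) (r : mark), running F h ->
    run_prob [set o | mkseq (run_mark ^~ o) (size h).+1 = rcons h r] =
    (run_prob [set o | mkseq (run_mark ^~ o) (size h) = h] *
       (choice_prob (active F h) r)%:E)%E ;
  (* Given the output [h] of Algorithm 1 and the first [m] symbols, the next
     symbol has density [symbol_density]. *)
  run_symbol_law : forall (h : seq mark) (m : nat)
      (phi : power 'I_m (option (spin A)) * option (spin A) -> \bar R),
    (m < size h)%N -> measurable_fun setT phi -> (forall z, (0 <= phi z)%E) ->
    let r := nth (0, None) (rev h) m in
    let state o := assign (rev h) (run_symbol ^~ o) m in
    let past o : power 'I_m (option (spin A)) := fun l => run_symbol l o in
    let E := [set o | sketch F (run_mark ^~ o) = Some h /\ ready r (state o)] in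
    (\int[run_prob]_(o in E) phi (past o, run_symbol m o) =
     \int[run_prob]_(o in E)
       \int[star rho]_a (phi (past o, a) * (symbol_density r (state o) a)%:E))%E }.

Section outputs.
Context (F : {fset site d}) (run : algorithms F).
Local Notation Omega := (run_space run).

Definition run_Nstop (o : Omega) : option nat := Nstop F ((@run_mark _ run) ^~ o).

Definition run_sketch (o : Omega) : option (seq mark) :=
  sketch F ((@run_mark _ run) ^~ o).

Definition run_state (o : Omega) (h : seq mark) (m : nat) :
  site d -> option (spin A) := assign (rev h) ((@run_symbol _ run) ^~ o) m.

(* The output [{(i, sigma(i)) : i in F}] as an element of [A^F]; [None] if
   Algorithm 1 does not stop or if some site of [F] is left with [Delta]. *)
Definition run_output (o : Omega) : option (power F (spin A)) :=
  if run_sketch o is Some h then spins_on (run_state o h (size h)) F else None.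

(* Algorithm 1 stops, each step of Algorithm 2 can be carried out, and it
   returns an element of [A^F]. *)
Definition success : set Omega :=
  [set o | run_output o <> None /\
     exists2 h, run_sketch o = Some h &
       forall m, (m < size h)%N ->
         ready (nth (0, None) (rev h) m) (run_state o h m)].

Definition stops : set Omega := [set o | run_Nstop o <> None].

End outputs.

End dynamics.

Arguments stops {R d A rho c pm1 pk F} run.
Arguments success {R d A rho c pm1 pk F} run.

(* Main.v *)
(* For a mark [r = (i, k)] let [T_r f] average [f] over the value at [i], drawn
   with the density prescribed by the range [k]; if [f] depends on [F] only, then
   [T_r f] depends on [step F r] only.  The law [law_F] of the output of the two
   algorithms satisfies the first-step equation
     [law_F f = sum_r P(B(1) = r) law_(step F r)(T_r f)]
   and the decomposition of the rates turns the generator into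
     [G f = sum_(i in F) sum_k M_i lambda_i(k) (T_(i,k) f - f)].
   Let [q_n(F)] be the probability that Algorithm 1 started from [F] runs for more
   than [n] steps.  By induction on [n], two solutions of these equations differ by
   at most [q_n(F)] on the functions with values in [0, 1] depending on [F]; since
   [q_n(F)] tends to [0], they agree.  Applied to [law_F] and [law_F'] with
   [F] included in [F'], this gives the consistency of the family, hence a measure
   [mu] by Kolmogorov's theorem.  Applied to [law_F] and [m P_t], it gives
   [m P_t = mu], both for [m = mu] and for [m] invariant: if [M] is the total rate
   of [F], then [phi(t) = m P_t f - law_F f] satisfies, uniformly in [s],
     [|phi(s + t)| <= (1 - t M) |phi(s)| + t M q_(n+1)(F) + o(t)],
   so that [|phi|] stays below [q_(n+1)(F)], [phi] being [0] at time [0] or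
   constant. *)

Require Import Defs.
From HB Require Import structures.
From mathcomp Require Import all_boot all_order all_algebra finmap ring lra.
From mathcomp Require Import all_classical all_reals all_analysis measurable_realfun.
Set Implicit Arguments.
Unset Strict Implicit.
Unset Printing Implicit Defensive.
Import Order.TTheory GRing.Theory Num.Theory.
Import numFieldNormedType.Exports.

Local Open Scope classical_set_scope.
Local Open Scope ring_scope.

(** * Measure-theoretic preliminaries *)

(** The obstacle is that the generator is known on continuous functions only, whereas the densities
    are merely measurable in the configuration, so that [T_r f] need not be continuous even for
    continuous [f]. The induction on [n] therefore runs over all measurable local functions with
    values in [0, 1]. At each stage the inequality for [phi] is proved for continuous [f], the
    induction hypothesis being applied to the functions [T_r f], and the conclusion is extended to
    measurable [f] by approximation in L1. The extension keeps the bound [q_(n+1)(F)] unchanged,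
    because this bound is the same for all [0, 1]-valued functions. The constant [M q_(n+1)(F)] is
    [sum_r M_i lambda_i(k) q_n(step F r)] over the marks at sites of [F], by the recursion of the
    survival probabilities. The convergence of [q_n(F)] to 0 is known for each [F], not uniformly,
    so that [n] tends to infinity only after the induction, with [F] fixed. The process enters
    through its semigroup alone, without clocks. As [A] is an arbitrary Borel set, compactness
    cannot produce the projective limit, which is realized on [0, 1[ instead. *)

Lemma probability_of_measure d (T : measurableType d) (R : realType)
    (m : {measure set T -> \bar R}) : m setT = 1%E ->
  exists p : probability T R, forall B, p B = m B.
Proof.
move=> m1; have mE (p : probability T R) B : mnormalize m p B = m B.
  by rewrite /mnormalize m1 ifF ?onee_eq0//= invr1 mule1.
(* The Dirac mass is only the default value of the normalization, for a total mass 0 or infinity. *)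
by exists (mnormalize m (\d_point : probability T R)) => B; exact: mE.
Qed.

(** * Mixtures of a probability kernel *)

Section mixture.
Context d d' (X : measurableType d) (Y : measurableType d') (R : realType).
Variables (mu : probability X R) (k : R.-pker X ~> Y).

(** The measure [mu] becomes a kernel from [unit] and [k] a kernel ignoring that coordinate, so that
    the mixture is a composition of kernels. *)
Let l (_ : unit) : {measure set X -> \bar R} := mu.
Let ml U : measurable U -> measurable_fun [set: unit] (l ^~ U).
Proof. by move=> mU; exact: measurable_cst. Qed.
HB.instance Definition _ := isKernel.Build _ _ unit X R l ml.
Let l1 x : l x setT = 1%E. Proof. exact: probability_setT. Qed.
HB.instance Definition _ := Kernel_isProbability.Build _ _ unit X R l l1.

Let k' (p : unit * X) : {measure set Y -> \bar R} := k p.2.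
Let mk' U : measurable U -> measurable_fun [set: unit * X] (k' ^~ U).
Proof.
move=> mU; rewrite /k'.
exact: (measurableT_comp (measurable_kernel k U mU) (@measurable_snd _ _ _ _)).
Qed.
HB.instance Definition _ := isKernel.Build _ _ _ _ R k' mk'.
Let k'1 x : k' x setT = 1%E. Proof. exact: prob_kernel. Qed.
HB.instance Definition _ := Kernel_isProbability.Build _ _ _ _ R k' k'1.

Lemma mixture_exists : exists nu : probability Y R,
  forall B, nu B = (\int[mu]_x k x B)%E.
Proof.
pose nu := mkcomp l k' tt.
have nu1 : nu setT = 1%E.
  rewrite /nu /mkcomp/= /kcomp.
  under eq_integral do rewrite /k' prob_kernel.
  by rewrite integral_cst// mul1e l1.
by have [p pE] := probability_of_measure nu1; exists p => B; rewrite pE.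
Qed.

(** Any [nu] agreeing with the mixture is allowed: the lemma serves both for a measure built as a
    mixture and for [P (s + t) eta], which is one by the semigroup property. *)
Lemma ge0_integral_mixture (nu : {measure set Y -> \bar R}) (f : Y -> \bar R) :
  (forall B, measurable B -> nu B = (\int[mu]_x k x B)%E) ->
  (forall y, 0 <= f y)%E -> measurable_fun setT f ->
  (\int[nu]_y f y = \int[mu]_x \int[k x]_y f y)%E.
Proof.
move=> nuE f0 mf.
rewrite (@eq_measure_integral _ _ _ setT (mkcomp l k' tt)).
  exact: (integral_kcomp (l : R.-sfker unit ~> X) (k' : R.-sfker _ ~> Y)).
by move=> B mB _; rewrite nuE.
Qed.

End mixture.

(** * Sums over countable types *)

Section esum_countable.
Context (R : realType) (T : countType).
Implicit Type f : T -> \bar R.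
Local Open Scope ereal_scope.

Let term f (n : nat) : \bar R := if pickle_inv n is Some r then f r else 0.

Let term_ge0 f : (forall r, 0 <= f r) -> forall n, 0 <= term f n.
Proof. by move=> f0 n; rewrite /term; case: pickle_inv. Qed.

(** The encoding [pickle] embeds [T] into the naturals; naturals that encode nothing contribute 0.
    Results on series thereby pass to sums over marks, ranges and words. *)
Lemma esum_series f : (forall r, 0 <= f r) ->
  \esum_(r in [set: T]) f r =
  \sum_(0 <= n <oo) (if pickle_inv n is Some r then f r else 0).
Proof.
move=> f0; rewrite -/(term f) nneseries_esumT; last exact: term_ge0.
rewrite (esumID (range (@choice.pickle T)) setT (term f)); last by move=> *; exact: term_ge0.
rewrite [X in _ + X]esum1 ?adde0; last first.
  move=> n [_ /= nr]; rewrite /term; case E : pickle_inv => [r|]//.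
  exfalso; apply: nr; exists r => //.
  by have := @pickle_invK T n; rewrite /ocancel E.
rewrite setTI esum_image; last by move=> x y _ _; exact: (pcan_inj (@pickleK_inv T)).
by apply: eq_esum => r _; rewrite /term pickleK_inv.
Qed.

Lemma ge0_esumZl f (c : R) : (forall r, 0 <= f r) -> (0 <= c)%R ->
  \esum_(r in [set: T]) (c%:E * f r) = c%:E * \esum_(r in [set: T]) f r.
Proof.
move=> f0 c0; rewrite !esum_series => [|//|r]; last by rewrite mule_ge0.
rewrite -nneseriesZl; last by move=> n _; exact: term_ge0.
by apply: eq_eseriesr => n _; case: pickle_inv => //; rewrite mule0.
Qed.

Context d (X : measurableType d).
Implicit Type g : T -> X -> \bar R.

Lemma measurable_esum g : (forall r x, 0 <= g r x) ->
  (forall r, measurable_fun setT (g r)) ->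
  measurable_fun setT (fun x => \esum_(r in [set: T]) g r x).
Proof.
move=> g0 mg; under eq_fun do rewrite esum_series//.
apply: ge0_emeasurable_sum => [n x _|n _]; first by case: pickle_inv.
by case: pickle_inv => [r|]; [exact: mg|exact: measurable_cst].
Qed.

Lemma ge0_integral_esum (mu : {measure set X -> \bar R}) g :
  (forall r x, 0 <= g r x) -> (forall r, measurable_fun setT (g r)) ->
  \int[mu]_x (\esum_(r in [set: T]) g r x) =
  \esum_(r in [set: T]) \int[mu]_x g r x.
Proof.
move=> g0 mg; rewrite esum_series; last by move=> r; exact: integral_ge0.
under eq_integral do rewrite esum_series//.
rewrite integral_nneseries//; last 2 first.
- by move=> n; case: pickle_inv => [r|]; [exact: mg|exact: measurable_cst].
- by move=> n x _; case: pickle_inv.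
apply: eq_eseriesr => n _; case: pickle_inv => [r//|]; exact: integral0.
Qed.

Lemma measure_esum (mu : {measure set X -> \bar R}) (E : T -> set X) :
  (forall r, measurable (E r)) -> trivIset setT E ->
  mu (\bigcup_r E r) = \esum_(r in [set: T]) mu (E r).
Proof.
move=> mE tE; pose F n := if pickle_inv n is Some r then E r else set0.
have -> : \bigcup_r E r = \bigcup_n F n.
  apply/seteqP; split=> [x [r _ Er]|x [n _]].
    by exists (choice.pickle r) => //; rewrite /F pickleK_inv.
  by rewrite /F; case: pickle_inv => // r Er; exists r.
rewrite measure_semi_bigcup//.
- rewrite esum_series//; apply: eq_eseriesr => n _.
  by rewrite /F; case: pickle_inv => //; rewrite measure0.
- by move=> n; rewrite /F; case: pickle_inv.
- move=> m n _ _ [x []]; rewrite /F.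
  case Em : pickle_inv => [r|//]; case En : pickle_inv => [s|//] Er Es.
  have rs : r = s by apply: tE => //; exists x.
  have := @pickle_invK T m; have := @pickle_invK T n.
  by rewrite /ocancel Em En rs => <- <-.
- apply: bigcupT_measurable => n.
  by rewrite /F; case: pickle_inv.
Qed.

End esum_countable.

(** * Measurability and uniqueness of measures on product spaces *)

Section power_measurability.
Context dT (T : measurableType dT) (I : Type).

Lemma measurable_coord (i : I) : measurable_fun setT (fun x : power I T => x i).
Proof.
move=> _ B mB; rewrite setTI; apply: sub_sigma_algebra.
by exists i => //; exists B => //; rewrite setTI.
Qed.

Lemma measurable_power d (X : measurableType d) (f : X -> power I T) :
  (forall i, measurable_fun setT (fun x => f x i)) -> measurable_fun setT f.
Proof.
move=> mf; apply: (measurability (\bigcup_(i in [set: I])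
    preimage_set_system setT (fun g : power I T => g i) (@measurable _ T))) => //.
by move=> _ [_ [i _ [B mB <-]] <-]; rewrite !setTI; have := mf i measurableT B mB;
   rewrite setTI.
Qed.

Definition box (s : seq (I * set T)) : set (power I T) :=
  [set x | forall p, List.In p s -> p.2 (x p.1)].

Lemma measurable_box s : (forall p, List.In p s -> measurable p.2) ->
  measurable (box s).
Proof.
elim: s => [_|p s IH ms].
  rewrite (_ : box [::] = setT); first exact: measurableT.
  by apply/seteqP; split=> // x _ q [].
rewrite (_ : box (p :: s) = (fun x : power I T => x p.1) @^-1` p.2 `&` box s).
  apply: measurableI; last by apply: IH => q qs; apply: ms; right.
  by rewrite -[_ @^-1` _]setTI; apply: measurable_coord => //; apply: ms; left.
apply/seteqP; split=> x /=.
  by move=> xs; split; [apply: xs; left|move=> q qs; apply: xs; right].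
by move=> [px xs] q [<-//|]; exact: xs.
Qed.

(* [G] need not be stable by intersection: the boxes over lists of elements of
   [G] are, by concatenation. *)
Lemma power_measure_unique (R : realType) (G : set (set T))
    (m1 m2 : {measure set (power I T) -> \bar R}) :
  @measurable _ T = <<s G >> ->
  (m1 setT < +oo)%E ->
  (forall s, (forall p, List.In p s -> G p.2) -> m1 (box s) = m2 (box s)) ->
  forall B, measurable B -> m1 B = m2 B.
Proof.
move=> mG m1oo m12.
pose GG := [set box s | s in [set s | forall p, List.In p s -> G p.2]].
have box0 : box [::] = setT by apply/seteqP; split=> // x _ q [].
have GGm : @measurable _ (power I T) = <<s GG >>.
  apply/seteqP; split.
    apply: smallest_sub; first exact: smallest_sigma_algebra.
    move=> _ [i _ [B mB <-]]; rewrite setTI.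
    suff : measurable_fun (setT : set (g_sigma_algebraType GG))
      (fun x : g_sigma_algebraType GG => (x : power I T) i : T).
      by move=> /(_ measurableT B mB); rewrite setTI.
    apply: (measurability G) => // _ [C GC <-]; rewrite setTI.
    apply: sub_sigma_algebra; exists [:: (i, C)]; first by move=> p [<-|//].
    by apply/seteqP; split=> x /=; [move=> /(_ (i, C)); apply; left|move=> ? p [<-|//]].
  apply: smallest_sub; first exact: sigma_algebra_measurable.
  move=> _ [s sG <-]; apply: measurable_box => p ps.
  by rewrite mG; apply: sub_sigma_algebra; exact: sG.
apply: (measure_unique GG (fun _ => setT)) => //.
- move=> _ _ [s sG <-] [t tG <-]; exists (s ++ t).
    by move=> p /List.in_app_iff[]; [exact: sG|exact: tG].
  apply/seteqP; split=> x /=.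
    by move=> xst; split=> p ps; apply: xst; apply/List.in_app_iff; [left|right].
  by move=> [xs xt] p /List.in_app_iff[]; [exact: xs|exact: xt].
- by move=> _; exists [::].
- by rewrite bigcup_const//; exists 0%N.
- by move=> _ [s sG <-]; exact: m12.
Qed.

End power_measurability.

Lemma esum_option (R : realType) (T : choiceType) (f : option T -> \bar R) :
  (forall o, 0 <= f o)%E ->
  (\esum_(o in [set: option T]) f o = f None + \esum_(x in [set: T]) f (Some x))%E.
Proof.
move=> f0; rewrite (esumID [set None])// setTI esum_set1//; congr (_ + _)%E.
rewrite setTI (_ : ~` [set None] = range (@Some T)); last first.
  apply/seteqP; split=> [[x|]//= _|_ [x _ <-]//]; by exists x.
by rewrite esum_image// => x y _ _ [].
Qed.

(** The integral of a nonnegative function is a supremum over the simple functions below it, so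
    monotonicity holds for arbitrary functions, such as the infima over uncountably many
    configurations in [alpha]. *)
Lemma ge0_integral_mono d (T : measurableType d) (R : realType)
    (mu : {measure set T -> \bar R}) (f g : T -> \bar R) :
  (forall x, 0 <= f x <= g x)%E -> (\int[mu]_x f x <= \int[mu]_x g x)%E.
Proof.
move=> fg; have f0 x : (0 <= f x)%E by have /andP[] := fg x.
have g0 x : (0 <= g x)%E by have /andP[] := fg x; exact: le_trans.
rewrite !ge0_integralTE//; apply: ereal_sup_le => _ [h hf <-]; exists h => // x.
by apply: le_trans (hf x) _; have /andP[] := fg x.
Qed.

Lemma esum_single (R : realType) (T : choiceType) (f : T -> \bar R) (t : T) :
  (0 <= f t)%E -> (forall s, s <> t -> f s = 0%E) ->
  (\esum_(s in [set: T]) f s = f t)%E.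
Proof.
move=> ft0 f0; rewrite (esumID [set t]); last first.
  by move=> s _; have [->//|/eqP/f0->] := eqVneq s t.
rewrite setTI esum_set1// [X in (_ + X)%E]esum1 ?adde0// => s [_ st].
exact: f0.
Qed.

Lemma ge0_integral_partition (R : realType) (T : countType) d
    (X : measurableType d) (mu : {measure set X -> \bar R}) (E : T -> set X)
    (f : X -> \bar R) :
  (forall r, measurable (E r)) -> trivIset setT E ->
  (forall x, 0 <= f x)%E -> measurable_fun setT f ->
  (\int[mu]_(x in \bigcup_r E r) f x =
   \esum_(r in [set: T]) \int[mu]_(x in E r) f x)%E.
Proof.
move=> mE tE f0 mf; rewrite integral_mkcond.
under eq_esum do rewrite integral_mkcond.
have fE0 r x : (0 <= (f \_ (E r)) x)%E by rewrite patchE; case: ifP.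
have mfE r : measurable_fun setT (f \_ (E r)).
  by apply/measurable_restrict => //; exact: measurable_funS mf.
rewrite -ge0_integral_esum//; apply: eq_integral => x _.
rewrite patchE; case: ifPn => [/set_mem[r _ Er]|/negP nE].
  rewrite (@esum_single _ _ (fun s => (f \_ (E s)) x) r)// ?patchE ?mem_set// => s sr.
  rewrite patchE ifF//; apply/negP => /set_mem Es; apply: sr.
  by apply: tE => //; exists x.
rewrite esum1// => r _; rewrite patchE ifF//; apply/negP => /set_mem Er.
by apply: nE; apply/mem_set; exists r.
Qed.

Lemma countable_union_measurable (T : countType) d (X : measurableType d)
  (E : T -> set X) : (forall r, measurable (E r)) -> measurable (\bigcup_r E r).
Proof. by apply: countable_bigcupT_measurable; exact: countableP. Qed.

Lemma ge0_integral_null_diff (R : realType) d (X : measurableType d)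
    (mu : {measure set X -> \bar R}) (D B : set X) (f : X -> \bar R) :
  measurable D -> measurable B -> B `<=` D -> mu (D `\` B) = 0%E ->
  (forall x, 0 <= f x)%E -> measurable_fun setT f ->
  (\int[mu]_(x in D) f x = \int[mu]_(x in B) f x)%E.
Proof.
move=> mD mB BD DB0 f0 mf.
rewrite (ge0_negligible_integral (measurableD mD mB) mD)//; last first.
  exact: measurable_funS mf.
by rewrite setDD setIidr.
Qed.

Lemma measure_null_diff d (X : measurableType d) (R : realType)
    (mu : {measure set X -> \bar R}) (B C : set X) :
  measurable B -> measurable C -> mu (B `\` C) = 0%E -> mu B = mu (B `&` C).
Proof.
move=> mB mC BC0; apply: etrans (measureDI mu mB mC) _.
by rewrite [X in (X + _)%E]BC0 add0e.
Qed.

Lemma pushforward_probability d d' (X : measurableType d) (Y : measurableType d')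
    (R : realType) (P : probability X R) (f : X -> Y) : measurable_fun setT f ->
  exists Q : probability Y R, (forall B, Q B = P (f @^-1` B)) /\
    (forall g : Y -> \bar R, (forall y, 0 <= g y)%E -> measurable_fun setT g ->
       (\int[Q]_y g y = \int[P]_x g (f x))%E).
Proof.
move=> mf.
pose m : {measure set Y -> \bar R} :=
  measure_function_pushforward__canonical__measure_function_Measure P mf.
have m1 : m setT = 1%E by rewrite -(@probability_setT _ _ _ P).
have [Q QE] := probability_of_measure m1; exists Q; split=> [B|g g0 mg].
  by rewrite QE.
rewrite (@eq_measure_integral _ _ _ _ m) => [|B _ _]; last exact: QE.
transitivity (\int[P]_(x in f @^-1` setT) (g \o f) x)%E.
  exact: ge0_integral_pushforward.
by rewrite preimage_setT.
Qed.

(** * Distance estimates between extended reals *)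

Section close.
Context (R : realType).
Implicit Types (x y s : \bar R).
Local Open Scope ereal_scope.

(** The estimate [|x - y| <= s], written without subtraction so that it combines with sums of
    nonnegative extended reals. *)
Definition close s x y := x <= y + s /\ y <= x + s.

Lemma close_trivial x y : 0 <= x <= 1 -> 0 <= y <= 1 -> close 1 x y.
Proof.
move=> /andP[x0 x1] /andP[y0 y1].
by split; [apply: le_trans x1 _|apply: le_trans y1 _]; rewrite leeDr.
Qed.

Lemma close_refl s x : 0 <= s -> close s x x.
Proof. by move=> s0; split; rewrite leeDl. Qed.

Lemma close_eq x y : (forall e : R, (0 < e)%R -> close e%:E x y) -> x = y.
Proof.
move=> xy; apply/eqP; rewrite eq_le; apply/andP; split;
  by apply/lee_addgt0Pr => e /xy[].
Qed.

(** The alternative [a r = 0] disposes of the marks whose site is not active. *)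
Lemma close_esum (T : countType) (a : T -> R) (x y s : T -> \bar R) :
  (forall r, 0 <= a r)%R -> (forall r, 0 <= x r) -> (forall r, 0 <= y r) ->
  (forall r, 0 <= s r) -> (forall r, a r = 0%R \/ close (s r) (x r) (y r)) ->
  close (\esum_(r in [set: T]) ((a r)%:E * s r))
    (\esum_(r in [set: T]) ((a r)%:E * x r)) (\esum_(r in [set: T]) ((a r)%:E * y r)).
Proof.
move=> a0 x0 y0 s0 xy.
have ax (z : T -> \bar R) : (forall r, 0 <= z r) -> forall r, 0 <= (a r)%:E * z r.
  by move=> z0 r; rewrite mule_ge0// lee_fin.
split; (rewrite -esumD; [|by move=> r _; apply: ax|by move=> r _; apply: ax]);
  apply: le_esum => r _; rewrite -ge0_muleDr//;
  by case: (xy r) => [->|[? ?]]; rewrite ?mul0e// lee_wpmul2l// lee_fin.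
Qed.

End close.

(** * Measurability and integration on the spins with Delta added *)

Section option_measurability.
Context dT (T : measurableType dT).

(** The sigma-field of [option T] only constrains preimages under [Some]: the value at [None] is
    free. *)
Lemma measurable_fun_option d (Y : measurableType d) (f : option T -> Y) :
  measurable_fun setT (fun a => f (Some a)) -> measurable_fun setT f.
Proof.
move=> mf _ B mB; rewrite setTI; have := mf measurableT B mB; rewrite setTI.
by [].
Qed.

Lemma measurable_isSome : measurable_fun setT (fun o : option T => o : bool).
Proof. by apply: measurable_fun_option; exact: measurable_cst. Qed.

Lemma measurable_odflt (x : T) : measurable_fun setT (odflt x).
Proof. by apply: measurable_fun_option; exact: measurable_id. Qed.

Lemma measurable_fun_option2 d d' (X : measurableType d) (Y : measurableType d')
    (f : option T * X -> Y) :
  measurable_fun setT (fun p : T * X => f (Some p.1, p.2)) ->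
  measurable_fun setT (fun x => f (None, x)) ->
  measurable_fun setT f.
Proof.
move=> mS mN.
rewrite (_ : f = fun p => if (p.1 : bool) then f (Some (odflt point p.1), p.2)
                          else f (None, p.2)); last first.
  by apply/funext => -[[a|] x].
have m1 : measurable_fun setT (fun p : option T * X => odflt point p.1).
  exact: (measurableT_comp (measurable_odflt point) measurable_fst).
apply: measurable_fun_ifT.
- exact: (measurableT_comp measurable_isSome measurable_fst).
- exact: (measurableT_comp mS (measurable_fun_pair m1 measurable_snd)).
- exact: (measurableT_comp mN measurable_snd).
Qed.

Lemma ge0_integral_star (R : realType) (mu : {measure set T -> \bar R})
    (f : option T -> \bar R) :
  (forall a, 0 <= f a)%E -> measurable_fun setT f ->
  (\int[star mu]_a f a = \int[mu]_a f (Some a) + f None)%E.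
Proof.
move=> f0 mf.
have mS := @measurable_Some _ T.
pose pf : {measure set (option T) -> \bar R} :=
  measure_function_pushforward__canonical__measure_function_Measure mu mS.
pose m : {measure set (option T) -> \bar R} := measure_add pf (\d_(@None T)).
have mE B : star mu B = m B by exact/esym/measure_addE.
rewrite (@eq_measure_integral _ _ _ _ m) => [|B _ _]; last exact: mE.
rewrite (ge0_integral_measure_add _ _ measurableT (fun a _ => f0 a) mf).
rewrite integral_dirac// diracT mul1e; congr (_ + _)%E.
transitivity (\int[mu]_(a in @Some T @^-1` setT) (f \o Some) a)%E.
  exact: ge0_integral_pushforward.
by rewrite preimage_setT.
Qed.

End option_measurability.

(** * Resampling one site *)

Section one_step.
Context (R : realType) (d : nat) (A : borelSet R).
Local Notation S := (power (site d) (spin A)).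
Context (rho : {finite_measure set (spin A) -> \bar R}).
Context (c : site d -> spin A -> S -> R).
Context (pm1 : site d -> spin A -> R) (pk : condDensity d A).
Hypothesis dec : decomposition rho c pm1 pk.

Implicit Types (F G : {fset site d}) (f g : S -> \bar R) (r : mark d) (eta zeta : S).

(* [upd] extended by the convention [eta^{i,Delta} = eta] *)
Definition upd_star eta (i : site d) (a : option (spin A)) : S :=
  fun j => if j == i then odflt (eta i) a else eta j.

(** The law prescribed by a mark in a complete configuration; [symbol_density] agrees with it as
    soon as the sites that it reads are defined. *)
Definition mark_density r eta (a : option (spin A)) : R :=
  if r.2 is Some k then pk a (restr (V_ r.1 k) eta) else pm1star pm1 r.1 a.

(** The operator [T_r] of the overview. *)
Definition resample r f eta : \bar R :=
  (\int[star rho]_a ((mark_density r eta a)%:E * f (upd_star eta r.1 a)))%E.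

Definition local_test F f :=
  [/\ measurable_fun setT f, (forall eta, 0 <= f eta <= 1)%E &
      forall eta zeta, {in F, forall j, eta j = zeta j} -> f eta = f zeta].

Lemma local_test_sub F G f : {subset F <= G} -> local_test F f -> local_test G f.
Proof.
move=> FG [mf f01 Ff]; split=> // eta zeta ez; apply: Ff => j jF.
exact/ez/FG.
Qed.

Lemma measurable_restr (V : {fset site d}) :
  measurable_fun setT (fun eta : S => restr V eta).
Proof. by apply: measurable_power => j; exact: measurable_coord. Qed.

Lemma measurable_upd_star i :
  measurable_fun setT (fun p : option (spin A) * S => upd_star p.2 i p.1).
Proof.
apply: measurable_power => j; rewrite /upd_star; case: eqP => _.
  apply: measurable_fun_option2 => /=; first exact: measurable_fst.
  exact: measurable_coord.
exact: (measurableT_comp (@measurable_coord _ _ _ j) measurable_snd).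
Qed.

Lemma measurable_mark_density r :
  measurable_fun setT (fun p : option (spin A) * S => mark_density r p.2 p.1).
Proof.
have [m1 mk _ _] := dec; rewrite /mark_density; case: r => i [k|] /=.
  have /(measurable_fun_pair measurable_fst) :=
    measurableT_comp (@measurable_restr (V_ i k))
      (measurable_snd (T1 := option (spin A)) (T2 := S)).
  exact: measurableT_comp (mk i k).
apply: measurable_fun_option2 => /=; last exact: measurable_cst.
have [mi _ _] := m1 i.
exact: measurableT_comp mi measurable_fst.
Qed.

Lemma mark_density_ge0 r eta a : 0 <= mark_density r eta a.
Proof.
have [m1 _ mk _] := dec; rewrite /mark_density; case: r => i [k|] /=.
  exact: (mk i k _).1.
by have [_ p0 _] := m1 i; case: a => [a|]//=.
Qed.

Lemma mark_density1 r eta : (\int[star rho]_a (mark_density r eta a)%:E = 1)%E.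
Proof.
have [m1 _ mk _] := dec; rewrite /mark_density; case: r => i [k|] /=.
  exact: (mk i k _).2.
have [mi p0 p1] := m1 i.
rewrite ge0_integral_star/=; first by rewrite p1 adde0.
  by case=> [a|]; rewrite lee_fin//=.
by apply: measurable_fun_option; exact/measurable_EFinP.
Qed.

Lemma measurable_resample_integrand r f : measurable_fun setT f ->
  measurable_fun setT (fun p : option (spin A) * S =>
    (mark_density r p.2 p.1)%:E * f (upd_star p.2 r.1 p.1))%E.
Proof.
move=> mf; apply: emeasurable_funM.
  by apply/measurable_EFinP; exact: measurable_mark_density.
exact: measurableT_comp mf (@measurable_upd_star r.1).
Qed.

Lemma measurable_resample_slice r f eta : measurable_fun setT f ->
  measurable_fun setT (fun a : option (spin A) =>
    (mark_density r eta a)%:E * f (upd_star eta r.1 a))%E.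
Proof.
move=> /(measurable_resample_integrand r) mf.
exact: (measurableT_comp mf (pair2_measurable eta)).
Qed.

Lemma resample_ge0 r f eta : (forall zeta, 0 <= f zeta)%E ->
  (0 <= resample r f eta)%E.
Proof.
by move=> f0; apply: integral_ge0 => a _; rewrite mule_ge0// lee_fin mark_density_ge0.
Qed.

Lemma measurable_resample r f : (forall zeta, 0 <= f zeta)%E ->
  measurable_fun setT f -> measurable_fun setT (resample r f).
Proof.
move=> f0 mf; have mh := measurable_resample_integrand r mf.
set h := (fun p => _) in mh.
have h0 p : (0 <= h p)%E by rewrite /h mule_ge0// lee_fin mark_density_ge0.
rewrite (_ : resample r f = fun eta =>
    (\int[rho]_a h (Some a, eta) + h (None, eta))%E); last first.
  apply/funext => eta; rewrite /resample ge0_integral_star// => [a|].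
    exact: h0 (a, eta).
  exact: measurable_resample_slice.
apply: emeasurable_funD.
  apply: (measurable_fun_fubini_tonelli_G (m1 := rho)
    (fun p : spin A * S => h (Some p.1, p.2))) => //.
  apply: (measurableT_comp mh); apply: measurable_fun_pair; last exact: measurable_snd.
  exact: measurableT_comp (@measurable_Some _ _) measurable_fst.
exact: (measurableT_comp mh (pair1_measurable None)).
Qed.

Lemma resample_le1 r f eta : measurable_fun setT f ->
  (forall zeta, 0 <= f zeta <= 1)%E -> (resample r f eta <= 1)%E.
Proof.
move=> mf f01; rewrite -(mark_density1 r eta).
apply: ge0_le_integral => //.
- move=> a _; rewrite mule_ge0// ?lee_fin ?mark_density_ge0//.
  by have /andP[] := f01 (upd_star eta r.1 a).
- exact: measurable_resample_slice.
- have := measurable_resample_slice r eta (measurable_cst (1%E : \bar R)).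
  by under eq_fun do rewrite mule1.
- move=> a _; have /andP[f0 f1] := f01 (upd_star eta r.1 a).
  by rewrite -[leRHS]mule1 lee_wpmul2l// lee_fin mark_density_ge0.
Qed.

(** For a range [k >= 0] the density reads the ball and [f] reads [F], including the old value at
    [i] if Delta is drawn. For the range -1 the density vanishes at Delta, so the old value at [i]
    is always overwritten and [i] can be removed. *)
Lemma resample_local F r f : local_test F f -> local_test (step F r) (resample r f).
Proof.
move=> [mf f01 Ff]; have f0 zeta : (0 <= f zeta)%E by have /andP[] := f01 zeta.
split; first exact: measurable_resample.
  by move=> eta; rewrite resample_ge0//= resample_le1.
move=> eta zeta; rewrite /resample /mark_density /step; case: r => i [k|]/= ez.
  have -> : restr (V_ i k) eta = restr (V_ i k) zeta.
    apply/funext => j; rewrite /restr; apply: ez.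
    by rewrite in_fsetU (valP j) orbT.
  apply: eq_integral => a _; congr (_ * _)%E; apply: Ff => j jF.
  rewrite /upd_star; case: eqP => [ji|_]; last by apply: ez; rewrite in_fsetU jF.
  by case: a => //=; rewrite -ji; apply: ez; rewrite in_fsetU jF.
apply: eq_integral => -[a|] _ /=; last by rewrite !mul0e.
congr (_ * _)%E; apply: Ff => j jF.
by rewrite /upd_star; case: eqP => // /eqP ji; apply: ez; rewrite in_fsetD1 jF ji.
Qed.

(** The function does not see the resampled site, and the density has mass 1. Hence marks at
    additional sites do not affect expectations, which is the source of consistency. *)
Lemma resample_id F r f eta : local_test F f -> r.1 \notin F ->
  resample r f eta = f eta.
Proof.
move=> [mf f01 Ff] rF; rewrite /resample.
have f0 zeta : (0 <= f zeta)%E by have /andP[] := f01 zeta.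
under eq_integral.
  move=> a _; rewrite (Ff (upd_star eta r.1 a) eta); last first.
    by move=> j jF; rewrite /upd_star; case: eqP => [jr|//]; move: rF; rewrite -jr jF.
  over.
have md := measurable_resample_slice r eta (measurable_cst (1%E : \bar R)).
rewrite ge0_integralZr ?mark_density1 ?mul1e//.
- by move: md; under eq_fun do rewrite mule1.
- by move=> a _; rewrite lee_fin mark_density_ge0.
Qed.

End one_step.

(** * The rates and the generator *)

Section rates.
Context (R : realType) (d : nat) (A : borelSet R).
Local Notation S := (power (site d) (spin A)).
Context (rho : {finite_measure set (spin A) -> \bar R}).
Context (c : site d -> spin A -> S -> R).
Context (pm1 : site d -> spin A -> R) (pk : condDensity d A).
Hypothesis rho_neq0 : (rho setT != 0)%E.
Hypothesis c_gt0 : forall i a eta, 0 < c i a eta.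
Hypothesis measurable_c : forall i,
  measurable_fun setT (fun x : spin A * S => c i x.1 x.2).
Hypothesis c_bounded : (ereal_sup (range (fun i => ereal_sup (range (fun eta =>
  \int[rho]_a (c i a eta)%:E)))) < +oo)%E.
Hypothesis dec : decomposition rho c pm1 pk.

Implicit Types (i : site d) (eta zeta : S).
Local Notation M := (M_ rho c).
Local Notation lam := (lambda rho c).
Local Notation cs := (cstar rho c).

Lemma measurable_rate i eta : measurable_fun setT (fun a => c i a eta).
Proof. exact: (measurableT_comp (@measurable_c i) (pair2_measurable eta)). Qed.

Lemma rate_int_ge0 i eta : (0 <= \int[rho]_a (c i a eta)%:E)%E.
Proof. by apply: integral_ge0 => a _; rewrite lee_fin ltW. Qed.

Lemma M_E i : (M i)%:E = ereal_sup (range (fun eta => (\int[rho]_a (c i a eta)%:E)%E)).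
Proof.
rewrite /M_ fineK// ge0_fin_numE.
  by apply: le_lt_trans c_bounded; apply: ereal_sup_ubound; exists i.
apply: le_trans (rate_int_ge0 i point) _; apply: ereal_sup_ubound.
by exists point.
Qed.

Lemma rate_int_le i eta : (\int[rho]_a (c i a eta)%:E <= (M i)%:E)%E.
Proof. by rewrite M_E; apply: ereal_sup_ubound; exists eta. Qed.

Lemma rate_int_fin i eta : (\int[rho]_a (c i a eta)%:E)%E \is a fin_num.
Proof.
by rewrite ge0_fin_numE ?rate_int_ge0//; apply: le_lt_trans (rate_int_le i eta) (ltry _).
Qed.

Lemma rate_intE i eta : (\int[rho]_a (c i a eta)%:E = (\int[rho]_a c i a eta)%:E)%E.
Proof. by rewrite /Rintegral fineK// rate_int_fin. Qed.

Lemma M_gt0 i : 0 < M i.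
Proof.
rewrite -lte_fin; apply: lt_le_trans (rate_int_le i point).
rewrite lt0e rate_int_ge0 andbT; apply/eqP => c0.
move: rho_neq0; apply/negP; rewrite negbK; apply/eqP.
(* A nonnegative function of zero integral vanishes almost everywhere; as the rates are positive,
   the whole space would be negligible. *)
have : (ae_eq rho setT (fun a => (c i a point)%:E) (cst 0))%E.
  apply/ae_eq_integral_abs => //.
    by apply/measurable_EFinP; exact: measurable_rate.
  rewrite -[RHS]c0; apply: eq_integral => a _.
  by rewrite gee0_abs// lee_fin ltW.
move=> [N [mN N0 sN]]; apply/eqP; rewrite -measure_le0 -N0 le_measure ?inE//.
move=> a _; apply: sN => /= /(_ Logic.I) []; apply/eqP.
by rewrite gt_eqF.
Qed.

Lemma cstar_ge0 i a eta : 0 <= cs i a eta.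
Proof.
case: a => [a|] /=; first exact: ltW.
by rewrite subr_ge0 -lee_fin -rate_intE rate_int_le.
Qed.

Lemma measurable_cstar i eta : measurable_fun setT (fun a => cs i a eta).
Proof. by apply: measurable_fun_option; exact: measurable_rate. Qed.

Lemma integral_cstar i eta : (\int[star rho]_a (cs i a eta)%:E = (M i)%:E)%E.
Proof.
rewrite ge0_integral_star => [|a|]; last 2 first.
- by rewrite lee_fin cstar_ge0.
- by apply/measurable_EFinP; exact: measurable_cstar.
by rewrite /= rate_intE -EFinD addrC subrK.
Qed.

(** Common integrand of [alpha_m1], where [Z] is everything, and of [alpha], where [Z] prescribes
    the spins in a ball. Enlarging [Z] lowers it, whence the signs of the increments in [lambda]. *)
Let inf_over i (Z : set S) (a : option (spin A)) :=
  ereal_inf [set (cs i a zeta)%:E | zeta in Z].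

Let inf_over_ge0 i Z a : (0 <= inf_over i Z a)%E.
Proof. by apply: le_ereal_inf_tmp => _ [zeta _ <-]; rewrite lee_fin cstar_ge0. Qed.

Let inf_over_mono i (Z Z' : set S) : Z `<=` Z' ->
  (\int[star rho]_a inf_over i Z' a <= \int[star rho]_a inf_over i Z a)%E.
Proof.
move=> ZZ; apply: ge0_integral_mono => a; rewrite inf_over_ge0/=.
by apply: ereal_inf_le_tmp => _ [zeta Zz <-]; exists zeta => //; exact: ZZ.
Qed.

Let inf_over_le i (Z : set S) eta : Z eta ->
  (\int[star rho]_a inf_over i Z a <= (M i)%:E)%E.
Proof.
move=> Ze; rewrite -(integral_cstar i eta); apply: ge0_integral_mono => a.
by rewrite inf_over_ge0/=; apply: ereal_inf_lbound; exists eta.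
Qed.

Let fiber i k (w : power (V_ i k) (spin A)) : set S :=
  [set zeta | restr (V_ i k) zeta = w].

Let alphaE i k : \bar R := ereal_inf (range (fun w : power (V_ i k) (spin A) =>
  \int[star rho]_a inf_over i (fiber w) a)%E).

Let alphaE_ge0 i k : (0 <= alphaE i k)%E.
Proof. by apply: le_ereal_inf_tmp => _ [w _ <-]; apply: integral_ge0. Qed.

Let alphaE_fin i k : alphaE i k \is a fin_num.
Proof.
rewrite ge0_fin_numE//; apply: le_lt_trans (ltry (M i)).
apply: ge_ereal_inf; exists (\int[star rho]_a inf_over i (fiber (restr (V_ i k) point)) a)%E.
  by exists (restr (V_ i k) point).
exact: (@inf_over_le _ _ point).
Qed.

Let alphaS i k : (alphaE i k <= alphaE i k.+1)%E.
Proof.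
apply: le_ereal_inf_tmp => _ [w _ <-].
(* The restriction of [w] to the smaller ball; the default [point] is never taken, the balls being
   nested. *)
pose w' : power (V_ i k) (spin A) := fun j => odflt point (omap w (insub (val j))).
apply: ge_ereal_inf; exists (\int[star rho]_a inf_over i (fiber w') a)%E; first by exists w'.
apply: inf_over_mono => zeta /= zw; apply/funext => j.
have jV : val j \in V_ i k.+1.
  by have := valP j; rewrite !in_V => /leq_trans; apply.
by rewrite /w' insubT/= -zw.
Qed.

Let alpham1_fin i : (\int[star rho]_a inf_over i setT a)%E \is a fin_num.
Proof.
rewrite ge0_fin_numE ?integral_ge0//; apply: le_lt_trans (ltry (M i)).
exact: (@inf_over_le _ _ point).
Qed.

Lemma lambda_ge0 i k : 0 <= lam i k.
Proof.
have M0 := ltW (M_gt0 i).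
have aE j : alpha rho c i j = fine (alphaE i j) by [].
have a1E : alpha_m1 rho c i = fine (\int[star rho]_a inf_over i setT a)%E by [].
case: k => [[|k]|] /=; apply: divr_ge0 => //.
- rewrite subr_ge0 a1E aE fine_le ?alphaE_fin//.
  by apply: le_ereal_inf_tmp => _ [w _ <-]; exact: inf_over_mono.
- by rewrite subr_ge0 !aE fine_le ?alphaE_fin// alphaS.
- by rewrite a1E fine_ge0// integral_ge0.
Qed.

Definition mark_rate (r : mark d) : R := M r.1 * lam r.1 r.2.

Lemma mark_rate_ge0 r : 0 <= mark_rate r.
Proof. by rewrite mulr_ge0 ?lambda_ge0// ltW ?M_gt0. Qed.

(** An almost everywhere identity suffices under the integral, and sum and integral commute as all
    terms are nonnegative. The test function [g = 1] gives the total rate of the site, and the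
    values of a function after the update give the generator. *)
Lemma cstar_decomposition i eta (g : option (spin A) -> R) :
  (forall a, 0 <= g a) -> measurable_fun setT g ->
  (\int[star rho]_a (cs i a eta * g a)%:E =
   \esum_(k in [set: option nat]) ((mark_rate (i, k))%:E *
     \int[star rho]_a (mark_density pm1 pk (i, k) eta a * g a)%:E))%E.
Proof.
move=> g0 mg; pose p k a := mark_density pm1 pk (i, k) eta a.
have p0 k a : 0 <= p k a by exact: mark_density_ge0 dec _ _ _.
pose h (k : option nat) (a : option (spin A)) : \bar R :=
  ((mark_rate (i, k))%:E * (p k a * g a)%:E)%E.
have md k : measurable_fun setT (fun a => (p k a * g a)%:E).
  apply/measurable_EFinP; apply: measurable_funM => //.
  exact: (measurableT_comp (measurable_mark_density dec (i, k)) (pair2_measurable eta)).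
have h0 k a : (0 <= h k a)%E.
  by rewrite mule_ge0// lee_fin ?mark_rate_ge0// mulr_ge0.
have mh k : measurable_fun setT (h k) by apply: measurable_funeM; exact: md.
transitivity (\int[star rho]_a (\esum_(k in [set: option nat]) h k a))%E.
  apply: ge0_ae_eq_integral => //.
  - apply/measurable_EFinP; apply: measurable_funM => //; exact: measurable_cstar.
  - by apply: measurable_esum.
  - by move=> a _; rewrite lee_fin mulr_ge0// cstar_ge0.
  - by move=> a _; apply: esum_ge0 => k _.
  have [_ _ _ /(_ i eta)] := dec; apply: filterS => a ca _.
  have q0 k : (0 <= (lam i k * p k a)%:E)%E by rewrite lee_fin mulr_ge0// lambda_ge0.
  have M0 : (0 <= (M i)%:E)%E by rewrite lee_fin ltW// M_gt0.
  have hE k : h k a = ((g a)%:E * ((M i)%:E * (lam i k * p k a)%:E))%E.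
    by rewrite /h /mark_rate/= -!EFinM; congr EFin; ring.
  rewrite esum_option// -nneseries_esumT//.
  under eq_eseriesr do rewrite hE.
  rewrite EFinM ca muleC nneseriesZl; last by move=> n _; rewrite mule_ge0.
  rewrite nneseriesZl; last by move=> n _.
  rewrite hE -ge0_muleDr; last 2 first.
  - by rewrite mule_ge0.
  - by rewrite mule_ge0// nneseries_ge0.
  by rewrite -ge0_muleDr ?nneseries_ge0// => n _ _; exact: q0.
rewrite ge0_integral_esum//; apply: eq_esum => k _.
by rewrite ge0_integralZl// ?lee_fin ?mark_rate_ge0// => a _; rewrite lee_fin mulr_ge0.
Qed.

(** The test function [g = 1] in the decomposition; thus the [lambda] of a site sum to 1, the limit
    of [alpha] not having to be computed. *)
Lemma esum_mark_rate i :
  (\esum_(k in [set: option nat]) (mark_rate (i, k))%:E = (M i)%:E)%E.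
Proof.
have m1 : measurable_fun setT (fun _ : option (spin A) => 1 : R).
  exact: measurable_cst.
have := @cstar_decomposition i point _ (fun=> ler01) m1.
under eq_integral do rewrite mulr1.
rewrite integral_cstar => ->; apply: eq_esum => k _.
under eq_integral do rewrite mulr1.
by rewrite (mark_density1 dec) mule1.
Qed.

Definition total_rate (F : {fset site d}) : R := \sum_(i <- F) M i.

(** Extended by 0 outside [F], so that sums for different sets all range over the countable type of
    marks. *)
Definition active_rate (F : {fset site d}) (r : mark d) : R :=
  if r.1 \in F then mark_rate r else 0.

Lemma active_rate_ge0 F r : 0 <= active_rate F r.
Proof. by rewrite /active_rate; case: ifP => // _; exact: mark_rate_ge0. Qed.

Lemma total_rate_ge0 F : 0 <= total_rate F.
Proof. by apply: sumr_ge0 => i _; rewrite ltW// M_gt0. Qed.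

Lemma total_rate_gt0 F : F != fset0 -> 0 < total_rate F.
Proof.
move=> /fset0Pn[i iF]; rewrite /total_rate (big_fsetD1 i)//=.
by apply: ltr_pwDl; [exact: M_gt0|apply: sumr_ge0 => j _; rewrite ltW// M_gt0].
Qed.

Lemma esum_active_rate F (g : mark d -> \bar R) : (forall r, 0 <= g r)%E ->
  (\esum_(r in [set: mark d]) ((active_rate F r)%:E * g r) =
   \sum_(i <- F) \esum_(k in [set: option nat]) ((mark_rate (i, k))%:E * g (i, k)))%E.
Proof.
move=> g0.
have h0 i k : (0 <= (active_rate F (i, k))%:E * g (i, k))%E.
  by rewrite mule_ge0// lee_fin active_rate_ge0.
transitivity (\esum_(i in [set: site d]) \esum_(k in [set: option nat])
    ((active_rate F (i, k))%:E * g (i, k)))%E.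
  rewrite esum_esum// (_ : _ `*`` _ = [set: mark d]); last exact/seteqP.
  by apply: eq_esum => -[i k].
rewrite (esumID [set` F])//; last by move=> i _; exact: esum_ge0.
rewrite !setTI [X in (_ + X)%E]esum1 ?adde0; last first.
  move=> i /= /negP iF; apply: esum1 => k _.
  by rewrite /active_rate (negbTE iF) mul0e.
rewrite esum_fset; [|exact: finite_fset|by move=> i _; exact: esum_ge0].
rewrite fsbig_finite ?set_fsetK; last exact: finite_fset.
apply: eq_big_seq => i iF; apply: eq_esum => k _.
by rewrite /active_rate/= iF.
Qed.

Lemma esum_active_rate1 F :
  (\esum_(r in [set: mark d]) (active_rate F r)%:E = (total_rate F)%:E)%E.
Proof.
have := @esum_active_rate F (fun=> 1%E) (fun=> lee01).
under eq_esum do rewrite mule1.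
move=> ->; rewrite /total_rate -sumEFin; apply: eq_bigr => i _.
rewrite -esum_mark_rate; apply: eq_esum => k _; exact: mule1.
Qed.

Lemma choice_probE F r : choice_prob rho c F r = active_rate F r / total_rate F.
Proof.
rewrite /choice_prob /active_rate; case: ifP => _; last by rewrite mul0r.
congr (_ / _); apply: eq_bigr => i _.
by have /(congr1 fine) := esum_mark_rate i.
Qed.

(** The loss term stands on the left to leave a sum of nonnegative terms on the right. Sites outside
    [F] contribute nothing. At a site [i] of [F], the mass [M_i] minus the total rate to [A] is
    exactly the rate of Delta, which multiplies [f eta] as Delta changes nothing. *)
Lemma generatorE F (f : S -> R) eta : measurable_fun setT f ->
  (forall zeta, 0 <= f zeta <= 1) ->
  (forall zeta zeta', {in F, forall j, zeta j = zeta' j} -> f zeta = f zeta') ->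
  ((generator rho c f eta + total_rate F * f eta)%:E =
   \esum_(r in [set: mark d]) ((active_rate F r)%:E *
     resample rho pm1 pk r (EFin \o f) eta))%E.
Proof.
move=> mf f01 Ff; have f0 zeta : 0 <= f zeta by have /andP[] := f01 zeta.
rewrite esum_active_rate; last first.
  by move=> r; apply: (resample_ge0 dec) => zeta; rewrite lee_fin.
rewrite /generator (@fsbigTE _ _ _ _ F); last first.
  move=> i iF; rewrite (_ : (fun a => _) = cst 0) ?Rintegral_cst ?mul0r//.
  apply/funext => a /=; rewrite [X in X - _](_ : _ = f eta) ?subrr ?mulr0//.
  by apply: Ff => j jF; rewrite /upd; case: eqP => [ji|//]; move: iF; rewrite -ji jF.
rewrite /total_rate mulr_suml -big_split/= -sumEFin; apply: eq_bigr => i _.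
pose g a := f (upd_star eta i a).
have mg : measurable_fun setT g.
  exact: (measurableT_comp mf (measurableT_comp (@measurable_upd_star _ _ _ i)
    (pair2_measurable eta))).
have g0 a : 0 <= g a by exact: f0.
have cg0 a : 0 <= cs i a eta * g a by rewrite mulr_ge0// cstar_ge0.
have mcg : measurable_fun setT (fun a => cs i a eta * g a).
  by apply: measurable_funM => //; exact: measurable_cstar.
rewrite -(@cstar_decomposition i eta g)// ge0_integral_star; last 2 first.
- by move=> a; rewrite lee_fin.
- exact/measurable_EFinP.
have ic : rho.-integrable setT (EFin \o c i ^~ eta).
  apply/integrableP; split; first by apply/measurable_EFinP; exact: measurable_rate.
  rewrite (eq_integral (fun a => (c i a eta)%:E)).
    by have := rate_int_fin i eta; rewrite ge0_fin_numE// rate_int_ge0.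
  by move=> a _; rewrite /= ger0_norm// ltW.
have mcu : measurable_fun setT (fun a => c i a eta * f (upd eta i a)).
  exact: (measurableT_comp mcg (@measurable_Some _ _)).
have icu : rho.-integrable setT (EFin \o (fun a => c i a eta * f (upd eta i a))).
  apply: le_integrable ic => //; first exact/measurable_EFinP.
  move=> a _ /=; have /andP[fu0 fu1] := f01 (upd eta i a).
  by rewrite lee_fin normrM ler_piMr// ger0_norm.
have icf : rho.-integrable setT (EFin \o (fun a => c i a eta * f eta)).
  rewrite (_ : _ \o _ = (fun a => (c i a eta)%:E * (f eta)%:E)%E); last exact/funext.
  exact: integrableZr.
under eq_Rintegral do rewrite mulrBr.
rewrite RintegralB// RintegralZr//=.
rewrite /g /= -/(upd _ _ _).
(* The first summand is the integral over [A], the second the contribution of Delta. *)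
transitivity ((\int[rho]_a (c i a eta * f (upd eta i a)))%:E +
  ((M i - \int[rho]_a c i a eta) * f eta)%:E)%E.
  by rewrite -EFinD; congr EFin; ring.
congr (_ + _)%E.
  rewrite /Rintegral fineK//; exact: integrable_fin_num.
congr (_ * f _)%:E; apply/funext => j; rewrite /upd_star.
by case: eqP => // ->.
Qed.

End rates.

(** * The law of the algorithms *)

Section stopping.
Context (d : nat).
Implicit Types (F : {fset site d}) (h : seq (mark d)) (b : nat -> mark d).

(** Unlike [running], this leaves the set after the last mark free: together with
    [active F h = fset0] it says that [h] is a complete sketch, emptied for the first time at its
    end. *)
Definition alive F h := forall n, (n < size h)%N -> active F (take n h) != fset0.

Lemma active_rcons F h r : active F (rcons h r) = step (active F h) r.
Proof. by rewrite /active foldl_rcons. Qed.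

Lemma alive_rcons F h r : alive F h -> active F h != fset0 -> alive F (rcons h r).
Proof.
move=> hF h0 n; rewrite size_rcons ltnS leq_eqVlt => /predU1P[->|nh].
  by rewrite -cats1 take_size_cat.
by rewrite -cats1 take_cat nh; exact: hF.
Qed.

Lemma alive_running F h : alive F h -> active F h != fset0 -> running F h.
Proof.
move=> hF h0 n; rewrite leq_eqVlt => /predU1P[->|nh]; first by rewrite take_size.
exact: hF.
Qed.

Lemma take_mkseq (T : Type) (b : nat -> T) m n : (m <= n)%N ->
  take m (mkseq b n) = mkseq b m.
Proof. by move=> mn; rewrite /mkseq -map_take take_iota (minn_idPl mn). Qed.

Lemma NstopP F b n : Nstop F b = Some n <->
  active F (mkseq b n) = fset0 /\ alive F (mkseq b n).
Proof.
rewrite /Nstop; case: pselect => [st|nst]; last first.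
  by split=> // -[h0 _]; exfalso; apply: nst; exists n; apply/eqP.
case: ex_minnP => m /eqP m0 mmin; split=> [[<-]|[n0 nF]].
  split=> // k; rewrite size_mkseq => km; rewrite take_mkseq ?(ltnW km)//.
  by apply/negP => /mmin; rewrite leqNgt km.
congr Some; apply/eqP; rewrite eqn_leq mmin ?n0//= leqNgt; apply/negP => mn.
have := nF m; rewrite size_mkseq => /(_ mn).
by rewrite take_mkseq ?m0 ?eqxx// ltnW.
Qed.

Lemma sketchP F b h : sketch F b = Some h <->
  [/\ mkseq b (size h) = h, active F h = fset0 & alive F h].
Proof.
rewrite /sketch; split.
  case E : Nstop => [n|//] /= [<-]; have [n0 nF] := (NstopP F b n).1 E.
  by rewrite size_mkseq.
move=> [bh h0 hF]; have -> : Nstop F b = Some (size h) by apply/NstopP; rewrite bh.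
by rewrite /= bh.
Qed.

End stopping.

(** * Expectations truncated to finitely many steps *)

Section kernels.
Context (R : realType) (d : nat) (A : borelSet R).
Local Notation S := (power (site d) (spin A)).
Context (rho : {finite_measure set (spin A) -> \bar R}).
Context (c : site d -> spin A -> S -> R).
Context (pm1 : site d -> spin A -> R) (pk : condDensity d A).
Hypothesis rho_neq0 : (rho setT != 0)%E.
Hypothesis c_gt0 : forall i a eta, 0 < c i a eta.
Hypothesis measurable_c : forall i,
  measurable_fun setT (fun x : spin A * S => c i x.1 x.2).
Hypothesis c_bounded : (ereal_sup (range (fun i => ereal_sup (range (fun eta =>
  \int[rho]_a (c i a eta)%:E)))) < +oo)%E.
Hypothesis dec : decomposition rho c pm1 pk.
Implicit Types (F : {fset site d}) (h : seq (mark d)) (f : S -> \bar R).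
Local Notation resample := (resample rho pm1 pk).
Local Notation prob F r := (choice_prob rho c F r).

(** Undefined sites receive a default spin, which lets Algorithm 2 be followed in [S]; along a
    complete sketch, almost surely no step reads such a site. *)
Definition fill (s : site d -> option (spin A)) : S := fun j => odflt point (s j).

(** Marks act on [f] in the order of Algorithm 1, the reverse of that of Algorithm 2: the symbol
    drawn last is integrated out first. *)
Fixpoint resample_seq h f : S -> \bar R :=
  if h is r :: h' then resample_seq h' (resample r f) else f.

Lemma resample_seq_rcons h r f :
  resample_seq (rcons h r) f = resample r (resample_seq h f).
Proof. by elim: h f => //= s h IH f; rewrite IH. Qed.

Lemma resample_seq_ge0 h f : (forall eta, 0 <= f eta)%E ->
  forall eta, (0 <= resample_seq h f eta)%E.
Proof. by elim: h f => //= r h IH f f0; apply: IH => eta; exact: (resample_ge0 dec). Qed.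

(* [stop_value n F f] is the expectation of [f] at the output of the algorithms
   started from [F], on the event that Algorithm 1 stops within [n] steps, and
   [survival n F] the probability that it does not. *)
Fixpoint stop_value (n : nat) F f : \bar R :=
  if F == fset0 then f (fill (fun=> None)) else
  if n is n'.+1 then
    (\esum_(r in [set: mark d]) ((prob F r)%:E * stop_value n' (step F r) (resample r f)))%E
  else 0%E.

Fixpoint survival (n : nat) F : \bar R :=
  if F == fset0 then 0%E else
  if n is n'.+1 then
    (\esum_(r in [set: mark d]) ((prob F r)%:E * survival n' (step F r)))%E
  else 1%E.

Lemma choice_prob_ge0 F r : 0 <= prob F r.
Proof.
by rewrite (choice_probE rho_neq0 c_gt0 measurable_c c_bounded dec) divr_ge0//
  ?(active_rate_ge0 rho_neq0)// (total_rate_ge0 rho_neq0).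
Qed.

Lemma esum_choice_prob F : F != fset0 ->
  (\esum_(r in [set: mark d]) (prob F r)%:E = 1)%E.
Proof.
move=> F0; have M0 := total_rate_gt0 rho_neq0 c_gt0 measurable_c c_bounded F0.
under eq_esum => r _.
  rewrite (choice_probE rho_neq0 c_gt0 measurable_c c_bounded dec) mulrC EFinM; over.
rewrite ge0_esumZl ?invr_ge0 ?ltW//; last first.
  by move=> r; rewrite lee_fin (active_rate_ge0 rho_neq0).
rewrite (esum_active_rate1 rho_neq0 c_gt0 measurable_c c_bounded dec).
by rewrite -EFinM mulVf// gt_eqF.
Qed.

Lemma stop_value_ge0 n F f : (forall eta, 0 <= f eta)%E -> (0 <= stop_value n F f)%E.
Proof.
elim: n F f => [|n IH] F f f0 /=; case: ifP => // _.
apply: esum_ge0 => r _; rewrite mule_ge0 ?lee_fin ?choice_prob_ge0// IH// => eta.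
exact: (resample_ge0 dec).
Qed.

Lemma survival_ge0 n F : (0 <= survival n F)%E.
Proof.
elim: n F => [|n IH] F /=; case: ifP => // _.
by apply: esum_ge0 => r _; rewrite mule_ge0 ?lee_fin ?choice_prob_ge0.
Qed.

(** Resampling fixes the constant 1, hence the two recursions add up to the sum of the choice
    probabilities. *)
Lemma stop_value1 n F : (stop_value n F (cst 1) + survival n F = 1)%E.
Proof.
elim: n F => [|n IH] F /=; case: ifPn => F0; rewrite ?adde0 ?add0e//.
have -> : (fun r => (prob F r)%:E * stop_value n (step F r) (resample r (cst 1)))%E =
          (fun r => (prob F r)%:E * stop_value n (step F r) (cst 1))%E.
  have t1 : local_test fset0 (cst 1%E : S -> \bar R).
    by split=> // eta; rewrite lee01 lexx.
  apply/funext => r; congr (_ * stop_value _ _ _)%E; apply/funext => eta.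
  by rewrite (resample_id dec _ t1).
rewrite -esumD; last 2 first.
- move=> r _; rewrite mule_ge0 ?lee_fin ?choice_prob_ge0//.
  by apply: stop_value_ge0 => eta; exact: lee01.
- by move=> r _; rewrite mule_ge0 ?lee_fin ?choice_prob_ge0// survival_ge0.
rewrite -[RHS](esum_choice_prob F0); apply: eq_esum => r _.
have e0 : (0 <= stop_value n (step F r) (cst 1))%E.
  by apply: stop_value_ge0 => eta; exact: lee01.
by rewrite -ge0_muleDr ?survival_ge0// IH mule1.
Qed.

End kernels.

(** * Partial configurations of Algorithm 2 *)

Section assignment.
Context (R : realType) (d : nat) (A : borelSet R).
Local Notation S := (power (site d) (spin A)).
Context (pm1 : site d -> spin A -> R) (pk : condDensity d A).
Implicit Types (h : seq (mark d)).

Lemma measurable_assign d' (X : measurableType d') h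
    (x : nat -> X -> option (spin A)) m j :
  (forall l, measurable_fun setT (x l)) ->
  measurable_fun setT (fun o => assign h (x ^~ o) m j).
Proof.
move=> mx; elim: m => [|m IH] /=; first exact: measurable_cst.
case: eqP => _ /=; last exact: IH.
have -> : (fun o => if x m o != None then x m o else assign h (x ^~ o) m j) =
          (fun o => if (x m o : bool) then x m o else assign h (x ^~ o) m j).
  by apply/funext => o; case: (x m o).
apply: measurable_fun_ifT => //.
exact: (measurableT_comp (@measurable_isSome _ _) (mx m)).
Qed.

Lemma assign_ext h (x y : nat -> option (spin A)) m :
  (forall l, (l < m)%N -> x l = y l) -> assign h x m = assign h y m.
Proof.
elim: m => //= m IH xy; apply/funext => j; rewrite xy// IH// => l lm.
by rewrite xy// ltnW.
Qed.

Lemma measurable_fill d' (X : measurableType d') (s : X -> site d -> option (spin A)) :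
  (forall j, measurable_fun setT (fun o => s o j)) ->
  measurable_fun setT (fun o => fill (s o)).
Proof.
move=> ms; apply: measurable_power => j.
exact: (measurableT_comp (@measurable_odflt _ _ point) (ms j)).
Qed.

Lemma fill_assign h (x : nat -> option (spin A)) m : fill (assign h x m.+1) =
  upd_star (fill (assign h x m)) (nth (0, None) h m).1 (x m).
Proof.
apply/funext => j; rewrite /fill /upd_star/=; case: eqP => //= ->.
by case: (x m).
Qed.

Lemma spins_onP (s : site d -> option (spin A)) (V : {fset site d}) (w : power V (spin A)) :
  spins_on s V = Some w <-> [/\ {in V, forall j, s j <> None} & w = restr V (fill s)].
Proof.
rewrite /spins_on; case: pselect => [ex|nex]; last first.
  split=> // -[sV _]; exfalso; apply: nex; exists (restr V (fill s)) => j.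
  by have := sV _ (valP j); rewrite /restr /fill; case: (s (val j)).
case: cid => v vs /=; split=> [[<-]|[_ ->]].
  split=> [j jV|]; first by have := vs [` jV]%fset => /= ->.
  by apply/funext => j; rewrite /restr /fill vs.
by congr Some; apply/funext => j; rewrite /restr /fill vs.
Qed.

Lemma spins_on_neq0 (s : site d -> option (spin A)) (V : {fset site d}) :
  spins_on s V <> None <-> {in V, forall j, s j <> None}.
Proof.
case E : spins_on => [w|]; first by have [sV _] := (spins_onP s w).1 E.
split=> // sV; have := (spins_onP s (restr V (fill s))).2 (conj sV erefl).
by rewrite E.
Qed.

Lemma symbol_densityE r s : ready r s ->
  symbol_density pm1 pk r s = mark_density pm1 pk r (fill s).
Proof.
rewrite /ready /symbol_density /mark_density; case: r => i [k|]//=.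
case E : spins_on => [w|//] _; apply/funext => a.
by have [_ ->] := (spins_onP s w).1 E.
Qed.

Lemma measurable_defined (V : {fset site d}) d' (X : measurableType d')
    (s : X -> site d -> option (spin A)) :
  (forall j, measurable_fun setT (fun o => s o j)) ->
  measurable [set o | {in V, forall j, s o j <> None}].
Proof.
move=> ms; rewrite (_ : [set _ | _] =
    \bigcap_(j in [set` V]) [set o | s o j <> None]); last first.
  by apply/seteqP; split=> o sV j; exact: sV.
apply: fin_bigcap_measurable; first exact: finite_fset.
move=> j _; rewrite (_ : [set _ | _] = (fun o => s o j : bool) @^-1` [set true]).
  rewrite -[X in measurable X]setTI.
  exact: (measurableT_comp (@measurable_isSome _ _) (ms j)).
by apply/seteqP; split=> o /=; case: (s o j).
Qed.

End assignment.

(** * A realization of the two algorithms *)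

Section run.
Context (R : realType) (d : nat) (A : borelSet R).
Local Notation S := (power (site d) (spin A)).
Context (rho : {finite_measure set (spin A) -> \bar R}).
Context (c : site d -> spin A -> S -> R).
Context (pm1 : site d -> spin A -> R) (pk : condDensity d A).
Hypothesis rho_neq0 : (rho setT != 0)%E.
Hypothesis c_gt0 : forall i a eta, 0 < c i a eta.
Hypothesis measurable_c : forall i,
  measurable_fun setT (fun x : spin A * S => c i x.1 x.2).
Hypothesis c_bounded : (ereal_sup (range (fun i => ereal_sup (range (fun eta =>
  \int[rho]_a (c i a eta)%:E)))) < +oo)%E.
Hypothesis dec : decomposition rho c pm1 pk.
Context (F : {fset site d}) (run : algorithms rho c pm1 pk F).
Local Notation Omega := (run_space run).
Local Notation P := (run_prob run).
Implicit Types (h : seq (mark d)) (f : S -> \bar R) (o : Omega).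

Let mk o : nat -> mark d := (@run_mark _ _ _ _ _ _ _ _ run) ^~ o.
Let sym o : nat -> option (spin A) := (@run_symbol _ _ _ _ _ _ _ _ run) ^~ o.

Lemma measurable_prefix n h : measurable [set o | mkseq (mk o) n = h].
Proof.
elim: n h => [|n IH] h.
  have [->|h0] := eqVneq h [::].
    by rewrite (_ : [set _ | _] = setT)//; apply/seteqP; split.
  rewrite (_ : [set _ | _] = set0)//; apply/seteqP; split=> // o /= e.
  by move: h0; rewrite -e.
case/lastP: h => [|h r].
  by rewrite (_ : [set _ | _] = set0)//; apply/seteqP; split.
rewrite (_ : [set _ | _] =
    [set o | mkseq (mk o) n = h] `&` [set o | mk o n = r]).
  by apply: measurableI; [exact: IH|exact: run_mark_measurable].
apply/seteqP; split=> o /=; rewrite mkseqS.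
  by move=> /eqP; rewrite eqseq_rcons => /andP[/eqP-> /eqP->].
by move=> [-> ->].
Qed.

Definition sketch_event h : set Omega := [set o | sketch F (mk o) = Some h].

Lemma sketch_eventE h : active F h = fset0 -> alive F h ->
  sketch_event h = [set o | mkseq (mk o) (size h) = h].
Proof.
move=> h0 hF; apply/seteqP; split=> o; first by move=> /sketchP[].
by move=> ?; apply/sketchP.
Qed.

Lemma measurable_sketch_event h : measurable (sketch_event h).
Proof.
have [[h0 hF]|nh] := pselect (active F h = fset0 /\ alive F h).
  by rewrite sketch_eventE//; exact: measurable_prefix.
rewrite (_ : sketch_event h = set0)//; apply/seteqP; split=> // o.
by move=> /sketchP[_ h0 hF]; apply: nh.
Qed.

Definition state h m o := assign (rev h) (sym o) m.

Lemma measurable_state h m j : measurable_fun setT (fun o => state h m o j).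
Proof. by apply: measurable_assign => l; exact: run_symbol_measurable. Qed.

Lemma measurable_ready r h m : measurable [set o | ready r (state h m o)].
Proof.
rewrite /ready; case: r => i [k|] /=; last first.
  by rewrite (_ : [set _ | _] = setT)//; apply/seteqP; split.
rewrite (_ : [set _ | _] = [set o | {in V_ i k, forall j, state h m o j <> None}]).
  by apply: measurable_defined => j; exact: measurable_state.
by apply/seteqP; split=> o /=; [move=> /spins_on_neq0|move=> ?; apply/spins_on_neq0].
Qed.

Section one_sketch.
Context (h : seq (mark d)).
Local Notation E := (sketch_event h).
Local Notation r_ m := (nth (0, None) (rev h) m).

Let E_ m : set Omega := [set o | E o /\ ready (r_ m) (state h m o)].

Lemma measurable_E_ m : measurable (E_ m).
Proof.
rewrite (_ : E_ m = E `&` [set o | ready (r_ m) (state h m o)])//.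
by apply: measurableI; [exact: measurable_sketch_event|exact: measurable_ready].
Qed.

Lemma integral_state_step m f : (m < size h)%N ->
  (forall eta, 0 <= f eta)%E -> measurable_fun setT f ->
  (\int[P]_(o in E_ m) f (fill (state h m.+1 o)) =
   \int[P]_(o in E_ m) resample rho pm1 pk (r_ m) f (fill (state h m o)))%E.
Proof.
move=> mh f0 mf.
(* The law of the next symbol is tested against functions of the [m] past ones only. They are
   prolonged to a sequence, of which the first [m] steps of [assign] read nothing else. *)
pose ext (x : power 'I_m (option (spin A))) l : option (spin A) :=
  if insub l is Some l' then x l' else None.
pose phi (z : power 'I_m (option (spin A)) * option (spin A)) : \bar R :=
  f (upd_star (fill (assign (rev h) (ext z.1) m)) (r_ m).1 z.2).
have mext l : measurable_fun setT (ext ^~ l).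
  by rewrite /ext; case: insub => [l'|]; [exact: measurable_coord|exact: measurable_cst].
have mphi : measurable_fun setT phi.
  have m1 : measurable_fun setT
      (fun z : power 'I_m (option (spin A)) * option (spin A) =>
        fill (assign (rev h) (ext z.1) m)).
    apply: measurable_fill => j.
    exact: (measurableT_comp (measurable_assign _ _ _ mext) measurable_fst).
  exact: (measurableT_comp mf (measurableT_comp (@measurable_upd_star _ _ _ (r_ m).1)
    (measurable_fun_pair measurable_snd m1))).
have phiE o a : phi ((fun l : 'I_m => sym o l) : power 'I_m _, a) =
    f (upd_star (fill (state h m o)) (r_ m).1 a).
  rewrite /phi /state; congr (f (upd_star (fill _) _ _)).
  by apply: assign_ext => l lm; rewrite /ext insubT.
have := @run_symbol_law _ _ _ _ _ _ _ _ run h m phi mh mphi (fun=> f0 _).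
rewrite /= -/(E_ m) => H.
transitivity (\int[P]_(o in E_ m) phi ((fun l : 'I_m => sym o l) : power 'I_m _, sym o m))%E.
  by apply: eq_integral => o _; rewrite phiE /state fill_assign.
rewrite {}H; apply: eq_integral => o /set_mem[_ ro]; apply: eq_integral => a _.
by rewrite [X in (X * _)%E](phiE o a) symbol_densityE// muleC.
Qed.

Hypothesis h_complete : active F h = fset0.

(** The active set before Algorithm 1 chose the last [m] marks: empty for [m = 0], equal to [F] for
    [m = size h]. These are the sites that Algorithm 2 must have defined after [m] steps. *)
Let C m := active F (take (size h - m) h).

Let CS m : (m < size h)%N -> C m = step (C m.+1) (r_ m).
Proof.
move=> mh; rewrite /C nth_rev// -active_rcons -take_nth; last by rewrite subnSK ?leq_subr.
by rewrite subnSK.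
Qed.

Let defined m : set Omega := [set o | {in C m, forall j, state h m o j <> None}].

Let mdefined m : measurable (defined m).
Proof. by apply: measurable_defined => j; exact: measurable_state. Qed.

Let mE : measurable E. Proof. exact: measurable_sketch_event. Qed.

Let symbol_null m : (m < size h)%N -> (r_ m).2 = None ->
  P (E `&` [set o | sym o m = None]) = 0%E.
Proof.
move=> mh rN.
have mN : measurable [set o | sym o m = None].
  rewrite (_ : [set _ | _] = (fun o => sym o m : bool) @^-1` [set false]).
    rewrite -[X in measurable X]setTI.
    exact: (measurableT_comp (@measurable_isSome _ _) (run_symbol_measurable (a := run) m)).
  by apply/seteqP; split=> o /=; case: (sym o m).
(* The indicator that the next symbol is Delta, to which a mark of range -1 gives density 0. *)
pose phi (z : power 'I_m (option (spin A)) * option (spin A)) : \bar R :=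
  if (z.2 : bool) then 0%E else 1%E.
have mphi : measurable_fun setT phi.
  apply: measurable_fun_ifT; [|exact: measurable_cst|exact: measurable_cst].
  exact: (measurableT_comp (@measurable_isSome _ _) measurable_snd).
have phi0 z : (0 <= phi z)%E by rewrite /phi; case: ifP; rewrite ?lee01.
have := @run_symbol_law _ _ _ _ _ _ _ _ run h m phi mh mphi phi0.
rewrite /= -/(E_ m).
have EE : E_ m = E.
  by apply/seteqP; split=> o; [case|move=> Eo; split=> //; rewrite /ready rN].
rewrite EE [RHS]integral0_eq; last first.
  move=> o _; apply: integral0_eq => -[a|] _; rewrite /phi/=; first by rewrite mul0e.
  by rewrite /symbol_density rN/= mule0.
have -> : (fun o => phi ((fun l : 'I_m => sym o l) : power 'I_m _, sym o m)) =
    (fun o => (\1_[set o | sym o m = None] o)%:E).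
  apply/funext => o; rewrite /phi/= indicE; case Es : (sym o m) => [a|] /=.
    by rewrite memNset//= Es.
  by rewrite mem_set.
by rewrite integral_indic// setIC.
Qed.

(** By induction, as a defined site stays defined. A mark of range [k >= 0] requires no new site,
    [C m.+1] being included in [C m]. A mark of range -1 adds at most its own site, which it defines
    unless Delta is drawn, a null event. *)
Lemma undefined_null m : (m <= size h)%N -> P (E `\` defined m) = 0%E.
Proof.
elim: m => [|m IH] mh.
  rewrite (_ : _ `\` _ = set0) ?measure0//; apply/seteqP; split=> // o [_ /=].
  by case=> j; rewrite /C subn0 take_size h_complete.
have mN : measurable (E `&` [set o | sym o m = None]).
  apply: measurableI => //.
  rewrite (_ : [set _ | _] = (fun o => sym o m : bool) @^-1` [set false]).
    rewrite -[X in measurable X]setTI.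
    exact: (measurableT_comp (@measurable_isSome _ _) (run_symbol_measurable (a := run) m)).
  by apply/seteqP; split=> o /=; case: (sym o m).
have sub : E `\` defined m.+1 `<=` (E `\` defined m) `|`
    (if (r_ m).2 is None then E `&` [set o | sym o m = None] else set0).
  move=> o [Eo nd]; apply: contrapT => /not_orP[nEd ns].
  have dm : defined m o by apply: contrapT => nd'; apply: nEd.
  apply: nd => j jC; rewrite /state/=.
  have [jr|jr] /= := eqVneq j (r_ m).1; last first.
    apply: dm; rewrite CS// /step; case: (r_ m).2 => [k|].
      by rewrite in_fsetU jC.
    by rewrite in_fsetD1 jr jC.
  case Es : (sym o m) => [a|] //=; apply: dm; rewrite CS// /step.
  move: ns; case: (r_ m).2 => [k|]; first by rewrite in_fsetU jC.
  by case.
apply/eqP; rewrite -measure_le0; apply: le_trans (le_measure _ _ _ sub) _; rewrite ?inE.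
- exact: measurableD.
- by apply: measurableU; [exact: measurableD|case: (r_ m).2].
have U0 (B D : set Omega) : measurable B -> measurable D -> P B = 0%E -> P D = 0%E ->
    (P (B `|` D) <= 0)%E.
  by move=> mB mD B0 D0; rewrite measure_le0; apply/eqP; exact: etrans (measureU0 mB mD D0) B0.
apply: U0; [exact: measurableD|by case: (r_ m).2|exact: IH (ltnW mh)|].
by case Er : (r_ m).2 => [k|]; [rewrite measure0|rewrite symbol_null].
Qed.

Let ready_defined m o : (m < size h)%N -> defined m o -> ready (r_ m) (state h m o).
Proof.
move=> mh dm; rewrite /ready; case Er : (r_ m).2 => [k|//].
apply/spins_on_neq0 => j jV; apply: dm.
by rewrite CS// /step Er in_fsetU jV orbT.
Qed.

Let unready_null m : (m < size h)%N -> P (E `\` E_ m) = 0%E.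
Proof.
move=> mh; apply/eqP; rewrite -measure_le0 -(undefined_null (ltnW mh)) le_measure ?inE//.
- by apply: measurableD => //; exact: measurable_E_.
- exact: measurableD.
by move=> o [Eo nEo]; split=> // dm; apply: nEo; split=> //; exact: ready_defined.
Qed.

Let measurable_f_state f m : measurable_fun setT f ->
  measurable_fun setT (fun o => f (fill (state h m o))).
Proof.
move=> mf; apply: (measurableT_comp mf).
by apply: measurable_fill => j; exact: measurable_state.
Qed.

(** Integrating out the last symbol replaces [f] by its resampling and [m.+1] by [m]; the last mark
    processed is the one at position [size h - m.+1] of the sketch. *)
Lemma integral_state m f : (m <= size h)%N ->
  (forall eta, 0 <= f eta)%E -> measurable_fun setT f ->
  (\int[P]_(o in E) f (fill (state h m o)) =
   P E * resample_seq rho pm1 pk (drop (size h - m) h) f (fill (fun=> None)))%E.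
Proof.
elim: m f => [|m IH] f mh f0 mf.
  by rewrite subn0 drop_size/= (integral_cst P mE (f (fill (fun=> None)))) muleC.
have rf0 eta : (0 <= resample rho pm1 pk (r_ m) f eta)%E by exact: (resample_ge0 dec).
have mrf := measurable_resample dec (r_ m) f0 mf.
have EE : E_ m `<=` E by move=> o [].
(* The law of the symbol is prescribed on [E_ m] only, which fills [E] up to a null set; the domain
   is shrunk for this step and then restored for the induction. *)
rewrite (ge0_integral_null_diff mE (measurable_E_ m) EE (unready_null mh))//; last first.
  exact: measurable_f_state.
rewrite integral_state_step//.
rewrite -(ge0_integral_null_diff mE (measurable_E_ m) EE (unready_null mh))//; last first.
  exact: measurable_f_state.
rewrite IH ?(ltnW mh)//; congr (_ * _)%E.
rewrite [in RHS](drop_nth (0, None)); last by rewrite -subn_gt0 subKn.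
by rewrite subnSK//= nth_rev.
Qed.

End one_sketch.

(** Lists of marks being countable, any predicate of a prefix is a countable union of prefix
    events. *)
Lemma measurable_prefix_pred n (Q : seq (mark d) -> Prop) :
  measurable [set o | Q (mkseq (mk o) n)].
Proof.
rewrite (_ : [set _ | _] = \bigcup_h (if `[< Q h >] then
    [set o | mkseq (mk o) n = h] else set0)).
  apply: countable_union_measurable => h.
  by case: ifP => _; [exact: measurable_prefix|].
apply/seteqP; split=> [ o Qo|o [h _]].
  by exists (mkseq (mk o) n) => //; rewrite asboolT.
by case: asboolP => // Qh /= ->.
Qed.

Definition output_config o : S :=
  if sketch F (mk o) is Some h then fill (state h (size h) o) else fill (fun=> None).

Lemma output_configE h o : sketch_event h o ->
  output_config o = fill (state h (size h) o).
Proof. by rewrite /sketch_event /output_config /= => ->. Qed.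

Let mfill h m : measurable_fun setT (fun o => fill (state h m o)).
Proof. by apply: measurable_fill => j; exact: measurable_state. Qed.

Lemma measurable_output_config : measurable_fun setT output_config.
Proof.
move=> _ B mB; rewrite setTI.
pose G h := sketch_event h `&` (fun o => fill (state h (size h) o)) @^-1` B.
have mG h : measurable (G h).
  apply: measurableI; first exact: measurable_sketch_event.
  by rewrite -[X in measurable X]setTI; exact: mfill.
pose N := ~` \bigcup_h sketch_event h.
have mN : measurable N.
  apply: measurableC; apply: countable_union_measurable => h.
  exact: measurable_sketch_event.
have -> : output_config @^-1` B =
    \bigcup_h G h `|` (if `[< B (fill (fun=> None)) >] then N else set0).
  apply/seteqP; split=> o.
    rewrite /output_config /=; case E : sketch => [h|] Bo.
      by left; exists h => //; split.
    right; rewrite asboolT// => -[h _]; rewrite /sketch_event /= E.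
    by [].
  move=> [[h _ [oh Bo]]|]; first by rewrite /= (output_configE oh).
  case: asboolP => // B0 No; rewrite /output_config /=.
  by case E : sketch => [h|]//; exfalso; apply: No; exists h.
apply: measurableU; first exact: countable_union_measurable.
by case: ifP.
Qed.

Definition stopped n : set Omega :=
  [set o | exists2 k, (k <= n)%N & active F (mkseq (mk o) k) = fset0].

Lemma measurable_stopped n : measurable (stopped n).
Proof.
rewrite (_ : stopped n = [set o | exists2 k, (k <= n)%N &
    active F (take k (mkseq (mk o) n)) = fset0]).
  exact: (measurable_prefix_pred n (fun h => exists2 k, (k <= n)%N &
    active F (take k h) = fset0)).
by apply/seteqP; split=> o [k kn e]; exists k => //; move: e; rewrite take_mkseq.
Qed.

Let prefix_event h : set Omega := [set o | mkseq (mk o) (size h) = h].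

(** Induction on the number [n] of steps left, with the prefix general. If the active set is empty,
    the prefix is the whole sketch and [integral_state] computes the integral; otherwise the event
    splits according to the next mark, whose conditional law is [choice_prob]. *)
Lemma integral_prefix_stopped n h f : alive F h ->
  (forall eta, 0 <= f eta)%E -> measurable_fun setT f ->
  (\int[P]_(o in prefix_event h `&` stopped (size h + n)) f (output_config o) =
   P (prefix_event h) *
     stop_value rho c pm1 pk n (active F h) (resample_seq rho pm1 pk h f))%E.
Proof.
move=> hF f0 mf.
have mfX : measurable_fun setT (f \o output_config).
  exact: measurableT_comp mf measurable_output_config.
elim: n h hF => [|n IH] h hF.
  have [h0|h0] := eqVneq (active F h) fset0.
    have -> : prefix_event h `&` stopped (size h + 0) = sketch_event h.
      rewrite sketch_eventE//; apply/seteqP; split=> o; first by case.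
      by move=> ho; split=> //; exists (size h); rewrite ?addn0// (ho : _ = h).
    rewrite -[prefix_event h]/[set o | mkseq (mk o) (size h) = h] -(sketch_eventE h0 hF).
    under eq_integral => o /set_mem oh do rewrite (output_configE oh).
    by rewrite (integral_state h0 (leqnn _) f0 mf) subnn drop0/= h0 eqxx.
  rewrite /= (negbTE h0) mule0 (_ : _ `&` _ = set0) ?integral_set0//.
  apply/seteqP; split=> // o [ho [k]]; rewrite addn0 leq_eqVlt => /predU1P[->|kh].
    by rewrite (ho : _ = h) => e; rewrite e eqxx in h0.
  by rewrite -(take_mkseq _ (ltnW kh)) (ho : _ = h) => e; have := hF k kh; rewrite e eqxx.
have [h0|h0] := eqVneq (active F h) fset0.
  have -> : prefix_event h `&` stopped (size h + n.+1) = sketch_event h.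
    rewrite sketch_eventE//; apply/seteqP; split=> o; first by case.
    by move=> ho; split=> //; exists (size h); rewrite ?leq_addr// (ho : _ = h).
  rewrite -[prefix_event h]/[set o | mkseq (mk o) (size h) = h] -(sketch_eventE h0 hF).
  under eq_integral => o /set_mem oh do rewrite (output_configE oh).
  by rewrite (integral_state h0 (leqnn _) f0 mf) subnn drop0/= h0 eqxx.
have hrF r := @alive_rcons _ F h r hF h0.
pose D r := prefix_event (rcons h r) `&` stopped (size (rcons h r) + n).
have mD r : measurable (D r).
  by apply: measurableI; [exact: measurable_prefix|exact: measurable_stopped].
have tD : trivIset setT D.
  move=> r r' _ _ [ o [[+ _] [+ _]]]; rewrite /prefix_event /= !size_rcons => -> /eqP.
  by rewrite eqseq_rcons => /andP[_ /eqP].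
have -> : prefix_event h `&` stopped (size h + n.+1) = \bigcup_r D r.
  apply/seteqP; split=> [ o [ho so]|o [r _ []]].
    exists (mk o (size h)) => //; split; last by rewrite size_rcons addSnnS.
    by rewrite /prefix_event /= size_rcons mkseqS (ho : _ = h).
  rewrite /prefix_event /= size_rcons addSnnS mkseqS => /eqP.
  by rewrite eqseq_rcons => /andP[/eqP-> _] so; split.
rewrite (ge0_integral_partition P mD tD (fun o => f0 (output_config o)) mfX).
rewrite /= (negbTE h0).
have Pfin : P (prefix_event h) = (fine (P (prefix_event h)))%:E.
  by rewrite fineK// fin_num_measure//; exact: measurable_prefix.
rewrite Pfin -ge0_esumZl; last 2 first.
- move=> r.
  rewrite mule_ge0 ?lee_fin ?(choice_prob_ge0 rho_neq0 c_gt0 measurable_c c_bounded dec)//.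
  apply: (stop_value_ge0 rho_neq0 c_gt0 measurable_c c_bounded dec) => eta.
  by apply: (resample_ge0 dec) => zeta; exact: (resample_seq_ge0 dec).
- by rewrite fine_ge0.
apply: eq_esum => r _; rewrite IH// active_rcons resample_seq_rcons muleA -Pfin.
congr (_ * _)%E; rewrite /prefix_event size_rcons.
by apply: run_mark_law; exact: alive_running.
Qed.

Lemma integral_stopped n f : (forall eta, 0 <= f eta)%E -> measurable_fun setT f ->
  (\int[P]_(o in stopped n) f (output_config o) = stop_value rho c pm1 pk n F f)%E.
Proof.
move=> f0 mf; have := @integral_prefix_stopped n [::] f _ f0 mf.
rewrite /= add0n; have -> : prefix_event [::] = setT by apply/seteqP; split.
by rewrite setTI probability_setT mul1e; apply.
Qed.

Lemma prob_stopped n : P (stopped n) = stop_value rho c pm1 pk n F (cst 1%E).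
Proof.
rewrite -integral_stopped//; first by rewrite integral_cst ?mul1e//; exact: measurable_stopped.
Qed.

Lemma survivalE n : survival rho c n F = P (~` stopped n).
Proof.
rewrite probability_setC//; last exact: measurable_stopped.
rewrite prob_stopped.
have := stop_value1 rho_neq0 c_gt0 measurable_c c_bounded dec n F.
have : stop_value rho c pm1 pk n F (cst 1%E) \is a fin_num.
  by rewrite -prob_stopped fin_num_measure//; exact: measurable_stopped.
by move=> fs e; rewrite -[X in (X - _)%E]e addeAC subee// add0e.
Qed.

Lemma integral_output_bounds n f : measurable_fun setT f ->
  (forall eta, 0 <= f eta <= 1)%E ->
  (stop_value rho c pm1 pk n F f <= \int[P]_o f (output_config o) <=
   stop_value rho c pm1 pk n F f + survival rho c n F)%E.
Proof.
move=> mf f01; have f0 eta : (0 <= f eta)%E by have /andP[] := f01 eta.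
have f1 eta : (f eta <= 1)%E by have /andP[] := f01 eta.
have mfX : measurable_fun setT (f \o output_config).
  exact: measurableT_comp mf measurable_output_config.
have mS := measurable_stopped n.
have -> : (\int[P]_o f (output_config o) = stop_value rho c pm1 pk n F f +
    \int[P]_(o in ~` stopped n) f (output_config o))%E.
  rewrite -integral_stopped// -ge0_integral_setU ?setUv//.
  - exact: measurableC.
  - by apply/disj_setPCl.
rewrite leeDl ?integral_ge0//= leeD2l//.
apply: (@le_trans _ _ (P (~` stopped n))).
  rewrite -[leRHS]mul1e -integral_cst; last exact: measurableC.
  apply: ge0_le_integral => //; first exact: measurableC.
  exact: measurable_funS mfX.
by rewrite survivalE.
Qed.

Hypothesis stops1 : P (stops run) = 1%E.

Lemma stops_bigcup : stops run = \bigcup_n stopped n.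
Proof.
apply/seteqP; split=> [ o|o [n _ [k kn]] k0].
  rewrite /stops /run_Nstop /=; case E : Nstop => [n|//] _.
  have [n0 _] := (NstopP F _ n).1 E.
  by exists n => //; exists n.
rewrite /stops /run_Nstop /= /Nstop; case: pselect => // nex.
by exfalso; apply: nex; exists k; apply/eqP.
Qed.

Lemma sketch_bigcup : stops run = \bigcup_h sketch_event h.
Proof.
apply/seteqP; split=> o.
  rewrite /stops /run_Nstop /=; case E : Nstop => [n|//] _.
  by exists (mkseq (mk o) n) => //; rewrite /sketch_event /= /sketch E.
move=> [h _]; rewrite /sketch_event /stops /run_Nstop /= /sketch.
by case: Nstop.
Qed.

Lemma survival_cvg0 : survival rho c n F @[n --> \oo] --> 0%E.
Proof.
rewrite (_ : (fun n => survival rho c n F) = fun n => P (~` stopped n)); last first.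
  by apply/funext => n; exact: survivalE.
have mS := measurable_stopped.
have mB : measurable (\bigcup_n stopped n) by exact: bigcupT_measurable.
under eq_fun do rewrite probability_setC//.
have -> : 0%E = (1 - P (\bigcup_n stopped n))%E by rewrite -stops_bigcup stops1 subee.
apply: cvgeB => //; first exact: cvg_cst.
apply: nondecreasing_cvg_mu => // m n mn; apply/subsetPset => o [k km k0].
by exists k => //; exact: leq_trans mn.
Qed.

Lemma success_bigcup : success run = \bigcup_h (sketch_event h `&`
  ([set o | {in F, forall j, state h (size h) o j <> None}] `&`
   \bigcap_(m in [set m | (m < size h)%N])
     [set o | ready (nth (0, None) (rev h) m) (state h m o)])).
Proof.
apply/seteqP; split=> [ o [ro [h oh rh]]|o [h _ [oh [dh rh]]]].
  exists h => //; split=> //; split=> //.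
  by move: ro; rewrite /run_output oh => /spins_on_neq0.
split; last by exists h.
rewrite /run_output -[run_sketch o]/(sketch F (mk o)) oh.
exact/spins_on_neq0.
Qed.

Lemma measurable_success : measurable (success run).
Proof.
rewrite success_bigcup; apply: countable_union_measurable => h.
apply: measurableI; first exact: measurable_sketch_event.
apply: measurableI.
  by apply: measurable_defined => j; exact: measurable_state.
by apply: bigcap_measurableType => m _; exact: measurable_ready.
Qed.

Lemma prob_success : P (success run) = 1%E.
Proof.
(* Exceptional events indexed by a complete sketch and a number of steps of Algorithm 2: some site
   that should be defined is not. They are countably many and null, and off their union every step
   is ready and [F] is defined at the end. *)
pose G (hm : seq (mark d) * nat) : set Omega :=
  if `[< active F hm.1 = fset0 /\ (hm.2 <= size hm.1)%N >] then
    sketch_event hm.1 `\` [set o | {in active F (take (size hm.1 - hm.2) hm.1),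
      forall j, state hm.1 hm.2 o j <> None}] else set0.
have mG hm : measurable (G hm).
  rewrite /G; case: ifP => // _; apply: measurableD; first exact: measurable_sketch_event.
  by apply: measurable_defined => j; exact: measurable_state.
have G0 : P (\bigcup_hm G hm) = 0%E.
  apply/negligibleP; first exact: countable_union_measurable.
  pose G' n := if pickle_inv n is Some hm then G hm else set0.
  have -> : \bigcup_hm G hm = \bigcup_n G' n.
    apply/seteqP; split=> [ o [hm _ Go]|o [n _]].
      by exists (choice.pickle hm) => //; rewrite /G' pickleK_inv.
    by rewrite /G'; case: pickle_inv => // hm Go; exists hm.
  apply: negligible_bigcup => n; rewrite /G'; case: pickle_inv => [hm|]; last first.
    exact: negligible_set0.
  apply/negligibleP => //; rewrite /G; case: asboolP => [[h0 mh]|_]; last exact: measure0.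
  exact: undefined_null.
have sub : stops run `\` success run `<=` \bigcup_hm G hm.
  move=> o []; rewrite sketch_bigcup => -[h _ oh] ns; apply: contrapT => nG.
  have [_ h0 _] := (sketchP F _ h).1 oh.
  have dm m : (m <= size h)%N -> {in active F (take (size h - m) h),
      forall j, state h m o j <> None}.
    move=> mh; apply: contrapT => nd; apply: nG; exists (h, m) => //.
    by rewrite /G asboolT.
  apply: ns; rewrite success_bigcup; exists h => //; split=> //; split=> [/=|m mh].
    by have := dm _ (leqnn _); rewrite subnn take0.
  rewrite /ready; case Er : (nth (0, None) (rev h) m).2 => [k|//].
  apply/spins_on_neq0 => j jV; apply: (dm m (ltnW mh)).
  have -> : take (size h - m) h =
      rcons (take (size h - m.+1) h) (nth (0, None) (rev h) m).
    rewrite nth_rev// -take_nth; last by rewrite -subn_gt0 subKn.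
    by rewrite subnSK.
  by rewrite active_rcons /step Er in_fsetU jV orbT.
have mstops : measurable (stops run).
  by rewrite sketch_bigcup; apply: countable_union_measurable => h; exact: measurable_sketch_event.
have mD := measurableD mstops measurable_success.
have D0 : P (stops run `\` success run) = 0%E.
  apply/eqP; rewrite -measure_le0 -G0 le_measure ?inE//.
  exact: countable_union_measurable.
apply/eqP; rewrite eq_le probability_le1/=; last exact: measurable_success.
rewrite -stops1 (measure_null_diff mstops measurable_success D0).
by rewrite le_measure ?inE//; [exact: measurableI measurable_success|exact: measurable_success].
Qed.

Lemma run_output_success o : success run o ->
  run_output o = Some (restr F (output_config o)).
Proof.
rewrite success_bigcup => -[h _ [oh [dh _]]].
rewrite (output_configE oh) /run_output -[run_sketch o]/(sketch F (mk o)) oh.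
exact/spins_onP.
Qed.

Lemma measurable_run_output (D : set (power F (spin A))) : measurable D ->
  measurable [set o : Omega | exists2 x, D x & run_output o = Some x].
Proof.
move=> mD; rewrite (_ : [set _ | _] = \bigcup_h (sketch_event h `&`
    ([set o | {in F, forall j, state h (size h) o j <> None}] `&`
     (fun o => restr F (fill (state h (size h) o))) @^-1` D))).
  apply: countable_union_measurable => h.
  apply: measurableI; first exact: measurable_sketch_event.
  apply: measurableI.
    by apply: measurable_defined => j; exact: measurable_state.
  rewrite -[X in measurable X]setTI.
  exact: (measurableT_comp (@measurable_restr _ _ _ F) (mfill h (size h))).
apply/seteqP; split=> [ o [x Dx]|o [h _ [oh [dh Dh]]]].
  rewrite /run_output -[run_sketch o]/(sketch F (mk o)).
  case E : sketch => [h|//] /spins_onP[dh xE].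
  by exists h => //; split=> //; split=> //; rewrite /= -xE.
exists (restr F (fill (state h (size h) o))) => //.
rewrite /run_output -[run_sketch o]/(sketch F (mk o)) oh.
exact/spins_onP.
Qed.

Lemma prob_run_output (D : set (power F (spin A))) : measurable D ->
  P [set o | exists2 x, D x & run_output o = Some x] =
  P (output_config @^-1` (restr F @^-1` D)).
Proof.
move=> mD.
have mS := measurable_success.
have PI B : measurable B -> P B = P (B `&` success run).
  move=> mB; apply: measure_null_diff => //.
  apply/eqP; rewrite -measure_le0.
  have <- : P (~` success run) = 0%E.
    by rewrite probability_setC// prob_success subee.
  rewrite le_measure ?inE//; first exact: measurableD.
  exact: measurableC.
rewrite PI; last exact: measurable_run_output.
rewrite [RHS]PI; last first.
  rewrite -[X in measurable X]setTI.
  exact: (measurableT_comp (@measurable_restr _ _ _ F) measurable_output_config).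
congr (P _); apply/seteqP; split=> o [].
  by move=> [x Dx] + so; rewrite (run_output_success so) => -[xE]; split=> //=; rewrite xE.
by move=> Do so; split=> //; exists (restr F (output_config o)) => //; exact: run_output_success.
Qed.

End run.

(** * First-step equation and consistency *)

Section law.
Context (R : realType) (d : nat) (A : borelSet R).
Local Notation S := (power (site d) (spin A)).
Context (rho : {finite_measure set (spin A) -> \bar R}).
Context (c : site d -> spin A -> S -> R).
Context (pm1 : site d -> spin A -> R) (pk : condDensity d A).
Hypothesis rho_neq0 : (rho setT != 0)%E.
Hypothesis c_gt0 : forall i a eta, 0 < c i a eta.
Hypothesis measurable_c : forall i,
  measurable_fun setT (fun x : spin A * S => c i x.1 x.2).
Hypothesis c_bounded : (ereal_sup (range (fun i => ereal_sup (range (fun eta =>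
  \int[rho]_a (c i a eta)%:E)))) < +oo)%E.
Hypothesis dec : decomposition rho c pm1 pk.
Context (run : forall F : {fset site d}, algorithms rho c pm1 pk F).
Hypothesis stops1 : forall F, run_prob (run F) (stops (run F)) = 1%E.

Implicit Types (F G : {fset site d}) (f : S -> \bar R).
Local Notation resample := (resample rho pm1 pk).
Local Notation prob F r := (choice_prob rho c F r).
Local Notation surv := (survival rho c).
Local Notation rate := (active_rate rho c).
Local Notation total := (total_rate rho c).

Let rate_ge0 := active_rate_ge0 rho_neq0 c_gt0 measurable_c c_bounded.
Let prob_ge0 := choice_prob_ge0 rho_neq0 c_gt0 measurable_c c_bounded dec.
Let surv_ge0 := survival_ge0 rho_neq0 c_gt0 measurable_c c_bounded dec.

(** The law of a full configuration, so that all [F] share one space; only its marginal on [F] is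
    the law of the output. *)
Definition law F : probability S R := sval (cid (pushforward_probability
  (run_prob (run F)) (@measurable_output_config _ _ _ _ _ _ _ _ (run F)))).

Lemma lawE F B : law F B = run_prob (run F) (@output_config _ _ _ _ _ _ _ _ (run F) @^-1` B).
Proof. by rewrite /law; case: cid => Q /= []. Qed.

Lemma integral_law F f : (forall eta, 0 <= f eta)%E -> measurable_fun setT f ->
  (\int[law F]_eta f eta = \int[run_prob (run F)]_o f (output_config o))%E.
Proof. by rewrite /law; case: cid => Q /= [_]; apply. Qed.

Lemma probability_integral01 (Q : probability S R) F f : local_test F f ->
  (0 <= \int[Q]_eta f eta <= 1)%E.
Proof.
move=> [mf f01 _]; rewrite integral_ge0/=; last first.
  by move=> eta _; have /andP[] := f01 eta.
have <- : (\int[Q]_eta cst 1 eta = 1)%E.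
  by rewrite integral_cst// mul1e; exact: probability_setT.
exact: ge0_integral_mono.
Qed.

Lemma survival_small F (e : R) : 0 < e ->
  exists N, forall n, (N <= n)%N -> (surv n F <= e%:E)%E.
Proof.
move=> e0.
have /fine_cvgP[fs] := survival_cvg0 rho_neq0 c_gt0 measurable_c c_bounded dec (stops1 F).
move=> /cvgrPdist_le/(_ e e0) se; have [N _ HN] := filterI fs se.
exists N => n Nn; have [fn] := HN n Nn.
rewrite sub0r normrN ger0_norm; last by rewrite fine_ge0.
by move=> ?; rewrite -(fineK fn) lee_fin.
Qed.

Lemma law_stop_value n F f : local_test F f ->
  close (surv n F) (\int[law F]_eta f eta)%E (stop_value rho c pm1 pk n F f).
Proof.
move=> [mf f01 _]; have f0 eta : (0 <= f eta)%E by have /andP[] := f01 eta.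
rewrite integral_law//.
have /andP[l u] := integral_output_bounds rho_neq0 c_gt0 measurable_c c_bounded dec
  (run F) n mf f01.
by split=> //; apply: le_trans l _; rewrite leeDl.
Qed.

(** The realizations for [F] and for [step F r] live on unrelated spaces, so the equation is read
    off the recursion of [stop_value]. Truncation costs [surv N.+1 F] for [F] and, by the recursion
    of [survival], the same amount for the successors together; hence the two halves of [e]. *)
Lemma law_first_choice F f : F != fset0 -> local_test F f ->
  (\int[law F]_eta f eta =
   \esum_(r in [set: mark d]) ((prob F r)%:E * \int[law (step F r)]_eta resample r f eta))%E.
Proof.
move=> F0 tf; apply: close_eq => e e0.
have e20 : 0 < e / 2 by rewrite divr_gt0.
have [N HN] := survival_small F e20.
have sN := HN N.+1 (leqnSn N).
have [a1 a2] := law_stop_value N.+1 tf.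
have [mf f01 _] := tf; have f0 eta : (0 <= f eta)%E by have /andP[] := f01 eta.
have rf0 r eta : (0 <= resample r f eta)%E by exact: (resample_ge0 dec).
have int0 r : (0 <= \int[law (step F r)]_eta resample r f eta)%E.
  by apply: integral_ge0.
have [] := @close_esum R (mark d) (fun r => prob F r)
  (fun r => \int[law (step F r)]_eta resample r f eta)%E
  (fun r => stop_value rho c pm1 pk N (step F r) (resample r f))
  (fun r => surv N (step F r)).
- by move=> r; exact: prob_ge0.
- by [].
- move=> r; exact: (stop_value_ge0 rho_neq0 c_gt0 measurable_c c_bounded dec).
- by move=> r; exact: surv_ge0.
- by move=> r; right; apply: law_stop_value; exact: (resample_local dec).
move: a1 a2 sN; rewrite /= (negbTE F0).
set X := (\int[_]_eta f eta)%E; set V := (\esum_(r in _) _)%E; set s := (\esum_(r in _) _)%E.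
set Y := (\esum_(r in _) _)%E => XV VX se YV VY.
have ss : (s + s <= e%:E)%E.
  by rewrite [in leRHS](splitr e) EFinD; exact: leeD.
split; [apply: (le_trans XV)|apply: (le_trans YV)];
  [apply: (@le_trans _ _ (Y + s + s)%E)|apply: (@le_trans _ _ (X + s + s)%E)];
  by rewrite ?leeD2r// -addeA leeD2l.
Qed.

(** Multiplied by the total rate, the equation covers the empty set too and has the weights of
    [generatorE]. *)
Lemma law_first_step F f : local_test F f ->
  ((total F)%:E * \int[law F]_eta f eta =
   \esum_(r in [set: mark d]) ((rate F r)%:E * \int[law (step F r)]_eta resample r f eta))%E.
Proof.
move=> tf; have [mf f01 _] := tf.
have f0 eta : (0 <= f eta)%E by have /andP[] := f01 eta.
have int0 r : (0 <= \int[law (step F r)]_eta resample r f eta)%E.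
  by apply: integral_ge0 => eta _; exact: (resample_ge0 dec).
have [F0|F0] := eqVneq F fset0.
  rewrite esum1; last by move=> r _; rewrite /active_rate F0 in_fset0 mul0e.
  by rewrite F0 /total_rate big_nil mul0e.
have M0 := total_rate_gt0 rho_neq0 c_gt0 measurable_c c_bounded F0.
rewrite law_first_choice// -ge0_esumZl ?(ltW M0)//; last first.
  by move=> r; rewrite mule_ge0// lee_fin prob_ge0.
apply: eq_esum => r _; rewrite muleA -EFinM.
rewrite (choice_probE rho_neq0 c_gt0 measurable_c c_bounded dec).
by rewrite mulrCA divff ?mulr1// gt_eqF.
Qed.

Lemma step_sub F G r : {subset F <= G} -> {subset step F r <= step G r}.
Proof.
move=> FG j; rewrite /step; case: r.2 => [k|].
  by rewrite !in_fsetU => /orP[/FG->//|->]; rewrite orbT.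
by rewrite !in_fsetD1 => /andP[-> /FG].
Qed.

Lemma survivalS n F : F != fset0 ->
  ((total F)%:E * surv n.+1 F =
   \esum_(r in [set: mark d]) ((rate F r)%:E * surv n (step F r)))%E.
Proof.
move=> F0; have M0 := total_rate_gt0 rho_neq0 c_gt0 measurable_c c_bounded F0.
rewrite /= (negbTE F0) -ge0_esumZl ?(ltW M0)//; last first.
  by move=> r; rewrite mule_ge0// lee_fin prob_ge0.
apply: eq_esum => r _; rewrite muleA -EFinM.
rewrite (choice_probE rho_neq0 c_gt0 measurable_c c_bounded dec).
by rewrite mulrCA divff ?mulr1// gt_eqF.
Qed.

Lemma close_pmul (M : R) (s x y : \bar R) : 0 < M -> (0 <= s)%E -> (0 <= x)%E -> (0 <= y)%E ->
  close (M%:E * s) (M%:E * x) (M%:E * y) -> close s x y.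
Proof.
by move=> M0 s0 x0 y0 []; rewrite -!ge0_muleDr// !lee_pmul2l// ?lte_fin.
Qed.

(** After multiplication by the total rate of [G], both sides are sums over marks with the weights
    [rate G], and the induction hypothesis compares them term by term. *)
Lemma close_law n F G f : {subset F <= G} -> local_test F f ->
  close (surv n G) (\int[law F]_eta f eta)%E (\int[law G]_eta f eta)%E.
Proof.
elim: n F G f => [|n IH] F G f FG tf.
  have [G0|G0] := eqVneq G fset0.
    have -> : F = G by apply/fsetP => j; apply/idP/idP => [/FG//|]; rewrite G0 in_fset0.
    exact: close_refl.
  rewrite /= (negbTE G0); apply: close_trivial; exact: probability_integral01 tf.
have [G0|G0] := eqVneq G fset0.
  have -> : F = G by apply/fsetP => j; apply/idP/idP => [/FG//|]; rewrite G0 in_fset0.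
  by apply: close_refl; exact: surv_ge0.
have M0 := total_rate_gt0 rho_neq0 c_gt0 measurable_c c_bounded G0.
have tG := local_test_sub FG tf.
have [mf f01 _] := tf; have f0 eta : (0 <= f eta)%E by have /andP[] := f01 eta.
have i0 H : (0 <= \int[law H]_eta f eta)%E by exact: integral_ge0.
have ir0 H r : (0 <= \int[law H]_eta resample r f eta)%E.
  by apply: integral_ge0 => eta _; exact: (resample_ge0 dec).
apply: (close_pmul M0) => //; rewrite survivalS// (law_first_step tG).
pose D := (G `\` F)%fset.
have rateE r : rate G r = rate F r + rate D r.
  rewrite /active_rate in_fsetD; have [rF|rF] /= := boolP (r.1 \in F).
    by rewrite FG// addr0.
  by rewrite add0r.
have totalE : ((total G)%:E = (total F)%:E + (total D)%:E)%E.
  rewrite -!(esum_active_rate1 rho_neq0 c_gt0 measurable_c c_bounded dec).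
  rewrite -esumD => [|r _|r _]; rewrite ?lee_fin//.
  by apply: eq_esum => r _; rewrite rateE.
(* The first-step equation of [F], padded by the marks at sites of [G] outside [F]: these leave [f]
   unchanged and bring the missing rate. *)
pose L (r : mark d) := (if r.1 \in F then \int[law (step F r)]_eta resample r f eta
                        else \int[law F]_eta f eta)%E.
have L0 r : (0 <= L r)%E by rewrite /L; case: ifP.
have -> : ((total G)%:E * \int[law F]_eta f eta =
    \esum_(r in [set: mark d]) ((rate G r)%:E * L r))%E.
  rewrite totalE ge0_muleDl ?lee_fin; last 2 first.
  - exact: (total_rate_ge0 rho_neq0 c_gt0 measurable_c c_bounded).
  - exact: (total_rate_ge0 rho_neq0 c_gt0 measurable_c c_bounded).
  rewrite (law_first_step tf) muleC.
  rewrite -(esum_active_rate1 rho_neq0 c_gt0 measurable_c c_bounded dec).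
  have fin : (\int[law F]_eta f eta = (fine (\int[law F]_eta f eta))%:E)%E.
    rewrite fineK// ge0_fin_numE//; have /andP[_ i1] := probability_integral01 (law F) tf.
    by apply: le_lt_trans i1 _; exact: ltry.
  rewrite fin -ge0_esumZl ?fine_ge0//; last by move=> r; rewrite lee_fin.
  rewrite -fin -esumD; last 2 first.
  - by move=> r _; rewrite mule_ge0// lee_fin.
  - by move=> r _; rewrite mule_ge0// lee_fin.
  apply: eq_esum => r _; rewrite rateE EFinD [RHS]ge0_muleDl ?lee_fin// /L.
  congr (_ + _)%E; first by rewrite /active_rate; case: ifP => // _; rewrite !mul0e.
  rewrite muleC /active_rate in_fsetD; case: ifP => [/andP[/negbTE->]//|_].
  by rewrite !mul0e.
apply: close_esum => // r.
have [rG|rG] := boolP (r.1 \in G); last by left; rewrite /active_rate (negbTE rG).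
right; rewrite /L; case: ifPn => rF.
  by apply: IH; [exact: step_sub|exact: (resample_local dec)].
(* For a padding mark, [F] is kept while [G] moves; [step G r] still contains [F], as at most the
   site of [r] is removed. *)
have -> : (\int[law (step G r)]_eta resample r f eta = \int[law (step G r)]_eta f eta)%E.
  by apply: eq_integral => eta _; rewrite (resample_id dec _ tf).
apply: IH => // j jF; rewrite /step; case: r.2 => [k|]; first by rewrite in_fsetU FG.
by rewrite in_fsetD1 FG// andbT; apply: contraNneq rF => <-.
Qed.

Lemma law_consistent F G f : {subset F <= G} -> local_test F f ->
  (\int[law F]_eta f eta = \int[law G]_eta f eta)%E.
Proof.
move=> FG tf; apply: close_eq => e e0; have [N /(_ N (leqnn N)) sN] := survival_small G e0.
have [a b] := close_law N FG tf.
by split; [apply: le_trans a _|apply: le_trans b _]; rewrite leeD2l.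
Qed.

End law.

(** * Kolmogorov extension *)

Section cylinder_sets.
Context dT (T : measurableType dT) (I : choiceType).
Implicit Types (F G : {fset I}) (B : set (power I T)).

Definition cylinder_set F B := measurable B /\
  forall eta zeta : power I T, {in F, forall j, eta j = zeta j} -> B eta -> B zeta.

End cylinder_sets.

(** * Nested intervals of prescribed lengths *)

Section bernoulli_tree.
Context (R : realType) (p : seq bool -> R).
Hypothesis p_ge0 : forall w, 0 <= p w.
Hypothesis p_nil : p [::] = 1.
Hypothesis p_cons : forall w, p w = p (true :: w) + p (false :: w).

(* The nodes of the binary tree are words listing the digits from the last one to
   the first one; the node [w] is the interval of length [p w] starting at
   [left_end w]. *)
Fixpoint left_end (w : seq bool) : R :=
  if w is b :: w' then left_end w' + (if b then p (false :: w') else 0) else 0.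

Fixpoint digits (n : nat) (u : R) : seq bool :=
  if n is n'.+1 then
    (left_end (digits n' u) + p (false :: digits n' u) <= u) :: digits n' u
  else [::].

Lemma size_digits n u : size (digits n u) = n.
Proof. by elim: n => //= n ->. Qed.

(** The half-open intervals of the two children partition that of their parent, even when one of the
    lengths is 0. *)
Lemma digitsE w u : (0 <= u < 1 /\ digits (size w) u = w) <->
  (left_end w <= u < left_end w + p w).
Proof.
elim: w => [|b w IH] /=; first by rewrite p_nil add0r; split=> [[]|].
split.
  move=> [u01 [bE wE]]; have [+ _] := IH => /(_ (conj u01 wE)) /andP[l1 l2].
  move: bE; rewrite wE; case: b => /= b.
    by rewrite b /= -addrA [p (false :: w) + _]addrC -p_cons.
  by rewrite addr0 l1/= ltNge b.
move=> lw; have lw' : left_end w <= u < left_end w + p w.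
  move: lw; rewrite (p_cons w); have := p_ge0 (true :: w); have := p_ge0 (false :: w).
  by case: b => /=; lra.
have [u01 wE] := IH.2 lw'; split=> //; rewrite wE; congr (_ :: _).
by move: lw; case: b => /=; [move=> /andP[->]|rewrite addr0 => /andP[_]; rewrite ltNge => /negbTE].
Qed.

Lemma measurable_digits n w : measurable [set u : measurableTypeR R | digits n u = w].
Proof.
elim: n w => [|n IH] w.
  have [->|w0] := eqVneq w [::].
    by rewrite (_ : [set _ | _] = setT)//; apply/seteqP; split.
  rewrite (_ : [set _ | _] = set0)//; apply/seteqP; split=> // u /= e.
  by rewrite -e in w0.
case: w => [|b w]; first by rewrite (_ : [set _ | _] = set0)//; apply/seteqP; split.
rewrite (_ : [set _ | _] = [set u : measurableTypeR R | digits n u = w] `&`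
    (if b then `[left_end w + p (false :: w), +oo[%classic else
     `]-oo, left_end w + p (false :: w)[%classic)).
  by apply: measurableI => //; case: b; exact: measurable_itv.
apply/seteqP; split=> u /=.
  move=> [<- <-]; split=> //; case: ifPn => /=; rewrite in_itv/= ?andbT//.
  by rewrite -ltNge.
move=> [<-]; case: b => /=; rewrite in_itv/= ?andbT => h; congr (_ :: _) => //.
by rewrite leNgt h.
Qed.

Let unit_itv : set (measurableTypeR R) := `[0, 1[.
Let mU : measurable unit_itv. Proof. exact: measurable_itv. Qed.

Lemma digits_law : exists L : probability (measurableTypeR R) R,
  forall w, L [set u | digits (size w) u = w] = (p w)%:E.
Proof.
have m1 : mrestr (@lebesgue_measure R) mU setT = 1%E.
  rewrite /mrestr setTI /unit_itv lebesgue_measure_itv/= lte_fin ltr01.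
  by rewrite sube0.
have [L LE] := probability_of_measure m1; exists L => w; rewrite LE /= /mrestr.
rewrite (_ : _ `&` _ = `[left_end w, left_end w + p w[%classic).
  rewrite lebesgue_measure_itv/= lte_fin ltrDl; case: ltP => [_|p0].
    by rewrite -EFinB addrAC subrr add0r.
  by congr EFin; apply/eqP; rewrite eq_le p0 p_ge0.
apply/seteqP; split=> u /=; rewrite !in_itv/=.
  by move=> [wE u01]; apply/digitsE.
by move=> /digitsE[u01 wE].
Qed.

End bernoulli_tree.

(** * Decoding extended reals into spins *)

Section spin_of.
Context (R : realType) (A : borelSet R).

Lemma measurable_spin_val : measurable_fun setT (spin_val (A := A)).
Proof. by move=> _ B mB; exists B. Qed.

(** Defined on the extended reals, since the decoded supremum may be infinite; values outside [A]
    are sent to a default spin. *)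
Definition spin_of (x : \bar R) : spin A :=
  if pselect (bset A (fine x)) is left Ax then exist _ (fine x) (mem_set Ax) else point.

Lemma spin_ofE x : bset A (fine x) -> spin_val (spin_of x) = fine x.
Proof. by rewrite /spin_of; case: pselect. Qed.

Lemma spin_ofN x : ~ bset A (fine x) -> spin_of x = point.
Proof. by rewrite /spin_of; case: pselect. Qed.

Lemma spin_ofK (a : spin A) : spin_of (spin_val a)%:E = a.
Proof. by apply: val_inj; apply: spin_ofE; exact: set_mem (valP a). Qed.

Lemma measurable_spin_of : measurable_fun setT spin_of.
Proof.
move=> _ _ [B mB <-]; rewrite !setTI.
have mf D : measurable D -> measurable [set x : \bar R | D (fine x)].
  by move=> mD; have := @fine_measurable R setT measurableT measurableT D mD; rewrite setTI.
have -> : spin_of @^-1` (spin_val (A := A) @^-1` B) =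
    [set x | (bset A `&` B) (fine x)] `|`
    (if `[< B (spin_val (point : spin A)) >] then [set x | (~` bset A) (fine x)] else set0).
  apply/seteqP; split=> x /=.
    have [Ax|nAx] := pselect (bset A (fine x)); first by rewrite spin_ofE// => Bx; left.
    by rewrite spin_ofN// => Bx; right; rewrite asboolT.
  move=> [[Ax Bx]|]; first by rewrite spin_ofE.
  by case: asboolP => // Bp /= nAx; rewrite spin_ofN.
apply: measurableU; first by apply: mf; apply: measurableI => //; exact: bset_measurable.
by case: ifP => // _; apply: mf; apply: measurableC; exact: bset_measurable.
Qed.

End spin_of.

(* Each real coordinate is coded by the comparisons with the rationals, so that
   the marginals become a consistent family of laws of binary words; these are
   realized by nested intervals of [0, 1[. *)
Section kolmogorov.
Context (R : realType) (A : borelSet R) (I : countType).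
Local Notation S := (power I (spin A)).
Context (nu : {fset I} -> probability S R).
Implicit Types (F G : {fset I}) (B : set S).
Hypothesis nu_consistent : forall F G B, {subset F <= G} -> cylinder_set F B ->
  nu F B = nu G B.

Let code (n : nat) : option (I * rat) := pickle_inv n.

Let bit (n : nat) (eta : S) : bool :=
  if code n is Some (j, q) then spin_val (eta j) < ratr q else false.

Let word (n : nat) (eta : S) : seq bool := rev (mkseq (bit ^~ eta) n).

Let support (n : nat) : {fset I} :=
  [fset x | x in pmap (fun k => omap fst (code k)) (iota 0 n)]%fset.

Let in_support n j : reflect (exists2 k, (k < n)%N & omap fst (code k) = Some j)
  (j \in support n).
Proof.
rewrite in_fset /= mem_pmap; apply: (iffP mapP) => -[k].
  by rewrite mem_iota/= add0n => kn ->; exists k.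
by move=> kn e; exists k; [rewrite mem_iota|rewrite e].
Qed.

Let wordS n eta : word n.+1 eta = bit n eta :: word n eta.
Proof. by rewrite /word mkseqS rev_rcons. Qed.

Let measurable_bit n : measurable_fun setT (bit n).
Proof.
rewrite /bit; case: code => [[j q]|]; last exact: measurable_cst.
apply: measurable_fun_ltr; last exact: measurable_cst.
exact: (measurableT_comp (@measurable_spin_val R A) (@measurable_coord _ _ _ j)).
Qed.

Let measurable_word n (Q : seq bool -> Prop) : measurable [set eta | Q (word n eta)].
Proof.
rewrite (_ : [set _ | _] = \bigcup_w (if `[< Q w >] then [set eta | word n eta = w] else set0)).
  apply: countable_union_measurable => w; case: ifP => // _.
  elim: n w => [|n IH] w.
    have [->|w0] := eqVneq w [::].
      by rewrite (_ : [set _ | _] = setT)//; apply/seteqP; split.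
    rewrite (_ : [set _ | _] = set0)//; apply/seteqP; split=> // eta /= e.
    by rewrite -e in w0.
  case: w => [|b w].
    rewrite (_ : [set _ | _] = set0)//; apply/seteqP; split=> // eta /=.
    by rewrite wordS.
  rewrite (_ : [set _ | _] = [set eta | word n eta = w] `&` bit n @^-1` [set b]).
    apply: measurableI => //; rewrite -[X in measurable X]setTI.
    exact: measurable_bit.
  by apply/seteqP; split=> eta /=; rewrite wordS => -[-> ->].
apply/seteqP; split=> [eta Qe|eta [w _]].
  by exists (word n eta) => //; rewrite asboolT.
by case: asboolP => // Qw /= ->.
Qed.

Let cylinder_word n (Q : seq bool -> Prop) :
  cylinder_set (support n) [set eta | Q (word n eta)].
Proof.
split; first exact: measurable_word.
move=> eta zeta ez /=; suff -> : word n eta = word n zeta by [].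
rewrite /word; congr rev; apply/eq_in_map => k; rewrite mem_iota /= add0n => kn.
rewrite /bit; case E : (code k) => [[j q]|//]; rewrite ez//.
by apply/in_support; exists k; rewrite ?E.
Qed.

Let p (w : seq bool) : R := fine (nu (support (size w)) [set eta | word (size w) eta = w]).

Let pE w : (p w)%:E = nu (support (size w)) [set eta | word (size w) eta = w].
Proof. by rewrite /p fineK// fin_num_measure//; exact: (measurable_word _ (eq^~ w)). Qed.

Let support_sub m n : (m <= n)%N -> {subset support m <= support n}.
Proof.
move=> mn j /in_support[k km kj]; apply/in_support; exists k => //.
exact: leq_trans mn.
Qed.

Let p_ge0 w : 0 <= p w. Proof. by rewrite /p fine_ge0. Qed.

Let p_nil : p [::] = 1.
Proof.
rewrite /p /= (_ : [set _ | _] = setT); last by apply/seteqP; split.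
by rewrite probability_setT.
Qed.

(** The longer words are read from a larger support: consistency allows both sides to be computed
    under the same measure. *)
Let p_cons w : p w = p (true :: w) + p (false :: w).
Proof.
apply: EFin_inj; rewrite EFinD !pE.
rewrite (@nu_consistent _ (support (size w).+1)); last 2 first.
- exact: support_sub.
- exact: (cylinder_word _ (eq^~ w)).
rewrite -measureU; last 3 first.
- exact: (measurable_word _ (eq^~ (true :: w))).
- exact: (measurable_word _ (eq^~ (false :: w))).
- by apply/seteqP; split=> // eta /= [->].
congr (nu _ _); apply/seteqP; split=> eta /=; rewrite !wordS.
  by move=> ->; case: bit; [left|right].
by move=> [[_ ->]|[_ ->]].
Qed.

Let L : probability (measurableTypeR R) R := sval (cid (digits_law p_ge0 p_nil p_cons)).

Let L_digits n (Q : seq bool -> Prop) :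
  L [set u | Q (digits p n u)] = nu (support n) [set eta | Q (word n eta)].
Proof.
pose Lw w := if `[< Q w /\ size w = n >] then [set u : measurableTypeR R | digits p n u = w]
  else set0.
pose Nw w := if `[< Q w /\ size w = n >] then [set eta | word n eta = w] else set0.
have mL w : measurable (Lw w).
  by rewrite /Lw; case: ifP => // _; exact: measurable_digits.
have mN w : measurable (Nw w).
  by rewrite /Nw; case: ifP => // _; exact: (measurable_word _ (eq^~ w)).
have -> : [set u | Q (digits p n u)] = \bigcup_w Lw w.
  apply/seteqP; split=> [u Qu|u [w _]].
    by exists (digits p n u) => //; rewrite /Lw asboolT// size_digits.
  by rewrite /Lw; case: asboolP => // -[Qw _] /= ->.
have -> : [set eta | Q (word n eta)] = \bigcup_w Nw w.
  apply/seteqP; split=> [eta Qe|eta [w _]].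
    by exists (word n eta) => //; rewrite /Nw asboolT// /word size_rev size_mkseq.
  by rewrite /Nw; case: asboolP => // -[Qw _] /= ->.
rewrite !measure_esum//.
- apply: eq_esum => w _; rewrite /Lw /Nw; case: asboolP => [[_ <-]|_]; last by rewrite !measure0.
  by rewrite /L; case: cid => L' /= ->; rewrite pE.
- by move=> w w' _ _ [eta []]; rewrite /Nw; do 2 case: ifP => //; move=> _ _ /= -> ->.
- by move=> w w' _ _ [u []]; rewrite /Lw; do 2 case: ifP => //; move=> _ _ /= -> ->.
Qed.

Let digit n u := head false (digits p n.+1 u).

Let nth_digits n k u : (k < n)%N -> nth false (digits p n u) (n - k.+1) = digit k u.
Proof.
elim: n => // n IH; rewrite ltnS leq_eqVlt => /predU1P[->|kn].
  by rewrite subnn.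
by rewrite subSS -[(n - k)%N]prednK ?subn_gt0// -subnS /= IH.
Qed.

Let nth_word n k eta : (k < n)%N -> nth false (word n eta) (n - k.+1) = bit k eta.
Proof.
move=> kn; rewrite /word nth_rev ?size_mkseq; last by rewrite ltn_subrL (leq_ltn_trans _ kn).
by rewrite subnSK ?leq_subr// subKn// ?nth_mkseq// ltnW.
Qed.

(* The value at [j] is the supremum of the rationals below it; on a null set the
   digits need not come from a configuration, and [xi j u] may be infinite or
   outside [A]. *)
Let xi (j : I) (u : measurableTypeR R) : \bar R :=
  ereal_sup [set (ratr q)%:E | q in [set q | digit (choice.pickle (j, q)) u = false]].

Let xi_gt j (x : R) u : (x%:E < xi j u)%E <->
  exists q : rat, x < ratr q /\ digit (choice.pickle (j, q)) u = false.
Proof.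
split=> [/ereal_sup_gt[_ [q qd <-]]|[q [xq qd]]].
  by rewrite lte_fin => xq; exists q.
by apply: (@lt_le_trans _ _ (ratr q)%:E); rewrite ?lte_fin//; apply: ereal_sup_ubound; exists q.
Qed.

(** The same formula as for [xi], with the bits of an actual configuration in place of the digits,
    by density of the rationals. *)
Let spin_gt j (x : R) (eta : S) : x < spin_val (eta j) <->
  exists q : rat, x < ratr q /\ bit (choice.pickle (j, q)) eta = false.
Proof.
rewrite /bit /code; split=> [xe|[q [xq]]].
  have [q /[!in_itv]/= /andP[xq qe]] := rat_in_itvoo xe.
  by exists q; rewrite pickleK_inv; split=> //; apply/negbTE; rewrite -leNgt ltW.
by rewrite pickleK_inv => /negbT; rewrite -leNgt; exact: lt_le_trans.
Qed.

Let measurable_xi j : measurable_fun setT (xi j).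
Proof.
apply: (measurability _ (ErealGenOInfty.measurableE R)) => _ [_ [x ->] <-].
rewrite setTI (_ : _ @^-1` _ = \bigcup_(q : rat) (if x < ratr q then
    [set u | digit (choice.pickle (j, q)) u = false] else set0)).
  apply: countable_union_measurable => q; case: ifP => // _; rewrite /digit.
  set n := choice.pickle _; rewrite (_ : [set _ | _] = \bigcup_w
    (if head false w == false then [set u : measurableTypeR R | digits p n.+1 u = w] else set0)).
    by apply: countable_union_measurable => w; case: ifP => // _; exact: measurable_digits.
  apply/seteqP; split=> [u ud|u [w _]].
    have hd : head false (digits p n.+1 u) = false := ud.
    by exists (digits p n.+1 u); [|rewrite hd eqxx].
  case: ifP => // /eqP wd uw; have {}uw : digits p n.+1 u = w := uw.
  have : head false (digits p n.+1 u) = false by rewrite uw.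
  by [].
apply/seteqP; split=> u /=; rewrite in_itv /= andbT.
  by move=> /xi_gt[q [xq qd]]; exists q => //; rewrite xq.
move=> [q _]; case: ifP => // xq qd; apply/xi_gt; by exists q.
Qed.

Let some_bit N (e : nat -> bool) (s : seq (I * R)) : Prop := forall jx, List.In jx s ->
  exists q : rat,
    [/\ (choice.pickle (jx.1, q) < N)%N, jx.2 < ratr q & e (choice.pickle (jx.1, q)) = false].

Let some_bit_word N s w := some_bit N (fun k => nth false w (N - k.+1)) s.

Let some_bitW m n e s : (m <= n)%N -> some_bit m e s -> some_bit n e s.
Proof. by move=> mn se jx /se[q [qm ? ?]]; exists q; split=> //; exact: leq_trans mn. Qed.

Let some_bit_exists (e : nat -> bool) s :
  (forall jx, List.In jx s ->
    exists q : rat, jx.2 < ratr q /\ e (choice.pickle (jx.1, q)) = false) ->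
  exists N, some_bit N e s.
Proof.
elim: s => [_|jx s IH es]; first by exists 0%N.
have [N NE] : exists N, some_bit N e s by apply: IH => ? ?; apply: es; right.
have [q [xq qe]] := es jx (or_introl erefl).
exists (maxn N (choice.pickle (jx.1, q)).+1) => jx' [<-|js].
  by exists q; split=> //; rewrite leq_max ltnSn orbT.
exact: (some_bitW (leq_maxl _ _) NE).
Qed.

Let some_bit_wordE N s (w : seq bool) (e : nat -> bool) :
  (forall k, (k < N)%N -> nth false w (N - k.+1) = e k) ->
  some_bit_word N s w <-> some_bit N e s.
Proof.
by move=> we; split=> es jx /es[q [qN xq qe]]; exists q; split=> //; move: qe; rewrite we.
Qed.

(* Both events are increasing unions of events depending on finitely many digits. *)
Let half_space_law F (s : seq (I * R)) :
  (forall jx, List.In jx s -> jx.1 \in F) ->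
  L [set u | forall jx, List.In jx s -> (jx.2%:E < xi jx.1 u)%E] =
  nu F [set eta | forall jx, List.In jx s -> jx.2 < spin_val (eta jx.1)].
Proof.
move=> sF.
pose U N := [set u : measurableTypeR R | some_bit_word N s (digits p N u)].
pose V N := [set eta : S | some_bit_word N s (word N eta)].
have UE N u : U N u <-> some_bit N (digit^~ u) s.
  by apply: some_bit_wordE => k kN; rewrite nth_digits.
have VE N eta : V N eta <-> some_bit N (bit^~ eta) s.
  by apply: some_bit_wordE => k kN; rewrite nth_word.
have mV N : measurable (V N) by exact: measurable_word.
have mU N : measurable (U N).
  rewrite (_ : U N = \bigcup_w (if `[< some_bit_word N s w >] then
      [set u : measurableTypeR R | digits p N u = w] else set0)).
    by apply: countable_union_measurable => w; case: ifP => // _; exact: measurable_digits.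
  apply/seteqP; split=> [u Uu|u [w _]].
    by exists (digits p N u) => //; rewrite asboolT.
  by case: asboolP => // ww /= uw; rewrite /U /= uw.
have -> : [set u | forall jx, List.In jx s -> (jx.2%:E < xi jx.1 u)%E] = \bigcup_N U N.
  apply/seteqP; split=> [u su|u [N _ /UE Uu] jx js].
    have [N NE] : exists N, some_bit N (digit^~ u) s.
      by apply: some_bit_exists => jx /su /xi_gt.
    by exists N => //; apply/UE.
  by have [q [_ xq qd]] := Uu jx js; apply/xi_gt; exists q.
have -> : [set eta | forall jx, List.In jx s -> jx.2 < spin_val (eta jx.1)] = \bigcup_N V N.
  apply/seteqP; split=> [eta su|eta [N _ /VE Vu] jx js].
    have [N NE] : exists N, some_bit N (bit^~ eta) s.
      by apply: some_bit_exists => jx /su /spin_gt.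
    by exists N => //; apply/VE.
  by have [q [_ xq qd]] := Vu jx js; apply/spin_gt; exists q.
have LU : L (U N) @[N --> \oo] --> L (\bigcup_N U N).
  apply: nondecreasing_cvg_mu => //; first exact: bigcupT_measurable.
  move=> m n mn; apply/subsetPset => u /UE Um; apply/UE; exact: some_bitW mn Um.
have NV : nu F (V N) @[N --> \oo] --> nu F (\bigcup_N V N).
  apply: nondecreasing_cvg_mu => //; first exact: bigcupT_measurable.
  move=> m n mn; apply/subsetPset => eta /VE Vm; apply/VE; exact: some_bitW mn Vm.
have UV N : L (U N) = nu F (V N).
  (* The event [V N] is determined both by [support N], being read from a word, and by [F], since
     only bits of sites listed in [s] matter. The two marginals are compared through the union. *)
  rewrite L_digits; pose G := (F `|` support N)%fset.
  rewrite (@nu_consistent _ G); last 2 first.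
  - by move=> j js; rewrite in_fsetU js orbT.
  - exact: cylinder_word.
  rewrite -(@nu_consistent F G)//; first by move=> j jF; rewrite in_fsetU jF.
  split=> // eta zeta ez /VE Vn; apply/VE => jx js; have [q [qN xq qe]] := Vn jx js.
  exists q; split=> //; move: qe; rewrite /bit /code pickleK_inv.
  by rewrite ez//; exact: sF.
move: LU; under eq_fun do rewrite UV.
move=> LU; exact: (cvg_unique _ LU NV).
Qed.

Let gt_sets : set (set (\bar R)) := @ErealGenOInfty.G R.

(** Two laws on a finite power of the extended reals that agree on boxes of upper half-lines, which
    generate the sigma-field. *)
Let law_xi F (D : set (power F (\bar R))) : measurable D ->
  L [set u | D (fun j : F => xi (val j) u)] =
  nu F [set eta | D (fun j : F => (spin_val (eta (val j)))%:E)].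
Proof.
move=> mD.
have mx : measurable_fun setT (fun u => (fun j : F => xi (val j) u) : power F (\bar R)).
  by apply: measurable_power => j; exact: measurable_xi.
have me : measurable_fun setT
    (fun eta : S => (fun j : F => (spin_val (eta (val j)))%:E) : power F (\bar R)).
  apply: measurable_power => j; apply/measurable_EFinP.
  exact: (measurableT_comp (@measurable_spin_val R A) (@measurable_coord _ _ _ (val j))).
have [Q1 [Q1E _]] := pushforward_probability L mx.
have [Q2 [Q2E _]] := pushforward_probability (nu F) me.
suff : Q1 D = Q2 D by rewrite Q1E Q2E.
apply: (@power_measure_unique _ _ F R gt_sets) => //.
- exact: ErealGenOInfty.measurableE.
- by rewrite [ltLHS](@probability_setT _ _ _ Q1) ltry.
move=> s sG; apply: etrans (Q1E _) _; apply: etrans _ (esym (Q2E _)).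
(* The box is rewritten as a list of strict lower bounds, uniformly in [x] so as to serve both [xi]
   and actual configurations. *)
have [t tE] : exists t : seq (I * R), (forall jx, List.In jx t -> jx.1 \in F) /\
    (forall x : I -> \bar R, box s (fun j : F => x (val j)) <->
      forall jx, List.In jx t -> (jx.2%:E < x jx.1)%E).
  elim: s sG => [_|[j B] s IH sG]; first by exists [::]; split=> [? []|x]; split=> _ ? [].
  have [t [tF tE]] : exists t : seq (I * R), (forall jx, List.In jx t -> jx.1 \in F) /\
    (forall x : I -> \bar R, box s (fun j : F => x (val j)) <->
      forall jx, List.In jx t -> (jx.2%:E < x jx.1)%E).
    by apply: IH => q qs; apply: sG; right.
  have [y Bx] := sG (j, B) (or_introl erefl).
  exists ((val j, y) :: t); split=> [jx [<-|/tF//]|x]; first exact: valP.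
  split=> [bx jx [<-|jt]|tx q [<-|qs]].
  - by have /= := bx (j, B) (or_introl erefl); rewrite [B]Bx /= in_itv/= andbT.
  - by move: jt; apply: (tE x).1 => q qs; apply: bx; right.
  - by rewrite /= [B]Bx /= in_itv/= andbT; apply: (tx (val j, y)); left.
  - by apply: (tE x).2 qs => jx jt; apply: tx; right.
have [tF tx] := tE.
have -> : (fun u => (fun j : F => xi (val j) u) : power F (\bar R)) @^-1` box s =
    [set u | forall jx, List.In jx t -> (jx.2%:E < xi jx.1 u)%E].
  by apply/seteqP; split=> u /= h; apply: (tx (xi^~ u)).1 || apply: (tx (xi^~ u)).2.
rewrite (half_space_law tF); congr (nu F _); apply/seteqP; split=> eta /= h.
  apply: (tx (fun j => (spin_val (eta j))%:E)).2 => jx jt.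
  by rewrite lte_fin; exact: h.
move=> jx jt; rewrite -lte_fin.
exact: ((tx (fun j => (spin_val (eta j))%:E)).1 h).
Qed.

(** Decoding turns [D] into an event on extended reals, which [law_xi] transfers to [nu F]. There
    the coordinates come from actual spins, which decoding recovers; thus the default spin of bad
    digit sequences does not affect the marginals. *)
Theorem kolmogorov : exists m : probability S R, forall F (D : set (power F (spin A))),
  measurable D -> m (restr F @^-1` D) = nu F (restr F @^-1` D).
Proof.
have mx : measurable_fun setT (fun u => (fun j => spin_of A (xi j u)) : S).
  apply: measurable_power => j.
  exact: (measurableT_comp (@measurable_spin_of R A) (@measurable_xi j)).
have [m [mE _]] := pushforward_probability L mx; exists m => F D mD; rewrite mE.
pose D' := (fun x : power F (\bar R) => (fun j => spin_of A (x j)) : power F (spin A)) @^-1` D.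
have mD' : measurable D'.
  rewrite -[D']setTI; suff : measurable_fun setT
    (fun x : power F (\bar R) => (fun j => spin_of A (x j)) : power F (spin A)) by apply.
  apply: measurable_power => j.
  exact: (measurableT_comp (@measurable_spin_of R A) (@measurable_coord _ _ _ j)).
rewrite -[LHS]/(L [set u | D' (fun j : F => xi (val j) u)]) law_xi//.
have DE eta : (fun j : F => spin_of A (spin_val (eta (val j)))%:E) = restr F eta.
  by apply/funext => j; exact: spin_ofK.
by congr (nu F _); apply/seteqP; split=> eta; rewrite /D' /preimage /= DE.
Qed.

End kolmogorov.

(** * Approximation by continuous cylinder functions *)

Section approximation.
Context (R : realType) (d : nat) (A : borelSet R).
Local Notation S := (power (site d) (spin A)).
Implicit Types (F : {fset site d}) (B C : set S) (g : S -> R).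

(* The generator is only known on continuous functions. *)
Definition continuous_test F g :=
  [/\ continuous g, measurable_fun setT g, (forall eta, 0 <= g eta <= 1) &
      forall eta zeta, {in F, forall j, eta j = zeta j} -> g eta = g zeta].

Section approximable.
Context (m : {measure set S -> \bar R}) (F : {fset site d}).
Hypothesis m_finite : fin_num_fun m.

(** The sets whose indicator lies in the L1 closure of the continuous tests. They form a
    sigma-algebra containing the coordinate half-lines, hence all measurable cylinders over [F]. *)
Definition approximable B := measurable B /\ forall e : R, 0 < e ->
  exists2 g, continuous_test F g &
    (\int[m]_eta (`|\1_B eta - g eta|)%:E <= e%:E)%E.

Let integral_le2 (u v w : S -> R) (a b e : R) :
  measurable_fun setT u -> measurable_fun setT v -> measurable_fun setT w ->
  (forall eta, 0 <= u eta) -> (forall eta, 0 <= v eta) -> (forall eta, 0 <= w eta) ->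
  (forall eta, u eta <= v eta + w eta) ->
  (\int[m]_eta (v eta)%:E <= a%:E)%E -> (\int[m]_eta (w eta)%:E <= b%:E)%E ->
  a + b <= e -> (\int[m]_eta (u eta)%:E <= e%:E)%E.
Proof.
move=> mu mv mw u0 v0 w0 uvw va wb abe.
apply: (@le_trans _ _ (\int[m]_eta ((v eta)%:E + (w eta)%:E))%E).
  by apply: ge0_integral_mono => eta; rewrite -EFinD !lee_fin u0 uvw.
rewrite ge0_integralD//; last 4 first.
- by move=> eta _; rewrite lee_fin.
- exact/measurable_EFinP.
- by move=> eta _; rewrite lee_fin.
- exact/measurable_EFinP.
by apply: le_trans (leeD va wb) _; rewrite -EFinD lee_fin.
Qed.

Let measurable_abs_diff B g : measurable B -> measurable_fun setT g ->
  measurable_fun setT (fun eta => `|\1_B eta - g eta|).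
Proof.
move=> mB mg; apply: measurableT_comp => //.
by apply: measurable_funB => //; exact: measurable_indic.
Qed.

Lemma approximable0 : approximable set0.
Proof.
split=> // e e0; exists (cst 0).
  split.
  - exact: cst_continuous.
  - exact: measurable_cst.
  - by move=> eta; rewrite /= lexx ler01.
  - by [].
rewrite integral0_eq ?lee_fin ?ltW// => eta _.
by rewrite indic0 subrr normr0.
Qed.

Lemma approximableC B : approximable B -> approximable (~` B).
Proof.
move=> [mB aB]; split; first exact: measurableC.
move=> e /aB[g [cg mg g01 Fg] gB]; exists (fun eta => 1 - g eta).
  split.
  - by move=> eta; apply: continuousB; [exact: cst_continuous|exact: cg].
  - by apply: measurable_funB.
  - by move=> eta; have := g01 eta; lra.
  - by move=> eta zeta ez; rewrite (Fg _ _ ez).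
rewrite (eq_integral (fun eta => (`|\1_B eta - g eta|)%:E))// => eta _.
congr EFin; rewrite -normrN; congr `|_|; rewrite !indicE in_setC.
by case: (eta \in B) => /=; ring.
Qed.

Lemma approximableI B C : approximable B -> approximable C -> approximable (B `&` C).
Proof.
move=> [mB aB] [mC aC]; split; first exact: measurableI.
move=> e e0; have e2 : 0 < e / 2 by rewrite divr_gt0.
have [g [cg mg g01 Fg] gB] := aB _ e2; have [h [ch mh h01 Fh] hC] := aC _ e2.
exists (fun eta => g eta * h eta).
  split.
  - by move=> eta; apply: continuousM; [exact: cg|exact: ch].
  - exact: measurable_funM.
  - move=> eta; have /andP[g0 g1] := g01 eta; have /andP[h0 h1] := h01 eta.
    by rewrite mulr_ge0//= mulr_ile1.
  - by move=> eta zeta ez; rewrite (Fg _ _ ez) (Fh _ _ ez).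
apply: (integral_le2 _ _ _ _ _ _ _ gB hC) => //.
- by apply: measurable_abs_diff; [exact: measurableI|exact: measurable_funM].
- exact: measurable_abs_diff.
- exact: measurable_abs_diff.
- move=> eta; have /andP[g0 g1] := g01 eta; have /andP[h0 h1] := h01 eta.
  rewrite !indicE in_setI.
  have gn : `|g eta| <= 1 by rewrite ger0_norm.
  case: (eta \in B); case: (eta \in C) => /=.
  + have -> : 1 - g eta * h eta = (1 - g eta) + g eta * (1 - h eta) by ring.
    apply: le_trans (ler_normD _ _) _; rewrite lerD2l normrM.
    by rewrite ler_piMl.
  + rewrite !sub0r !normrN normrM (ger0_norm h0).
    by apply: (@le_trans _ _ (h eta)); [rewrite ler_piMl|rewrite lerDr].
  + rewrite !sub0r !normrN normrM (ger0_norm g0).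
    by apply: (@le_trans _ _ (g eta)); [rewrite ler_piMr// ger0_norm|rewrite lerDl].
  + rewrite !sub0r !normrN normrM (ger0_norm g0).
    by apply: (@le_trans _ _ (g eta)); [rewrite ler_piMr// ger0_norm|rewrite lerDl].
- by rewrite -splitr.
Qed.

Lemma approximableU B C : approximable B -> approximable C -> approximable (B `|` C).
Proof.
move=> aB aC; rewrite -[_ `|` _]setCK setCU.
by apply: approximableC; apply: approximableI; exact: approximableC.
Qed.

Lemma approximable_bigcup (B : (set S)^nat) : (forall n, approximable (B n)) ->
  approximable (\bigcup_n B n).
Proof.
move=> aB; have mB n : measurable (B n) := (aB n).1.
have mU : measurable (\bigcup_n B n) by exact: bigcupT_measurable.
split=> // e e0; have e2 : 0 < e / 2 by rewrite divr_gt0.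
(* Half of [e] pays for the tail of the union beyond [U N], the other half for the approximation of
   [U N]. *)
pose U N := \big[setU/set0]_(k < N) B k.
have aU N : approximable (U N).
  rewrite /U; elim: N => [|N IH]; first by rewrite big_ord0; exact: approximable0.
  by rewrite big_ord_recr; exact: approximableU.
pose D N := \bigcup_n B n `\` U N.
have mD N : measurable (D N) by apply: measurableD => //; exact: (aU N).1.
have D0 : \bigcap_N D N = set0.
  apply/seteqP; split=> // eta De; have [[n _ Bn] _] := De 0%N Logic.I.
  have [_] := De n.+1 Logic.I; apply.
  by rewrite /U big_ord_recr; right.
have : (m \o D) N @[N --> \oo] --> m (\bigcap_N D N).
  apply: nonincreasing_cvg_mu => //.
  - by rewrite ltey_eq m_finite.
  - by rewrite D0.
  - move=> N N' NN; apply/subsetPset => eta [Be nU]; split=> // UN; apply: nU.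
    exact: (subset_bigsetU NN).
rewrite D0 measure0 => /fine_cvgP[_] /cvgrPdist_le/(_ _ e2)[N _ /(_ N (leqnn N))].
rewrite sub0r normrN ger0_norm ?fine_ge0// => mDN.
have [g tg gU] := (aU N).2 _ e2; exists g => //; have [cg mg g01 Fg] := tg.
apply: (@integral_le2 _ (fun eta => \1_(D N) eta) (fun eta => `|\1_(U N) eta - g eta|)
  (e / 2) (e / 2)) => //.
- exact: measurable_abs_diff.
- exact: measurable_indic.
- by apply: measurable_abs_diff => //; exact: (aU N).1.
- move=> eta; rewrite !indicE /D in_setD.
  have UB : eta \in U N -> eta \in \bigcup_n B n.
    by move=> /set_mem; rewrite /U -bigcup_mkord => -[n _ Bn]; apply/mem_set; exists n.
  case: (boolP (eta \in \bigcup_n B n)) => [_|/negP nB] /=.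
    case: (eta \in U N) => /=; first by rewrite add0r.
    have /andP[g0 g1] := g01 eta.
    by rewrite sub0r normrN (ger0_norm g0) ger0_norm ?subr_ge0//; lra.
  have /negbTE -> : eta \notin U N by apply/negP => /UB.
  by rewrite lerDr.
- by rewrite integral_indic// setIT -(fineK (m_finite (mD N))) lee_fin.
- by rewrite -splitr.
Qed.

Lemma sigma_algebra_approximable (Y : Type) (f : S -> Y) :
  sigma_algebra setT [set D | approximable (f @^-1` D)].
Proof.
split=> /=.
- by rewrite preimage_set0; exact: approximable0.
- by move=> D; rewrite setTD preimage_setC; exact: approximableC.
- by move=> D aD; rewrite preimage_bigcup; exact: approximable_bigcup.
Qed.

Let spin_at (j : site d) (eta : S) : R := spin_val (eta j).

Let measurable_spin_at j : measurable_fun setT (spin_at j).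
Proof.
exact: (measurableT_comp (@measurable_spin_val R A) (@measurable_coord _ _ _ j)).
Qed.

Let continuous_spin_at j : continuous (spin_at j).
Proof.
move=> eta; apply: (@continuous_comp _ _ _ (fun zeta : S => zeta j) (@spin_val R A)).
  exact: (@proj_continuous _ (fun=> spin A) j).
exact: (@initial_continuous _ _ (@spin_val R A)).
Qed.

Let ramp (q : R) (k : nat) (x : R) : R := Num.min 1 (Num.max 0 (k%:R * (x - q))).

Let continuous_ramp q k : continuous (ramp q k).
Proof.
apply: (@min_fun_continuous _ R R (cst 1)); first exact: cst_continuous.
apply: (@max_fun_continuous _ R R (cst 0)); first exact: cst_continuous.
by move=> x; apply: cvgMl_tmp; apply: cvgB; [exact: cvg_id|exact: cvg_cst].
Qed.

Let ramp_test j q k : j \in F -> continuous_test F (fun eta => ramp q k (spin_at j eta)).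
Proof.
move=> jF; split.
- move=> eta; apply: (@continuous_comp _ _ _ (spin_at j) (ramp q k)).
    exact: continuous_spin_at.
  exact: continuous_ramp.
- apply: measurable_minr; first exact: measurable_cst.
  apply: measurable_maxr; first exact: measurable_cst.
  apply: measurable_funM; first exact: measurable_cst.
  by apply: measurable_funB; [exact: measurable_spin_at|exact: measurable_cst].
- by move=> eta; rewrite /ramp le_min ler01 le_max lexx/= ge_min lexx.
- by move=> eta zeta ez; rewrite /spin_at ez.
Qed.

Lemma approximable_gt j (q : R) : j \in F -> approximable [set eta | q < spin_at j eta].
Proof.
move=> jF; have mG : measurable [set eta | q < spin_at j eta].
  rewrite (_ : [set _ | _] = spin_at j @^-1` `]q, +oo[%classic).
    by rewrite -[X in measurable X]setTI; apply: measurable_spin_at => //; exact: measurable_itv.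
  by apply/seteqP; split=> eta /=; rewrite in_itv/= andbT.
split=> // e e0.
(* The ramp of slope [k.+1] differs from the indicator on this strip only, and the strips decrease
   to the empty set. *)
pose D (k : nat) := [set eta | q < spin_at j eta < q + k.+1%:R^-1].
have mD k : measurable (D k).
  rewrite (_ : D k = spin_at j @^-1` `]q, q + k.+1%:R^-1[%classic).
    by rewrite -[X in measurable X]setTI; apply: measurable_spin_at => //; exact: measurable_itv.
  by apply/seteqP; split=> eta /=; rewrite in_itv.
have D0 : \bigcap_k D k = set0.
  apply/seteqP; split=> // eta De.
  have /andP[q0 _] := De 0%N Logic.I.
  have e1 : 0 < spin_at j eta - q by rewrite subr_gt0.
  (* An index [k] for which [1 / (k + 1)] is below the distance to [q], so that the point has left
     the strip. *)
  have /andP[_] := De (Num.truncn (spin_at j eta - q)^-1) Logic.I.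
  rewrite -ltrBlDl => h.
  have := truncnS_gt (spin_at j eta - q)^-1.
  by rewrite invf_plt ?posrE// => /(lt_trans h); rewrite ltxx.
have : (m \o D) k @[k --> \oo] --> m (\bigcap_k D k).
  apply: nonincreasing_cvg_mu => //.
  - by rewrite ltey_eq m_finite.
  - by rewrite D0.
  - move=> k k' kk; apply/subsetPset => eta /andP[qe ek]; apply/andP; split=> //.
    apply: lt_le_trans ek _; rewrite lerD2l lef_pV2 ?posrE//.
    by rewrite ler_nat.
rewrite D0 measure0 => /fine_cvgP[_] /cvgrPdist_le/(_ _ e0)[k _ /(_ k (leqnn k))].
rewrite sub0r normrN ger0_norm ?fine_ge0// => mDk.
have tg := ramp_test q k.+1 jF; exists (fun eta => ramp q k.+1 (spin_at j eta)) => //.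
apply: (@le_trans _ _ (\int[m]_eta (\1_(D k) eta)%:E)%E); last first.
  by rewrite integral_indic// setIT -(fineK (m_finite (mD k))) lee_fin.
apply: ge0_integral_mono => eta; rewrite !lee_fin normr_ge0/=.
rewrite !indicE /ramp; set x := spin_at j eta.
have k0 : 0 < k.+1%:R :> R by [].
have memE B (b : bool) : (eta \in B) = b -> (\1_B eta : R) = b%:R by rewrite indicE => ->.
have -> : (eta \in [set eta | q < spin_at j eta]) = (q < x).
  by apply/idP/idP => [/set_mem|?] //; exact/mem_set.
have -> : (eta \in D k) = (q < x < q + k.+1%:R^-1).
  by apply/idP/idP => [/set_mem|?] //; exact/mem_set.
have [xq|qx] := leP x q.
  rewrite max_l ?min_r ?subrr ?normr0//.
  by rewrite pmulr_rle0// subr_le0.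
rewrite /= max_r; last by rewrite mulr_ge0// subr_ge0 ltW.
have [xk|kx] := ltP x (q + k.+1%:R^-1).
  have : k.+1%:R * (x - q) < 1.
    by rewrite -(@ltr_pM2l _ k.+1%:R^-1) ?invr_gt0// mulrA mulVf ?mul1r ?mulr1 ?gt_eqF// ltrBlDl.
  have : 0 <= k.+1%:R * (x - q) by rewrite mulr_ge0// subr_ge0 ltW.
  move=> a0 /ltW a1; rewrite (min_r a1) ger0_norm ?subr_ge0//.
  by rewrite lerBlDr lerDl.
rewrite min_l ?subrr ?normr0//.
by rewrite -(@ler_pM2l _ k.+1%:R^-1) ?invr_gt0// mulrA mulVf ?mul1r ?mulr1 ?gt_eqF// lerBrDl.
Qed.

Lemma approximable_restr (D : set (power F (spin A))) : measurable D ->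
  approximable (restr F @^-1` D).
Proof.
move=> mD; apply: (smallest_sub (sigma_algebra_approximable (restr F)) _ mD).
move=> _ [j _ [_ [B mB <-] <-]]; rewrite setTI !setTI.
rewrite /=; change (approximable (spin_at (val j) @^-1` B)).
have mB' : (@RGenOInfty.G R).-sigma.-measurable B by rewrite -RGenOInfty.measurableE.
apply: (smallest_sub (sigma_algebra_approximable (spin_at (val j))) _ mB').
move=> _ [q ->] /=; rewrite (_ : _ @^-1` _ = [set eta | q < spin_at (val j) eta]).
  exact: approximable_gt (valP j).
by apply/seteqP; split=> eta /=; rewrite in_itv/= andbT.
Qed.

End approximable.

(** Extension by a default spin is a measurable section of [restr F]; the base of the cylinder is
    the preimage under it. *)
Lemma cylinder_set_restrP F B : cylinder_set F B ->
  exists2 D : set (power F (spin A)), measurable D & B = restr F @^-1` D.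
Proof.
move=> [mB FB].
pose ext (w : power F (spin A)) : S := fun j =>
  if insub j : option F is Some j' then w j' else point.
have mext : measurable_fun setT ext.
  apply: measurable_power => j; rewrite /ext; case: insub => [j'|].
    exact: measurable_coord.
  exact: measurable_cst.
exists (ext @^-1` B); first by rewrite -[X in measurable X]setTI; exact: mext.
have extE eta : {in F, forall j, ext (restr F eta) j = eta j}.
  by move=> j jF; rewrite /ext insubT.
by apply/seteqP; split=> eta /=; apply: FB => j jF; rewrite extE.
Qed.

(** * From continuous tests to measurable ones, with the same error *)

Section domination.
Context (m1 m2 : probability S R) (F : {fset site d}) (s : R).
Hypothesis s_ge0 : 0 <= s.

Lemma cylinder_domination : (forall g, continuous_test F g ->
    (\int[m1]_eta (g eta)%:E <= \int[m2]_eta (g eta)%:E + s%:E)%E) ->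
  forall B, cylinder_set F B -> (m1 B <= m2 B + s%:E)%E.
Proof.
move=> m12 B /cylinder_set_restrP[D mD BE].
apply/lee_addgt0Pr => e e0; have e2 : 0 < e / 2 by rewrite divr_gt0.
(* Approximation for the sum provides a single [g] close to the indicator under both measures. *)
pose m := measure_add m1 m2.
have mfin : fin_num_fun m.
  by move=> C mC; rewrite /m measure_addE fin_numD !fin_num_measure.
have [mB /(_ _ e2)[g tg gB]] := approximable_restr mfin mD.
rewrite -BE in mB gB; have [cg mg g01 Fg] := tg.
have mdiff : measurable_fun setT (fun eta => (`|\1_B eta - g eta|)%:E).
  apply/measurable_EFinP; apply: measurableT_comp => //.
  by apply: measurable_funB => //; exact: measurable_indic.
have d0 eta : (0 <= (`|\1_B eta - g eta|)%:E)%E by rewrite lee_fin.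
have gB' : (\int[m1]_eta (`|\1_B eta - g eta|)%:E +
    \int[m2]_eta (`|\1_B eta - g eta|)%:E <= (e / 2)%:E)%E.
  by rewrite -ge0_integral_measure_add.
have [gB1 gB2] : (\int[m1]_eta (`|\1_B eta - g eta|)%:E <= (e / 2)%:E)%E /\
    (\int[m2]_eta (`|\1_B eta - g eta|)%:E <= (e / 2)%:E)%E.
  split; apply: le_trans gB'; [rewrite leeDl//|rewrite leeDr//];
  exact: integral_ge0.
have mgE : measurable_fun setT (fun eta => (g eta)%:E) by exact/measurable_EFinP.
have mBE : measurable_fun setT (fun eta => (\1_B eta : R)%:E).
  by apply/measurable_EFinP; exact: measurable_indic.
have g0 eta : (0 <= (g eta)%:E)%E by rewrite lee_fin; have /andP[] := g01 eta.
have B1 (mu : probability S R) : (mu B <= \int[mu]_eta (g eta)%:E +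
    \int[mu]_eta (`|\1_B eta - g eta|)%:E)%E.
  rewrite -ge0_integralD//.
  rewrite -[leLHS](_ : \int[mu]_eta (\1_B eta)%:E = _)%E; last by rewrite integral_indic// setIT.
  apply: ge0_integral_mono => eta; rewrite -EFinD !lee_fin -lerBlDl ler_norm andbT.
  by rewrite indicE; case: (_ \in _).
have B2 (mu : probability S R) : (\int[mu]_eta (g eta)%:E <= mu B +
    \int[mu]_eta (`|\1_B eta - g eta|)%:E)%E.
  rewrite -[X in (X + _)%E](_ : \int[mu]_eta (\1_B eta)%:E = _)%E; last first.
    by rewrite integral_indic// setIT.
  rewrite -ge0_integralD//.
  apply: ge0_integral_mono => eta; rewrite -EFinD g0/= lee_fin -lerBlDl distrC.
  exact: ler_norm.
apply: le_trans (B1 m1) _.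
have := leeD (le_trans (m12 _ tg) (leeD (le_trans (B2 m2) (leeD2l _ gB2)) (lexx s%:E))) gB1.
move/le_trans; apply.
rewrite -!addeA leeD2l// -!EFinD lee_fin; lra.
Qed.

(** Approximating [f] by a mean [h] of [N] indicators keeps the error equal to [s]: each indicator
    contributes [s / N]. The mesh [1 / N] of the levels is below [e]. *)
Lemma local_domination : (forall B, cylinder_set F B -> (m1 B <= m2 B + s%:E)%E) ->
  forall f : S -> \bar R, local_test F f ->
  (\int[m1]_eta f eta <= \int[m2]_eta f eta + s%:E)%E.
Proof.
move=> m12 f [mf f01 Ff].
have f0 eta : (0 <= f eta)%E by have /andP[] := f01 eta.
have ff eta : f eta = (fine (f eta))%:E.
  rewrite fineK// ge0_fin_numE//; have /andP[_ f1] := f01 eta.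
  by apply: le_lt_trans f1 _; exact: ltry.
apply/lee_addgt0Pr => e e0.
pose N := (Num.truncn e^-1).+1.
have N0 : 0 < N%:R :> R by [].
have Ne : N%:R^-1 < e by rewrite -[ltRHS]invrK ltf_pV2 ?posrE ?invr_gt0//; exact: truncnS_gt.
pose B (k : 'I_N) : set S := [set eta | k.+1%:R / N%:R <= fine (f eta)].
have mff : measurable_fun setT (fun eta => fine (f eta)).
  exact: measurableT_comp mf.
have cB k : cylinder_set F (B k).
  split; last by move=> eta zeta ez; rewrite /B /= (Ff _ _ ez).
  rewrite (_ : B k = (fun eta => fine (f eta)) @^-1` `[k.+1%:R / N%:R, +oo[%classic).
    by rewrite -[X in measurable X]setTI; apply: mff => //; exact: measurable_itv.
  by apply/seteqP; split=> eta /=; rewrite in_itv/= andbT.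
have mB k : measurable (B k) := (cB k).1.
(* layer cake approximation of [f] from below *)
pose h eta : R := N%:R^-1 * \sum_(k < N) \1_(B k) eta.
have hf eta : h eta <= fine (f eta) <= h eta + N%:R^-1.
  pose x := N%:R * fine (f eta); pose n := Num.truncn x.
  have fx0 : 0 <= fine (f eta) by exact: fine_ge0.
  have x0 : 0 <= x by rewrite mulr_ge0.
  have fx1 : fine (f eta) <= 1 by rewrite -lee_fin -ff; have /andP[] := f01 eta.
  have nN : (n <= N)%N.
    rewrite -(@ler_nat R); apply: (@le_trans _ _ x); first by rewrite truncn_le.
    by rewrite /x ler_piMr.
  have -> : h eta = N%:R^-1 * n%:R.
    rewrite /h; congr (_ * _).
    rewrite (eq_bigr (fun k : 'I_N => ((k < n)%N : nat)%:R)); last first.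
      move=> k _; rewrite indicE; congr (nat_of_bool _)%:R.
      apply/idP/idP => [/set_mem|kn]; last apply/mem_set; rewrite /B /=.
        by rewrite ler_pdivrMr// mulrC -/x -truncn_ge_nat.
      by rewrite ler_pdivrMr// mulrC -/x -truncn_ge_nat.
    rewrite -natr_sum; congr _%:R.
    rewrite -(big_mkord xpredT (fun k => ((k < n)%N : nat))) (big_cat_nat (leq0n n) nN)//=.
    rewrite [X in (X + _)%N](eq_big_nat _ _ (F2 := fun=> 1%N)); last by move=> k /andP[_ ->].
    rewrite [X in (_ + X)%N](eq_big_nat _ _ (F2 := fun=> 0%N)); last first.
      by move=> k /andP[nk _]; rewrite ltnNge nk.
    by rewrite sum_nat_const_nat big1_eq muln1 subn0 addn0.
  have fE : fine (f eta) = N%:R^-1 * x by rewrite /x mulrA mulVf ?mul1r// gt_eqF.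
  rewrite [X in _ <= X <= _]fE ler_pM2l ?invr_gt0//.
  have := truncn_itv x0; rewrite -/n => /andP[-> xn] /=.
  by rewrite -[X in _ + X]mulr1 -mulrDr ler_pM2l ?invr_gt0// natr1 ltW.
have mBE k : measurable_fun setT (fun eta => (\1_(B k) eta : R)%:E).
  by apply/measurable_EFinP; exact: measurable_indic.
have ind0 k eta : (0 <= (\1_(B k) eta : R)%:E)%E by rewrite lee_fin indicE; case: (_ \in _).
have mS : measurable_fun setT (fun eta => (\sum_(k < N) (\1_(B k) eta : R)%:E)%E).
  exact: emeasurable_sum.
have hE (mu : probability S R) :
    (\int[mu]_eta (h eta)%:E = (N%:R^-1)%:E * \sum_(k < N) mu (B k))%E.
  under eq_integral do rewrite /h EFinM -sumEFin.
  have S0 eta : setT eta -> (0 <= \sum_(k < N) (\1_(B k) eta : R)%:E)%E.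
    by move=> _; exact: sume_ge0.
  rewrite (ge0_integralZl mu measurableT mS S0)//.
  rewrite ge0_integral_sum//; congr (_ * _)%E.
  by apply: eq_bigr => k _; rewrite integral_indic// setIT.
have mh : measurable_fun setT (fun eta => (h eta)%:E).
  apply/measurable_EFinP; apply: measurable_funM; first exact: measurable_cst.
  by apply: measurable_sum => k; exact: measurable_indic.
have h0 eta : 0 <= h eta.
  rewrite mulr_ge0 ?invr_ge0// sumr_ge0// => k _; rewrite indicE; by case: (_ \in _).
have up : (\int[m1]_eta f eta <= \int[m1]_eta (h eta)%:E + (N%:R^-1)%:E)%E.
  apply: (@le_trans _ _ (\int[m1]_eta ((h eta)%:E + (N%:R^-1)%:E))%E).
    apply: ge0_integral_mono => eta; rewrite f0 ff -EFinD lee_fin.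
    by have /andP[] := hf eta.
  rewrite ge0_integralD//; last by move=> eta _; rewrite lee_fin.
  by rewrite integral_cst// [X in (_ * X)%E](@probability_setT _ _ _ m1) mule1.
have low : (\int[m2]_eta (h eta)%:E <= \int[m2]_eta f eta)%E.
  apply: ge0_integral_mono => eta; rewrite lee_fin h0 ff lee_fin.
  by have /andP[] := hf eta.
apply: (le_trans up); apply: leeD; last by rewrite lee_fin ltW.
apply: (@le_trans _ _ (\int[m2]_eta (h eta)%:E + s%:E)%E); last by rewrite leeD2r.
rewrite !hE.
apply: (@le_trans _ _ ((N%:R^-1)%:E * \sum_(k < N) (m2 (B k) + s%:E))%E).
  by rewrite lee_wpmul2l ?lee_fin ?invr_ge0// lee_sum// => k _; exact: m12.
rewrite big_split/= ge0_muleDr; last 2 first.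
- by apply: sume_ge0.
- by apply: sume_ge0 => k _; rewrite lee_fin.
rewrite leeD2l// sumEFin -EFinM lee_fin sumr_const card_ord -[X in _ * X]mulr_natl.
by rewrite mulrA mulVf ?mul1r// gt_eqF.
Qed.

End domination.

End approximation.

(** * Convergence of the semigroup *)

(** A discrete Gronwall argument: along equal small steps the sign is preserved, since the factor
    [1 - t * M] is nonnegative. *)
Lemma contraction_le0 (R : realType) (y : R -> R) (M delta : R) :
  0 < M -> 0 < delta -> y 0 <= 0 ->
  (forall s t, 0 <= s -> 0 < t < delta -> t * M <= 1 ->
     y (s + t) <= (1 - t * M) * y s) ->
  forall T, 0 <= T -> y T <= 0.
Proof.
move=> M0 delta0 y0 yS T T0.
have [->|Tn] := eqVneq T 0; first by [].
have {}T0 : 0 < T by rewrite lt_neqAle eq_sym Tn.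
(* More than [T / delta] steps make each one shorter than [delta], and more than [T * M] steps give
   [t * M <= 1]. *)
pose N := (Num.truncn (T / delta + T * M)).+1.
have N0 : 0 < N%:R :> R by [].
have TN : T / delta + T * M < N%:R by exact: truncnS_gt.
have Td : 0 < T / delta by rewrite divr_gt0.
have TM : 0 < T * M by rewrite mulr_gt0.
pose t := T / N%:R; have t0 : 0 < t by rewrite divr_gt0.
have td : t < delta.
  by rewrite /t ltr_pdivrMr// mulrC -ltr_pdivrMr//; lra.
have tM : t * M <= 1.
  by rewrite /t mulrAC ler_pdivrMr// mul1r; lra.
have yk k : y (k%:R * t) <= 0.
  elim: k => [|k IH]; first by rewrite mul0r.
  rewrite -natr1 mulrDl mul1r.
  apply: (le_trans (yS _ _ _ _ tM)); first by rewrite mulr_ge0// ltW.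
    by rewrite t0 td.
  by rewrite mulr_ge0_le0// subr_ge0.
have -> : T = N%:R * t by rewrite /t mulrC divfK// gt_eqF.
exact: yk.
Qed.

Lemma close_integral dT (T : measurableType dT) (R : realType) (m : probability T R)
    (u v : T -> \bar R) (s : R) : 0 <= s ->
  measurable_fun setT u -> measurable_fun setT v ->
  (forall x, 0 <= u x)%E -> (forall x, 0 <= v x)%E ->
  (forall x, close s%:E (u x) (v x)) -> close s%:E (\int[m]_x u x)%E (\int[m]_x v x)%E.
Proof.
move=> s0 mu mv u0 v0 uv.
have one_side (f g : T -> \bar R) : (forall x, 0 <= f x)%E -> (forall x, 0 <= g x)%E ->
    measurable_fun setT g -> (forall x, f x <= g x + s%:E)%E ->
    (\int[m]_x f x <= \int[m]_x g x + s%:E)%E.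
  move=> f0 g0 mg fg; apply: (@le_trans _ _ (\int[m]_x (g x + s%:E))%E).
    by apply: ge0_integral_mono => x; rewrite f0 fg.
  rewrite ge0_integralD//.
  by rewrite integral_cst// [X in (_ * X)%E](@probability_setT _ _ _ m) mule1.
by split; apply: one_side => // x; have [] := uv x.
Qed.

(** * Evolution of a measure under the semigroup *)

Section evolution.
Context (R : realType) (d : nat) (A : borelSet R).
Local Notation S := (power (site d) (spin A)).
Context (P : R -> R.-pker S ~> S).
Hypothesis markov : markov_semigroup P.
Implicit Types (m : probability S R) (f : S -> \bar R) (B : set S).

Definition evolve m t : probability S R := sval (cid (mixture_exists m (P t))).

Lemma evolveE m t B : evolve m t B = (\int[m]_eta P t eta B)%E.
Proof. by rewrite /evolve; case: cid. Qed.

Lemma integral_evolve m t f : (forall eta, 0 <= f eta)%E -> measurable_fun setT f ->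
  (\int[evolve m t]_eta f eta = \int[m]_eta \int[P t eta]_zeta f zeta)%E.
Proof. by move=> f0 mf; apply: ge0_integral_mixture => // B _; exact: evolveE. Qed.

Lemma measurable_kernel_integral t f : (forall eta, 0 <= f eta)%E ->
  measurable_fun setT f -> measurable_fun setT (fun eta => \int[P t eta]_zeta f zeta)%E.
Proof.
move=> f0 mf; apply: measurable_fun_integral_kernel => // U mU.
exact: measurable_kernel.
Qed.

Lemma integral_evolve0 m f : (forall eta, 0 <= f eta)%E -> measurable_fun setT f ->
  (\int[evolve m 0]_eta f eta = \int[m]_eta f eta)%E.
Proof.
move=> f0 mf; rewrite integral_evolve//; apply: eq_integral => eta _.
rewrite (@eq_measure_integral _ _ _ _ \d_eta)//; last by move=> B mB _; exact: markov.1.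
by rewrite integral_dirac// diracT mul1e.
Qed.

Lemma integral_evolveD m s t f : 0 <= s -> 0 <= t ->
  (forall eta, 0 <= f eta)%E -> measurable_fun setT f ->
  (\int[evolve m (s + t)]_eta f eta =
   \int[evolve m s]_eta \int[P t eta]_zeta f zeta)%E.
Proof.
move=> s0 t0 f0 mf.
have kf0 eta : (0 <= \int[P t eta]_zeta f zeta)%E by exact: integral_ge0.
rewrite (integral_evolve m (s + t) f0 mf).
rewrite (integral_evolve m s kf0 (measurable_kernel_integral t f0 mf)).
apply: eq_integral => eta _.
(* The measure [P s eta] is rebundled as a probability to serve as the mixing measure. *)
have [m' m'E] := probability_of_measure (@prob_kernel _ _ _ _ _ (P s) eta).
rewrite (@ge0_integral_mixture _ _ _ _ _ m' (P t))//; last first.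
  move=> B mB; rewrite (markov.2 _ _ _ _ s0 t0 mB); apply: eq_measure_integral => C _ _.
  exact/esym/m'E.
by apply: eq_measure_integral => C _ _; exact: m'E.
Qed.

Lemma expectE t (g : S -> R) eta : measurable_fun setT g -> (forall zeta, 0 <= g zeta <= 1) ->
  (\int[P t eta]_zeta (g zeta)%:E)%E = (expect P t g eta)%:E.
Proof.
move=> mg g01; rewrite /expect /Rintegral fineK// ge0_fin_numE; last first.
  by apply: integral_ge0 => zeta _; rewrite lee_fin; have /andP[] := g01 zeta.
apply: (@le_lt_trans _ _ (\int[P t eta]_zeta (cst 1 zeta))%E).
  apply: ge0_integral_mono => zeta; rewrite !lee_fin; exact: g01.
by rewrite integral_cst// mul1e prob_kernel ltry.
Qed.

End evolution.

Section generator.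
Context (R : realType) (d : nat) (A : borelSet R).
Local Notation S := (power (site d) (spin A)).
Context (rho : {finite_measure set (spin A) -> \bar R}).
Context (c : site d -> spin A -> S -> R).
Context (P : R -> R.-pker S ~> S).

(** As the limit defining the generator holds in sup norm, [delta] does not depend on the
    configuration, and the estimate can be integrated. *)
Lemma generator_bound F (g : S -> R) (e : R) : has_generator rho c P ->
  continuous_test F g -> 0 < e ->
  exists2 delta : R, 0 < delta & forall t eta, 0 < t < delta ->
    `|expect P t g eta - g eta - t * generator rho c g eta| <= t * e.
Proof.
move=> gen [cg mg g01 Fg] e0.
have bg : [bounded g eta | eta in [set: S]].
  exists 1; split=> // x x1 eta _; have /andP[g0 g1] := g01 eta.
  by rewrite /= ger0_norm// (le_trans g1)// ltW.
have cyl : cylinder_fun g.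
  exists F => eta zeta ez; apply: Fg => j jF.
  by have /(congr1 (fun h => h (Sub j jF : F))) := ez.
have := gen g cg bg cyl; move=> /(_ [set x | (x < e%:E)%E]).
have ne : nbhs (0%E : \bar R) [set x | (x < e%:E)%E].
  exists e => //= y; rewrite /ball/= sub0r normrN => ye.
  by rewrite lte_fin (le_lt_trans (ler_norm _)).
move=> /(_ ne) [delta /= delta0 small]; exists delta => // t eta /andP[t0 td].
have := small t; rewrite /ball/= sub0r normrN gtr0_norm// => /(_ td t0) /ltW supe.
have : `|(expect P t g eta - g eta) / t - generator rho c g eta| <= e.
  rewrite -lee_fin; apply: le_trans supe; apply: ereal_sup_ubound.
  by exists eta.
have -> : (expect P t g eta - g eta) / t - generator rho c g eta =
    (expect P t g eta - g eta - t * generator rho c g eta) / t.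
  by rewrite [RHS]mulrBl; congr (_ - _); rewrite mulrAC divff ?mul1r// gt_eqF.
by rewrite normrM normfV (gtr0_norm t0) ler_pdivrMr// [e * t]mulrC.
Qed.

End generator.

(** * Comparison of the evolved measure with the output of the algorithms *)

Section convergence.
Context (R : realType) (d : nat) (A : borelSet R).
Local Notation S := (power (site d) (spin A)).
Context (rho : {finite_measure set (spin A) -> \bar R}).
Context (c : site d -> spin A -> S -> R).
Context (pm1 : site d -> spin A -> R) (pk : condDensity d A).
Hypothesis rho_neq0 : (rho setT != 0)%E.
Hypothesis c_gt0 : forall i a eta, 0 < c i a eta.
Hypothesis measurable_c : forall i,
  measurable_fun setT (fun x : spin A * S => c i x.1 x.2).
Hypothesis c_bounded : (ereal_sup (range (fun i => ereal_sup (range (fun eta =>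
  \int[rho]_a (c i a eta)%:E)))) < +oo)%E.
Hypothesis dec : decomposition rho c pm1 pk.
Context (run : forall F : {fset site d}, algorithms rho c pm1 pk F).
Hypothesis stops1 : forall F, run_prob (run F) (stops (run F)) = 1%E.
Context (P : R -> R.-pker S ~> S).
Hypothesis process_P : process rho c P.

Implicit Types (F G : {fset site d}) (f : S -> \bar R) (m : probability S R).
Local Notation resample := (resample rho pm1 pk).
Local Notation surv := (survival rho c).
Local Notation rate := (active_rate rho c).
Local Notation total := (total_rate rho c).

Let markov : markov_semigroup P. Proof. by case: process_P. Qed.
Let has_gen : has_generator rho c P. Proof. by case: process_P. Qed.
Let rate_ge0 := active_rate_ge0 rho_neq0 c_gt0 measurable_c c_bounded.
Let total_ge0 := total_rate_ge0 rho_neq0 c_gt0 measurable_c c_bounded.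
Let surv_ge0 := survival_ge0 rho_neq0 c_gt0 measurable_c c_bounded dec.

Lemma continuous_test_local F (g : S -> R) : continuous_test F g ->
  local_test F (EFin \o g).
Proof.
move=> [cg mg g01 Fg]; split; first exact/measurable_EFinP.
- by move=> eta; rewrite /= !lee_fin.
- by move=> eta zeta ez; rewrite /= (Fg _ _ ez).
Qed.

(** The generator estimate integrated against [m P_s], hence a [delta] valid for all [s]. The loss
    term stays on the left to keep both sides nonnegative. *)
Lemma evolve_increment m F (g : S -> R) (e : R) : continuous_test F g -> 0 < e ->
  exists2 delta : R, 0 < delta & forall s t, 0 <= s -> 0 < t < delta ->
    close (t * e)%:E
      (\int[evolve P m (s + t)]_eta (g eta)%:E +
         (t * total F)%:E * \int[evolve P m s]_eta (g eta)%:E)%E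
      (\int[evolve P m s]_eta (g eta)%:E +
         t%:E * \esum_(r in [set: mark d]) ((rate F r)%:E *
           \int[evolve P m s]_eta resample r (EFin \o g) eta))%E.
Proof.
move=> tg e0; have [delta delta0 Hd] := generator_bound has_gen tg e0.
exists delta => // s t s0 td; have /andP[t0 _] := td.
have [cg mg g01 Fg] := tg.
have g0 eta : (0 <= (g eta)%:E)%E by rewrite lee_fin; have /andP[] := g01 eta.
have mgE : measurable_fun setT (fun eta => (g eta)%:E) by exact/measurable_EFinP.
have tM0 : 0 <= t * total F by rewrite mulr_ge0// ltW.
set m' := evolve P m s.
pose G eta := (\esum_(r in [set: mark d]) ((rate F r)%:E * resample r (EFin \o g) eta))%E.
have res0 r eta : (0 <= resample r (EFin \o g) eta)%E by exact: (resample_ge0 dec).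
have mres r : measurable_fun setT (resample r (EFin \o g)).
  by apply: (measurable_resample dec).
have term0 r eta : (0 <= (rate F r)%:E * resample r (EFin \o g) eta)%E.
  by rewrite mule_ge0// lee_fin.
have mterm r : measurable_fun setT (fun eta => (rate F r)%:E * resample r (EFin \o g) eta)%E.
  exact: measurable_funeM.
have G0 eta : (0 <= G eta)%E by exact: esum_ge0.
have mG : measurable_fun setT G by exact: measurable_esum.
have -> : (\esum_(r in [set: mark d]) ((rate F r)%:E *
    \int[m']_eta resample r (EFin \o g) eta) = \int[m']_eta G eta)%E.
  rewrite ge0_integral_esum//; apply: eq_esum => r _.
  by rewrite ge0_integralZl// lee_fin.
rewrite (integral_evolveD markov)// ?ltW// -/m'.
rewrite -[X in (_ + X)%E]ge0_integralZl ?lee_fin//.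
rewrite -[X in close _ _ (_ + X)%E]ge0_integralZl ?lee_fin ?ltW//.
have mexp : measurable_fun setT (fun eta => \int[P t eta]_zeta (g zeta)%:E)%E.
  exact: measurable_kernel_integral.
have exp0 eta : (0 <= \int[P t eta]_zeta (g zeta)%:E)%E by exact: integral_ge0.
have tG0 eta : (0 <= t%:E * G eta)%E by rewrite mule_ge0// lee_fin ltW.
have mtG : measurable_fun setT (fun eta => t%:E * G eta)%E by exact: measurable_funeM.
have tg0 eta : (0 <= (t * total F)%:E * (g eta)%:E)%E by rewrite mule_ge0.
have mtg : measurable_fun setT (fun eta => (t * total F)%:E * (g eta)%:E)%E.
  exact: measurable_funeM.
rewrite -!ge0_integralD//; apply: close_integral.
- by rewrite mulr_ge0// ltW.
- exact: emeasurable_funD.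
- exact: emeasurable_funD.
- by move=> eta; exact: adde_ge0.
- by move=> eta; exact: adde_ge0.
move=> eta; rewrite /G -(generatorE rho_neq0 c_gt0 measurable_c c_bounded dec)//.
rewrite (expectE P)// -!EFinM -!EFinD /close -!EFinD !lee_fin.
have := Hd t eta td; rewrite ler_norml => /andP[h1 h2].
by split; lra.
Qed.

(** Up to errors, [phi' = gamma - M phi] with [gamma] within [M q] of [M X], so [X] attracts [phi]
    at rate [M]. The excess of [phi] above [X + q + e] and its mirror below [X - q - e] both satisfy
    [contraction_le0]. *)
Lemma relaxation (phi gamma : R -> R) (M X q e delta : R) :
  0 < M -> 0 < delta -> 0 <= q -> 0 <= e ->
  (forall s, 0 <= s -> `|gamma s - M * X| <= M * q) ->
  (forall s t, 0 <= s -> 0 < t < delta ->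
     `|phi (s + t) + t * M * phi s - (phi s + t * gamma s)| <= t * (M * e)) ->
  (phi 0 = X \/ forall s, 0 <= s -> phi s = phi 0) ->
  forall T, 0 <= T -> `|phi T - X| <= q + e.
Proof.
move=> M0 delta0 q0 e0 Hgamma Hphi init T T0.
have half0 : 0 < delta / 2 < delta by rewrite divr_gt0//= ltr_pdivrMr// ltr_pMr// ltr1n.
have start : `|phi 0 - X| <= q + e.
  case: init => [->|const]; first by rewrite subrr normr0 addr_ge0.
  have [u0 ud] := andP half0.
  (* If [phi] is constant, its increment over a step [delta / 2] vanishes, which forces [M phi] to
     be within [M e] of [gamma]. *)
  have := Hphi _ _ (lexx 0) half0; rewrite add0r (const _ (ltW u0)).
  have := Hgamma _ (lexx 0).
  set u := delta / 2 in u0 *; rewrite !ler_norml => /andP[a1 a2] /andP[b1 b2].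
  have uM : 0 < u * M by rewrite mulr_gt0.
  have c1 : u * - (M * q) <= u * (gamma 0 - M * X) by rewrite ler_pM2l.
  have c2 : u * (gamma 0 - M * X) <= u * (M * q) by rewrite ler_pM2l.
  by apply/andP; split; rewrite -(ler_pM2l uM); lra.
rewrite ler_norml; move: start; rewrite ler_norml => /andP[st1 st2].
have step s t : 0 <= s -> 0 < t < delta ->
    phi (s + t) <= phi s - t * M * phi s + t * M * (X + q + e) /\
    phi s - t * M * phi s + t * M * (X - q - e) <= phi (s + t).
  move=> s0 td; have /andP[t0 _] := td.
  have := Hphi _ _ s0 td; have := Hgamma _ s0.
  rewrite !ler_norml => /andP[a1 a2] /andP[b1 b2].
  have c1 : t * - (M * q) <= t * (gamma s - M * X) by rewrite ler_pM2l.
  have c2 : t * (gamma s - M * X) <= t * (M * q) by rewrite ler_pM2l.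
  by split; lra.
have up := @contraction_le0 R (fun s => phi s - X - q - e) M delta M0 delta0.
have down := @contraction_le0 R (fun s => X - q - e - phi s) M delta M0 delta0.
apply/andP; split.
  have := down _ _ T T0; have : X - q - e - phi 0 <= 0 by lra.
  move=> h /(_ h) H; suff : X - q - e - phi T <= 0 by lra.
  by apply: H => s t s0 td _; have [] := step _ _ s0 td; lra.
have := up _ _ T T0; have : phi 0 - X - q - e <= 0 by lra.
move=> h /(_ h) H; suff : phi T - X - q - e <= 0 by lra.
by apply: H => s t s0 td _; have [] := step _ _ s0 td; lra.
Qed.

Definition sketched_or_invariant m :=
  (forall F f, local_test F f -> \int[m]_eta f eta = \int[law run F]_eta f eta)%E \/
  invariant_law P m.

Lemma integral_local0 m f : local_test fset0 f -> (\int[m]_eta f eta = f point)%E.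
Proof.
move=> [mf f01 Ff]; rewrite (eq_integral (cst (f point)))//; last by move=> eta _; exact: Ff.
by rewrite integral_cst// [X in (_ * X)%E](@probability_setT _ _ _ m) mule1.
Qed.

Lemma close_evolve n m F f t : sketched_or_invariant m -> 0 <= t -> local_test F f ->
  close (surv n F) (\int[evolve P m t]_eta f eta)%E (\int[law run F]_eta f eta)%E.
Proof.
move=> stat; elim: n F f t => [|n IH] F f t t0 tf.
  have [F0|F0] := eqVneq F fset0.
    by rewrite F0 in tf *; rewrite !integral_local0//; exact: close_refl.
  by rewrite /= (negbTE F0); apply: close_trivial; exact: probability_integral01 tf.
have [F0|F0] := eqVneq F fset0.
  by rewrite F0 in tf *; rewrite !integral_local0//; exact: close_refl.
have M0 := total_rate_gt0 rho_neq0 c_gt0 measurable_c c_bounded F0.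
have surv_fin : (fine (surv n.+1 F))%:E = surv n.+1 F.
  rewrite fineK// ge0_fin_numE//.
  have := stop_value1 rho_neq0 c_gt0 measurable_c c_bounded dec n.+1 F => /esym h.
  apply: (@le_lt_trans _ _ 1%E); last exact: ltry.
  by rewrite h leeDr// (stop_value_ge0 rho_neq0 c_gt0 measurable_c c_bounded dec).
have q0 : 0 <= fine (surv n.+1 F) by exact: fine_ge0.
have fin m' (H : {fset site d}) h : local_test H h ->
    (\int[m']_eta h eta = (fine (\int[m']_eta h eta))%:E)%E.
  move=> th; have /andP[i0 i1] := probability_integral01 m' th.
  by rewrite fineK// ge0_fin_numE// (le_lt_trans i1)// ltry.
(* Continuous tests are enough: two-sided domination extends the bound first to cylinder sets, then
   to all local tests. *)
suff main g : continuous_test F g -> close (surv n.+1 F)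
    (\int[evolve P m t]_eta (g eta)%:E)%E (\int[law run F]_eta (g eta)%:E)%E.
  rewrite -surv_fin; split; apply: local_domination tf => //;
  apply: cylinder_domination => // g /main[];
  by rewrite -surv_fin.
move=> tg; have tgE := continuous_test_local tg.
pose phi u := fine (\int[evolve P m u]_eta (g eta)%:E)%E.
pose X := fine (\int[law run F]_eta (g eta)%:E)%E.
have phiE u : (\int[evolve P m u]_eta (g eta)%:E)%E = (phi u)%:E by exact: fin tgE.
have XE : (\int[law run F]_eta (g eta)%:E)%E = X%:E by exact: fin tgE.
pose q := fine (surv n.+1 F).
pose gammaE u := (\esum_(r in [set: mark d]) ((rate F r)%:E *
  \int[evolve P m u]_eta resample r (EFin \o g) eta))%E.
(* The induction hypothesis at time [u], applied to each resampled function, which is a local test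
   but possibly discontinuous; the errors add up to [total F * q] by [survivalS]. *)
have Hgamma u : 0 <= u -> close (total F * q)%:E (gammaE u) (total F * X)%:E.
  move=> u0; rewrite EFinM surv_fin (survivalS rho_neq0 c_gt0 measurable_c c_bounded dec)//.
  rewrite [(_ * X)%:E]EFinM -XE.
  rewrite (law_first_step rho_neq0 c_gt0 measurable_c c_bounded dec stops1 tgE).
  have [mg g01 _] := tgE.
  have res0 r eta : (0 <= resample r (EFin \o g) eta)%E.
    by apply: (resample_ge0 dec) => zeta; have /andP[] := g01 zeta.
  apply: close_esum => // [r|r|r]; [exact: integral_ge0|exact: integral_ge0|].
  have [rF|rF] := boolP (r.1 \in F); last by left; rewrite /active_rate (negbTE rF).
  by right; apply: IH => //; exact: (resample_local dec).
pose gamma u := fine (gammaE u).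
have gammaEE u : 0 <= u -> gammaE u = (gamma u)%:E.
  move=> u0; rewrite /gamma fineK// ge0_fin_numE; last first.
    apply: esum_ge0 => r _; rewrite mule_ge0 ?lee_fin//; apply: integral_ge0 => eta _.
    by apply: (resample_ge0 dec) => zeta; have [_ /(_ zeta)/andP[]] := tgE.
  have [h _] := Hgamma u u0; apply: le_lt_trans h _.
  by rewrite -EFinD ltry.
rewrite phiE XE -surv_fin -/q /close -!EFinD !lee_fin.
suff : `|phi t - X| <= q.
  by rewrite ler_norml; move: (phi t) (X) (q) => a b r /andP[h1 h2]; split; lra.
apply/ler_addgt0Pr => e e0.
(* The tolerance is scaled by [total F], since [relaxation] divides the error by this rate. *)
have [delta delta0 Hd] := evolve_increment m tg (mulr_gt0 M0 e0).
apply: (@relaxation phi gamma (total F) X q e delta) => //; first exact: ltW.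
- move=> s s0; have := Hgamma s s0; rewrite gammaEE// => -[].
  rewrite -!EFinD !lee_fin ler_norml.
  by move: (gamma s) (total F * X) (total F * q) => a b r h1 h2; apply/andP; split; lra.
- move=> s u s0 ud; have := Hd s u s0 ud; rewrite -/(gammaE s) gammaEE// !phiE.
  move: (phi (s + u)) (phi s) (gamma s) (total F) => a b r M -[].
  rewrite -!EFinM -!EFinD !lee_fin ler_norml => h1 h2.
  by apply/andP; split; lra.
- have [mg g01 _] := tgE; have g0 eta : (0 <= (g eta)%:E)%E by have /andP[] := g01 eta.
  case: stat => [mlaw|minv]; [left|right].
    by rewrite /phi integral_evolve0//; rewrite /X -(mlaw _ _ tgE).
  move=> s s0; rewrite /phi; congr fine; rewrite [RHS](integral_evolve0 markov m g0 mg).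
  by apply: eq_measure_integral => B mB _; exact: etrans (evolveE P m s B) (minv s B s0 mB).
Qed.

Lemma evolve_law m F f t : sketched_or_invariant m -> 0 <= t -> local_test F f ->
  (\int[evolve P m t]_eta f eta = \int[law run F]_eta f eta)%E.
Proof.
move=> stat t0 tf; apply: close_eq => e e0.
have [N /(_ N (leqnn N)) sN] :=
  survival_small rho_neq0 c_gt0 measurable_c c_bounded dec stops1 F e0.
have [a b] := close_evolve N stat t0 tf.
by split; [apply: le_trans a _|apply: le_trans b _]; rewrite leeD2l.
Qed.

End convergence.

(** * Measures determined by cylinder sets *)

Section cylinders.
Context (R : realType) (d : nat) (A : borelSet R).
Local Notation S := (power (site d) (spin A)).
Implicit Types (F : {fset site d}) (B : set S) (m : probability S R).

Lemma local_test_indic F B : cylinder_set F B ->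
  local_test F (fun eta : S => (\1_B eta : R)%:E).
Proof.
move=> [mB FB]; split.
- by apply/measurable_EFinP; exact: measurable_indic.
- by move=> eta; rewrite !lee_fin indicE; case: (_ \in _); rewrite /= ?lexx ler01.
move=> eta zeta ez; congr EFin; rewrite !indicE; congr (_ %:R); congr nat_of_bool.
by apply/idP/idP => /set_mem h; apply/mem_set; apply: FB h => // j /ez.
Qed.

Lemma box_cylinder (s : seq (site d * set (spin A))) :
  (forall p, List.In p s -> measurable p.2) -> exists F, cylinder_set F (box s).
Proof.
move=> ms; exists [fset j in map fst s]%fset; split; first exact: measurable_box.
move=> eta zeta ez eb p ps; rewrite -ez; first exact: eb.
rewrite !inE /=; elim: s ps {ms ez eb} => //= q s IH [->|/IH h]; rewrite inE ?eqxx//.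
by rewrite h orbT.
Qed.

Lemma probability_cylinder_unique m1 m2 :
  (forall F B, cylinder_set F B -> m1 B = m2 B) ->
  forall B, measurable B -> m1 B = m2 B.
Proof.
move=> m12; apply: (@power_measure_unique _ _ _ _ measurable).
- by rewrite sigma_algebra_id//; exact: sigma_algebra_measurable.
- by rewrite [X in (X < _)%E](@probability_setT _ _ _ m1) ltry.
- by move=> s /box_cylinder[F]; exact: m12.
Qed.

End cylinders.

Theorem theorem2 (R : realType) (d : nat) (A : borelSet R)
  (rho : {finite_measure set (spin A) -> \bar R})
  (c : site d -> spin A -> power (site d) (spin A) -> R)
  (pm1 : site d -> spin A -> R)
  (pk : forall (i : site d) (k : nat),
     option (spin A) -> power (V_ i k) (spin A) -> R)
  (P : R -> R.-pker (power (site d) (spin A)) ~> (power (site d) (spin A)))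
  (run : forall F : {fset site d}, algorithms rho c pm1 pk F) :
  (rho setT != 0)%E ->
  (forall i a eta, 0 < c i a eta) ->
  (forall i, measurable_fun setT
     (fun x : spin A * power (site d) (spin A) => c i x.1 x.2)) ->
  (forall i, {ae rho, forall a, continuous (c i a)}) ->
  (ereal_sup (range (fun i => ereal_sup (range (fun eta =>
     \int[rho]_a (c i a eta)%:E)))) < +oo)%E ->
  ereal_sup (range (fun i =>
    (\int[rho]_a ereal_sup
       [set `|c i a x.1 - c i a x.2|%:E |
          x in [set x | restr (V_ i k) x.1 = restr (V_ i k) x.2]])%E))
    @[k --> \oo] --> 0%E ->
  (ereal_sup (range (fun i : site d => \esum_(j in [set j | j != i])
     ereal_sup (range (fun eta => ereal_sup (range (fun b : spin A =>
       \int[rho]_a `|c i a eta - c i a (upd eta j b)|%:E)))))) < +oo)%E ->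
  process rho c P ->
  decomposition rho c pm1 pk ->
  (forall F, run_prob (run F) (stops (run F)) = 1%E) ->
  (forall F, run_prob (run F) (success (run F)) = 1%E) /\
  exists mu : probability (power (site d) (spin A)) R,
    [/\ invariant_law P mu,
        (forall nu : probability (power (site d) (spin A)) R,
           invariant_law P nu -> forall B, measurable B -> nu B = mu B) &
        (forall (F : {fset site d}) (D : set (power F (spin A))), measurable D ->
           run_prob (run F) [set o | exists2 x, D x & run_output o = Some x] =
           mu (restr F @^-1` D))].
Proof.
move=> rho0 c0 mc _ cb _ _ procP dec stops1.
split=> [F|]; first exact: prob_success.
have integral_cylinder (m : probability (power (site d) (spin A)) R) F B :
    cylinder_set F B -> (\int[m]_eta (\1_B eta)%:E = m B)%E.
  by move=> [mB _]; rewrite integral_indic// setIT.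
have consistent F G B : {subset F <= G} -> cylinder_set F B -> law run F B = law run G B.
  move=> FG FB; rewrite -!(integral_cylinder _ F)//.
    exact: (law_consistent rho0 c0 mc cb dec stops1 FG (local_test_indic FB)).
have [mu muE] := kolmogorov consistent.
have mu_cylinder F B : cylinder_set F B -> mu B = law run F B.
  by move=> /cylinder_set_restrP[D mD ->]; exact: muE.
have mu_law F f : local_test F f -> (\int[mu]_eta f eta = \int[law run F]_eta f eta)%E.
  (* Domination with error 0 in both directions turns equality on cylinder sets into equality of
     integrals. *)
  move=> tf; apply/eqP; rewrite eq_le; apply/andP; split; rewrite -[leRHS]adde0;
  by apply: local_domination tf => // B FB; rewrite adde0 (mu_cylinder F).
have evolve_cylinder m t F B : sketched_or_invariant run P m -> 0 <= t -> cylinder_set F B ->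
    evolve P m t B = mu B.
  move=> stat t0 FB; rewrite -!(integral_cylinder _ F)// (mu_law F); last first.
    exact: local_test_indic.
  by apply: (evolve_law rho0 c0 mc cb dec stops1 procP) => //; exact: local_test_indic.
have mu_stat : sketched_or_invariant run P mu by left.
exists mu; split.
- move=> t B t0 mB; rewrite -evolveE; apply: probability_cylinder_unique mB => F C FC.
  exact: evolve_cylinder FC.
- move=> nu nu_inv; apply: probability_cylinder_unique => F B FB.
  (* Time 0 suffices: for an invariant measure the comparison rests on the constancy of [phi], so it
     already identifies the measure at the start. *)
  rewrite -(evolve_cylinder nu 0 F B)//; last by right.
  by rewrite evolveE nu_inv//; case: FB.
- by move=> F D mD; rewrite prob_run_output// muE// lawE.
Qed.
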